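(* Let $p$ be $\infty$ or a prime number, $K$ a number field, and $\Omega=(\omega_{ij})$ an $n\times n$ matrix with nonnegative integer entries. Let $f_i(\mathbf{z}),g_h(\mathbf{z})\in K[[z_1,\ldots,z_n]]$ ($1\leq i\leq l$, $1\leq h\leq m$) with $g_h(\mathbf{0})\neq0$ converge in an $n$-polydisc $U$ around the origin of $\mathbb{C}_p^n$. Suppose that $${}^t(f_1(\mathbf{z}),\ldots,f_l(\mathbf{z}))=A\,{}^t(f_1(\Omega\mathbf{z}),\ldots,f_l(\Omega\mathbf{z}))+{}^t(b_1(\mathbf{z}),\ldots,b_l(\mathbf{z})),$$ where $A$ is an $l\times l$ matrix with entries in $K$ and $b_i(\mathbf{z})\in K(z_1,\ldots,z_n)$, and that $g_h(\mathbf{z})=e_h(\mathbf{z})g_h(\Omega\mathbf{z})$ with $e_h(\mathbf{z})\in K(z_1,\ldots,z_n)$ ($1\leq h\leq m$). Let $\boldsymbol{\alpha}=(\alpha_1,\ldots,\alpha_n)\in U$ have nonzero algebraic components. Suppose that $\Omega$ and $\boldsymbol{\alpha}$ satisfy conditions (I), (II), (III)$_p$, (IV)$_p$ (defined in the context), and that $b_i(\Omega^k\boldsymbol{\alpha})$, $e_h(\Omega^k\boldsymbol{\alpha})$ are defined and $e_h(\Omega^k\boldsymbol{\alpha})\neq0$ for all $i,h$ and all $k\geq0$. If the functions $f_1(\mathbf{z}),\ldots,f_l(\mathbf{z}),g_1(\mathbf{z}),\ldots,g_m(\mathbf{z})$ are algebraically independent over $K(z_1,\ldots,z_n)$, then the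 numbers $f_1(\boldsymbol{\alpha}),\ldots,f_l(\boldsymbol{\alpha}),g_1(\boldsymbol{\alpha}),\ldots,g_m(\boldsymbol{\alpha})$ of $\overline{\mathbb{Q}}_p$ are algebraically independent over $\mathbb{Q}$.
   Context: $|\cdot|_p$ is the usual absolute value ($p=\infty$) or standard $p$-adic absolute value; $\mathbb{C}_p$ is the completion of the algebraic closure $\overline{\mathbb{Q}}_p$ of $\mathbb{Q}_p$ ($\mathbb{C}_\infty=\mathbb{C}$); $\overline{\mathbb{Q}}$ is embedded in $\mathbb{C}_p$. A number field is a finite extension of $\mathbb{Q}$ inside $\overline{\mathbb{Q}}$. For $\mathbf{z}\in\mathbb{C}_p^n$, $\Omega\mathbf{z}:=\left(\prod_{j}z_j^{\omega_{1j}},\ldots,\prod_jz_j^{\omega_{nj}}\right)$, iterated as $\Omega^k\mathbf{z}$; write $\Omega^k\boldsymbol{\alpha}=(\alpha_1^{(k)},\ldots,\alpha_n^{(k)})$. Let $\rho$ be the maximum of the archimedean absolute values of the eigenvalues of $\Omega$. (I): $\Omega$ is nonsingular and none of its eigenvalues is a root of unity. (II): every entry of $\Omega^k$ is $O(\rho^k)$ as $k\to\infty$. (III)$_p$: there is $c>0$ with $\log|\alpha_i^{(k)}|_p\leq-c\rho^k$ for $1\leq i\leq n$ and all sufficiently large $k$. (IV)$_\infty$ (for $p=\infty$): for every nonzero $f\in\mathbb{C}[[z_1,\ldots,z_n]]$ convergent near the origin, $f(\Omega^k\boldsymbol{\alpha})\neq0$ for infinitely many positive integers $k$. (IV)$_p$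 (for $p$ prime): for every nonzero $f\in\mathbb{C}_p[[z_1,\ldots,z_n]]$ convergent near the origin and every positive integer $a$, $f(\Omega^{ak}\boldsymbol{\alpha})\neq0$ for infinitely many positive integers $k$. *)

(* Defs.v *)
From HB Require Import structures.
From mathcomp Require Import all_boot all_order all_algebra all_field.
From mathcomp Require Import complex mpoly.
From mathcomp Require Import boolp classical_sets reals exp.

Set Implicit Arguments.
Unset Strict Implicit.
Unset Printing Implicit Defensive.

Import Order.TTheory GRing.Theory Num.Theory.
Local Open Scope ring_scope.

Notation "x %:F" := (@FracField.tofrac _ x) : ring_scope.

(* The inclusion of fields of fractions induced by an inclusion of domains.   *)
Section MapFrac.
Variables (R S : idomainType) (h : {rmorphism R -> S}).
Hypothesis h_inj : injective h.

Definition map_frac (x : {fraction R}) : {fraction S} :=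
  (h \n_(repr x))%:F / (h \d_(repr x))%:F.

Lemma frac_repr (x : {fraction R}) :
  x = (\n_(repr x))%:F / (\d_(repr x))%:F /\ \d_(repr x) != 0.
Proof.
have d0 := denom_ratioP (repr x); split=> //.
have dF0 : (\d_(repr x))%:F != 0 :> {fraction R} by rewrite tofrac_eq0.
apply: (mulIf dF0); rewrite divfK //.
rewrite -{1}[x]reprK.
rewrite !piE.
apply/eqmodP; rewrite /= FracField.equivfE /= /FracField.mulf.
by rewrite !numden_Ratio ?mulr1 ?oner_eq0 // mulrC.
Qed.

Lemma fracP (x : {fraction R}) : exists a c, c != 0 /\ x = a%:F / c%:F.
Proof. by have [e d0] := frac_repr x; exists \n_(repr x), \d_(repr x). Qed.

Lemma map_fracE (x y : R) : y != 0 ->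
  map_frac (x%:F / y%:F) = (h x)%:F / (h y)%:F.
Proof.
move=> y0; rewrite /map_frac; set z := x%:F / y%:F.
have [ez d0] := frac_repr z.
move: ez d0; set a := \n_(repr z); set d := \d_(repr z); rewrite /z => ez d0.
have inj0 u : u != 0 -> (h u)%:F != 0 :> {fraction S}.
  by move=> u0; rewrite tofrac_eq0 -(rmorph0 h) (inj_eq h_inj).
have yF0 : y%:F != 0 :> {fraction R} by rewrite tofrac_eq0.
have dF0 : d%:F != 0 :> {fraction R} by rewrite tofrac_eq0.
have /eqP e : a * y == x * d.
  by rewrite -tofrac_eq !rmorphM /= -eqr_div // ez.
apply/eqP; rewrite eqr_div ?inj0 // -!tofracM -!rmorphM e //.
Qed.

Lemma map_frac_tofrac (x : R) : map_frac x%:F = (h x)%:F.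
Proof.
by rewrite -[x%:F]divr1 -tofrac1 map_fracE ?oner_eq0 // rmorph1 tofrac1 divr1.
Qed.

Lemma map_frac_zmod : zmod_morphism map_frac.
Proof.
move=> u v; have [a [c [c0 ->]]] := fracP u; have [b [d [d0 ->]]] := fracP v.
have inj0 w : w != 0 -> (h w)%:F != 0 :> {fraction S}.
  by move=> w0; rewrite tofrac_eq0 -(rmorph0 h) (inj_eq h_inj).
have F0 w : w != 0 -> w%:F != 0 :> {fraction R} by rewrite tofrac_eq0.
have -> : a%:F / c%:F - b%:F / d%:F = (a * d - b * c)%:F / (c * d)%:F.
  by rewrite -[in LHS]mulNr addf_div ?F0 // tofracB !tofracM mulNr.
rewrite !map_fracE ?mulf_neq0 // -[in RHS]mulNr addf_div ?inj0 //.
by rewrite rmorphB !rmorphM tofracB !tofracM mulNr.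
Qed.

Lemma map_frac_monoid : monoid_morphism map_frac.
Proof.
split; first by rewrite -tofrac1 map_frac_tofrac rmorph1 tofrac1.
move=> u v; have [a [c [c0 ->]]] := fracP u; have [b [d [d0 ->]]] := fracP v.
rewrite mulf_div -!tofracM !map_fracE ?mulf_neq0 // mulf_div.
by rewrite !rmorphM.
Qed.

End MapFrac.

(* Formal power series in n variables: arbitrary families of coefficients     *)
(* indexed by the exponents 'X_{1..n}.                                        *)
Record powser (n : nat) (R : Type) := PowSer { pcoef : 'X_{1..n} -> R }.

HB.instance Definition _ n R := gen_eqMixin (powser n R).
HB.instance Definition _ n R := gen_choiceMixin (powser n R).

Section PowSerRing.
Variables (n : nat) (R : idomainType).
Implicit Types (f g : powser n R) (m : 'X_{1..n}).

Lemma powserP f g : (forall m, pcoef f m = pcoef g m) -> f = g.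
Proof. by case: f g => [f] [g] /= /funext ->. Qed.

Definition ps_zero : powser n R := PowSer (fun=> 0).
Definition ps_one : powser n R := PowSer (fun m => (m == 0%MM)%:R).
Definition ps_opp f : powser n R := PowSer (fun m => - pcoef f m).
Definition ps_add f g : powser n R := PowSer (fun m => pcoef f m + pcoef g m).
Definition ps_mul f g : powser n R := PowSer (fun m =>
  \sum_(k : 'X_{1..n < (mdeg m).+1, (mdeg m).+1} | m == (k.1 + k.2)%MM)
    pcoef f k.1 * pcoef g k.2).

Lemma ps_addA : associative ps_add.
Proof. by move=> f g h; apply: powserP => m /=; rewrite addrA. Qed.
Lemma ps_addC : commutative ps_add.
Proof. by move=> f g; apply: powserP => m /=; rewrite addrC. Qed.
Lemma ps_add0 : left_id ps_zero ps_add.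
Proof. by move=> f; apply: powserP => m /=; rewrite add0r. Qed.
Lemma ps_addN : left_inverse ps_zero ps_opp ps_add.
Proof. by move=> f; apply: powserP => m /=; rewrite addNr. Qed.

HB.instance Definition _ :=
  GRing.isZmodule.Build (powser n R) ps_addA ps_addC ps_add0 ps_addN.

Definition ps_trunc d f : {mpoly R[n]} :=
  \sum_(k : 'X_{1..n < d}) pcoef f k *: 'X_[k].

Lemma ps_truncE d f m : (mdeg m < d)%N -> (ps_trunc d f)@_m = pcoef f m.
Proof.
move=> lt; rewrite raddf_sum /= (bigD1 (BMultinom lt)) //= big1 => [|k ne].
  by rewrite mcoeffZ mcoeffX eqxx mulr1 addr0.
by rewrite mcoeffZ mcoeffX; move: ne; rewrite -val_eqE /= => /negPf ->; rewrite mulr0.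
Qed.

Lemma mcoeffM_low (p q p' q' : {mpoly R[n]}) m :
    (forall k, (mdeg k <= mdeg m)%N -> p@_k = p'@_k) ->
    (forall k, (mdeg k <= mdeg m)%N -> q@_k = q'@_k) ->
  (p * q)@_m = (p' * q')@_m.
Proof.
move=> ep eq; rewrite !mcoeffM; apply: eq_bigr => -[[a la] [b lb]] /= _.
by rewrite ep ?eq.
Qed.

Lemma ps_mulE d f g m : (mdeg m < d)%N ->
  pcoef (ps_mul f g) m = (ps_trunc d f * ps_trunc d g)@_m.
Proof.
move=> lt; rewrite mcoeffM /=; apply: eq_bigr => -[[a la] [b lb]] /= _.
by rewrite !ps_truncE // (leq_trans _ lt).
Qed.

Lemma ps_mulA : associative ps_mul.
Proof.
move=> f g h; apply: powserP => m; have lt := ltnSn (mdeg m).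
rewrite !(ps_mulE _ _ lt).
set d := (mdeg m).+1.
transitivity (ps_trunc d f * (ps_trunc d g * ps_trunc d h))@_m.
  apply: mcoeffM_low => // k lek; rewrite ps_truncE // (@ps_mulE d) //.
rewrite mulrA; apply: mcoeffM_low => // k lek.
by rewrite ps_truncE // (@ps_mulE d).
Qed.

Lemma ps_mulC : commutative ps_mul.
Proof.
move=> f g; apply: powserP => m; have lt := ltnSn (mdeg m).
by rewrite !(ps_mulE _ _ lt) mulrC.
Qed.

Lemma ps_mul1 : left_id ps_one ps_mul.
Proof.
move=> f; apply: powserP => m; have lt := ltnSn (mdeg m).
rewrite (ps_mulE _ _ lt) -[RHS](ps_truncE _ lt) -[in RHS](mul1r (ps_trunc _ f)).
apply: mcoeffM_low => // k lek.
by rewrite ps_truncE // mcoeff1.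
Qed.

Lemma ps_mulD : left_distributive ps_mul ps_add.
Proof.
move=> f g h; apply: powserP => m /=; rewrite -big_split /=.
by apply: eq_bigr => k _; rewrite mulrDl.
Qed.

Lemma ps_one_neq0 : ps_one != ps_zero.
Proof.
apply/eqP => /(congr1 (fun f => pcoef f 0%MM)) /= /eqP.
by rewrite eqxx oner_eq0.
Qed.

HB.instance Definition _ := GRing.Zmodule_isComNzRing.Build (powser n R)
  ps_mulA ps_mulC ps_mul1 ps_mulD ps_one_neq0.

Lemma ps_neq0_lead f : f != 0 ->
  exists m, pcoef f m != 0 /\ forall k, (k < m)%O -> pcoef f k = 0.
Proof.
move=> f0; have [m] : exists m, pcoef f m != 0.
  apply: contrapT => h; case/eqP: f0; apply: powserP => m /=.
  by apply/eqP; apply: contrapT => /negP hm; apply: h; exists m.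
elim/(@ltmwf n): m => m ih fm.
have [[k [km fk]]|h] := pselect (exists k, (k < m)%O /\ pcoef f k != 0).
  exact: ih km fk.
exists m; split=> // k km; apply/eqP; apply: contrapT => /negP hk.
by apply: h; exists k.
Qed.

Lemma ps_mul_lead f g : f != 0 -> g != 0 -> f * g != 0.
Proof.
move=> /ps_neq0_lead[a [fa fl]] /ps_neq0_lead[b [gb gl]].
apply/eqP => /(congr1 (fun h => pcoef h (a + b)%MM)) /= /eqP.
have lea : (mdeg a < (mdeg (a + b)).+1)%N by rewrite mdegD ltnS leq_addr.
have leb : (mdeg b < (mdeg (a + b)).+1)%N by rewrite mdegD ltnS leq_addl.
rewrite (bigD1 (BMultinom lea, BMultinom leb)) //= big1 ?addr0.
  by rewrite mulf_eq0 (negPf fa) (negPf gb).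
move=> [[c lc] [d ld]] /= /andP[/eqP e ne].
have [ca|ca|ca] := ltgtP c a; first by rewrite fl ?mul0r.
  have [db|db|db] := ltgtP d b; first by rewrite gl ?mulr0.
    by have := ltm_add ca db; rewrite -e ltxx.
  by have := ltmc_add2l a c b; rewrite ca -{2}db -e ltxx.
subst c; move: e => /eqP; rewrite eqm_add2l => /eqP e; subst d.
by case/eqP: ne; congr pair; apply: val_inj.
Qed.

Definition ps_unit : pred (powser n R) := fun f => `[< exists g, g * f = 1 >].
Definition ps_inv f : powser n R := xget f [set g | g * f = 1].

Lemma ps_mulVr : {in ps_unit, left_inverse 1 ps_inv *%R}.
Proof.
by move=> f /asboolP[g gf]; rewrite /ps_inv; case: xgetP => [h _ //|/(_ g)].
Qed.
Lemma ps_unitP f g : g * f = 1 -> ps_unit f.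
Proof. by move=> h; apply/asboolP; exists g. Qed.
Lemma ps_inv_out : {in [predC ps_unit], ps_inv =1 id}.
Proof.
move=> f /negP nu; rewrite /ps_inv; case: xgetP => // h _ /= hf.
by case: nu; apply/asboolP; exists h.
Qed.

HB.instance Definition _ := GRing.ComNzRing_hasMulInverse.Build (powser n R)
  ps_mulVr ps_unitP ps_inv_out.

Lemma ps_integral : GRing.integral_domain_axiom (powser n R).
Proof.
move=> f g fg; apply: contrapT => /negP; rewrite negb_or => /andP[f0 g0].
by move: (ps_mul_lead f0 g0); rewrite fg eqxx.
Qed.

HB.instance Definition _ :=
  GRing.ComUnitRing_isIntegral.Build (powser n R) ps_integral.

(* K[z_1, ..., z_n] inside K[[z_1, ..., z_n]].                                *)
Definition poly_ps (p : {mpoly R[n]}) : powser n R :=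
  PowSer (fun m => p@_m).

Lemma poly_ps_zmod : zmod_morphism poly_ps.
Proof. by move=> p q; apply: powserP => m /=; rewrite mcoeffB. Qed.
Lemma poly_ps_monoid : monoid_morphism poly_ps.
Proof.
split=> [|p q]; apply: powserP => m /=; first by rewrite mcoeff1.
by rewrite mcoeffM.
Qed.
HB.instance Definition _ :=
  GRing.isZmodMorphism.Build {mpoly R[n]} (powser n R) poly_ps poly_ps_zmod.
HB.instance Definition _ :=
  GRing.isMonoidMorphism.Build {mpoly R[n]} (powser n R) poly_ps poly_ps_monoid.

Lemma poly_ps_inj : injective poly_ps.
Proof.
by move=> p q e; apply/mpolyP => m; rewrite -[LHS]/(pcoef (poly_ps p) m) e.
Qed.

(* K(z_1, ..., z_n) inside the field of fractions of K[[z_1, ..., z_n]].      *)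
Definition ratfun_ps : {fraction {mpoly R[n]}} -> {fraction (powser n R)} :=
  map_frac poly_ps.

HB.instance Definition _ := GRing.isZmodMorphism.Build
  {fraction {mpoly R[n]}} {fraction (powser n R)} ratfun_ps
  (map_frac_zmod poly_ps_inj).
HB.instance Definition _ := GRing.isMonoidMorphism.Build
  {fraction {mpoly R[n]}} {fraction (powser n R)} ratfun_ps
  (map_frac_monoid poly_ps_inj).

End PowSerRing.

Definition map_ps n (R S : Type) (h : R -> S) (f : powser n R) : powser n S :=
  PowSer (fun m => h (pcoef f m)).

(* (Omega z)_i = prod_j z_j ^ omega_ij sends the monomial z^k to z^(k Omega). *)
Definition mnm_act n (Omega : 'M[nat]_n) (k : 'X_{1..n}) : 'X_{1..n} :=
  [multinom (\sum_(i < n) k i * Omega i j)%N | j < n].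

(* f(Omega z).  When Omega has no zero row, as is the case for nonsingular    *)
(* Omega, mdeg k <= mdeg (mnm_act Omega k), so the bound on mdeg k discards   *)
(* nothing.                                                                   *)
Definition subst_ps n (R : idomainType) (Omega : 'M[nat]_n) (f : powser n R) :
    powser n R :=
  PowSer (fun m =>
    \sum_(k : 'X_{1..n < (mdeg m).+1} | mnm_act Omega k == m) pcoef f k).

Definition vec_act n (L : fieldType) (Omega : 'M[nat]_n) (z : 'I_n -> L) :
    'I_n -> L :=
  fun i => \prod_(j < n) z j ^+ Omega i j.

(* v_1, ..., v_N in L are algebraically independent over F.                   *)
Definition alg_independent (F L : fieldType) (h : F -> L) N (v : 'I_N -> L) :=
  forall P : {mpoly F[N]}, mmap h v P = 0 -> P = 0.

Definition join_fam (T : Type) l m (f : 'I_l -> T) (g : 'I_m -> T) :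
    'I_(l + m) -> T :=
  fun i => match split i with inl j => f j | inr k => g k end.

(* The rational function q is defined at x, with value y.                     *)
Definition ratfun_value n (K L : fieldType) (h : K -> L)
    (q : {fraction {mpoly K[n]}}) (x : 'I_n -> L) (y : L) :=
  exists N D : {mpoly K[n]},
    [/\ q = N%:F / D%:F, mmap h x D != 0 & y = mmap h x N / mmap h x D].

Section AbsoluteValues.
Variable R : realType.

Definition is_absval (F : fieldType) (v : F -> R) :=
  [/\ forall x, 0 <= v x, forall x, (v x == 0) = (x == 0),
      {morph v : x y / x * y} & forall x y, v (x + y) <= v x + v y].

Definition abs_complete (F : fieldType) (v : F -> R) :=
  forall u : nat -> F,
    (forall e : R, 0 < e -> exists N, forall i j,
       (N <= i)%N -> (N <= j)%N -> v (u i - u j) < e) ->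
  exists x, forall e : R, 0 < e -> exists N, forall i,
    (N <= i)%N -> v (u i - x) < e.

Definition is_completion (F L : fieldType) (vF : F -> R) (vL : L -> R)
    (h : F -> L) :=
  [/\ is_absval vL, forall x, vL (h x) = vF x,
      forall y (e : R), 0 < e -> exists x, vL (y - h x) < e &
      abs_complete vL].

Definition is_alg_closure (F L : fieldType) (h : F -> L) :=
  GRing.closed_field_axiom L /\ forall y, algebraicOver h y.

Definition padic_abs (p : nat) (x : rat) : R :=
  if x == 0 then 0
  else p%:R ^+ logn p `|denq x|%N / p%:R ^+ logn p `|numq x|%N.

(* Q -> Q_p -> \bar Q_p -> C_p: completion, algebraic closure, completion.    *)
(* These are determined up to isometric isomorphism.                          *)
Record padic_tower (p : nat) := PadicTower {
  Qp : fieldType;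
  Qp_abs : Qp -> R;
  rat_Qp : {rmorphism rat -> Qp};
  Qp_completion : is_completion (padic_abs p) Qp_abs rat_Qp;
  Qpbar : fieldType;
  Qpbar_abs : Qpbar -> R;
  Qp_Qpbar : {rmorphism Qp -> Qpbar};
  Qpbar_closure : is_alg_closure Qp_Qpbar;
  Qpbar_absval : is_absval Qpbar_abs;
  Qpbar_extends : forall x, Qpbar_abs (Qp_Qpbar x) = Qp_abs x;
  Cpadic : fieldType;
  Cpadic_abs : Cpadic -> R;
  Qpbar_Cpadic : {rmorphism Qpbar -> Cpadic};
  Cpadic_completion : is_completion Qpbar_abs Cpadic_abs Qpbar_Cpadic
}.

Variant place := Infinite | Finite (p : nat) of prime p.

Variant Cp_model : place -> Type :=
| ComplexModel : Cp_model Infinite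
| PadicModel p (p_prime : prime p) of padic_tower p : Cp_model (Finite p_prime).

Definition Cp pl (M : Cp_model pl) : fieldType :=
  match M with
  | ComplexModel => R[i]
  | PadicModel _ _ T => Cpadic T
  end.

Definition Cp_abs pl (M : Cp_model pl) : Cp M -> R :=
  match M return Cp M -> R with
  | ComplexModel => fun z : R[i] => Normc.normc z
  | PadicModel _ _ T => @Cpadic_abs _ T
  end.

(* Membership in \bar Q_p, where \bar Q_oo = C.                               *)
Definition in_Qpbar pl (M : Cp_model pl) : Cp M -> Prop :=
  match M return Cp M -> Prop with
  | ComplexModel => fun _ => True
  | PadicModel _ _ T => fun x => exists y, x = Qpbar_Cpadic T y
  end.

Section Evaluation.
Variables (L : fieldType) (v : L -> R) (n : nat).
Implicit Types (f : powser n L) (z : 'I_n -> L).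

(* Unconditional summation over all exponents.                                *)
Definition ps_sum f z (s : L) :=
  forall e : R, 0 < e -> exists S0 : seq 'X_{1..n},
    forall S : seq 'X_{1..n}, uniq S -> {subset S0 <= S} ->
      v (\sum_(k <- S) pcoef f k * mmap1 z k - s) < e.

(* Junk value 0 when the series does not converge at z.                       *)
Definition ps_val f z : L := xget 0 (ps_sum f z).

Definition polydisc (r : 'I_n -> R) z := forall j, v (z j) < r j.

Definition converges_on (U : ('I_n -> L) -> Prop) f :=
  forall z, U z -> exists s, ps_sum f z s.

Definition converges_near0 f :=
  exists2 r : 'I_n -> R, (forall j, 0 < r j) & converges_on (polydisc r) f.

End Evaluation.

Definition infinitely_many (P : nat -> Prop) :=
  forall N, exists2 k, (N < k)%N & P k.

Section Conditions.
Variables (n : nat) (Omega : 'M[nat]_n).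

Definition is_eigen (a : R[i]) : Prop :=
  eigenvalue (map_mx (fun k => k%:R) Omega : 'M[R[i]]_n) a.

(* The supremum of a finite set, nonempty when n > 0, i.e. its maximum.       *)
Definition spectral_radius : R :=
  sup [set Normc.normc a | a in is_eigen]%classic.

Definition cond_I :=
  \det (map_mx (fun k => k%:R) Omega : 'M[rat]_n) != 0 /\
  forall a, is_eigen a -> forall k, (0 < k)%N -> a ^+ k != 1.

Definition cond_II :=
  forall i j, exists c : R, exists N, forall k, (N <= k)%N ->
    ((Omega ^+ k) i j)%:R <= c * spectral_radius ^+ k.

Variables (pl : place) (M : Cp_model pl).

Definition cond_III (alpha : 'I_n -> Cp M) :=
  exists2 c : R, 0 < c & exists N, forall k, (N <= k)%N -> forall i,
    ln (Cp_abs (iter k (vec_act Omega) alpha i)) <= - c * spectral_radius ^+ k.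

Definition cond_IV (alpha : 'I_n -> Cp M) :=
  forall f : powser n (Cp M), f != 0 -> converges_near0 (@Cp_abs _ M) f ->
  match pl with
  | Infinite => infinitely_many (fun k =>
      ps_val (@Cp_abs _ M) f (iter k (vec_act Omega) alpha) != 0)
  | Finite _ _ => forall a, (0 < a)%N -> infinitely_many (fun k =>
      ps_val (@Cp_abs _ M) f (iter (a * k) (vec_act Omega) alpha) != 0)
  end.

End Conditions.
End AbsoluteValues.

(* Main.v *)
Require Import Defs.
From HB Require Import structures.
From mathcomp Require Import all_boot all_order all_algebra all_field.
From mathcomp Require Import perm complex mpoly.
From mathcomp Require Import boolp classical_sets reals sequences exp.
From mathcomp Require Import ring lra zify.

Set Implicit Arguments.
Unset Strict Implicit.
Unset Printing Implicit Defensive.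

Import Order.TTheory GRing.Theory Num.Theory.
Local Open Scope ring_scope.

(* Mahler's method. Suppose that P(f(alpha), g(alpha)) = 0 with P <> 0.       *)
(* Iterating the functional equations, f(alpha) = A^k f(Omega^k alpha) + u_k  *)
(* and g(alpha) = w_k g(Omega^k alpha), where t_k = (u_k, w_k) has            *)
(* logarithmic height O(rho^k). So F_k(z; t) = P(A^k f(z) + u, w g(z))        *)
(* vanishes at z = Omega^k alpha, t = t_k. A dimension count gives a nonzero  *)
(* combination sum_{j < p} P_{j,k}(z; t) F_k(z; t)^j vanishing at z = 0 to an *)
(* order I much larger than p, the P_{j,k} being polynomials of degree < p in *)
(* each variable; their coefficients are sequences in k found by McCoy's      *)
(* theorem in the ring of exponential polynomials, of height exp(O(k)).       *)
(* Dividing by a power of F_k, which does not vanish at z = 0, we may take    *)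
(* P_{0,k} nonzero. At (Omega^k alpha, t_k) only this term survives: it is at *)
(* most exp(-c I rho^k), and by Liouville's inequality at least               *)
(* exp(-C p rho^k) or zero, hence zero for all large k. Written in terms of   *)
(* f and g, this is a sequence of functions gamma_k with                      *)
(* gamma_k(Omega^k alpha) = 0, annihilated by a constant coefficient          *)
(* recurrence in k. By (IV) and the fact that y(Omega z) = mu y(z) + c forces *)
(* y to be constant, it vanishes identically, against the algebraic           *)
(* independence of f and g.                                                   *)

(** * Exponential polynomials and linear systems over sequences *)

(** The contradiction comes from two estimates for one number. Let theta_k be the value at (Omega^k
    alpha, t_k) of the surviving polynomial P_{0,k}. It is the value at Omega^k alpha of a power
    series of order at least p(s+1), where s is chosen first and p afterwards, so [ps_val_order_le]
    and the decay (III) bound it by exp(-c p (s+1) rho^k + O(k)). It also lies in a fixed number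
    field, and [lheight_box_sum] gives it a height C p rho^k + O(k) with C independent of s and p,
    so by Liouville's inequality [lheight_absv_ge] it is zero or at least exp(-C' p rho^k - O(k)). A
    large s leaves only theta_k = 0. The coefficients of P_{0,k} contribute just O(k) because
    [ev_kernel] solves the linear system of [auxiliary_series] for all k at once, inside the ring
    [good_seq].

    The vanishing of theta_k for large k must now contradict independence. The vectors t_k need not
    satisfy a recurrence, but along the orbit u_k = f(alpha) - A^k f and w_k = g(alpha) / g; this
    replacement produces the functions [gam], which depend on k through exponential polynomials
    ([gam_exp]). [vanishing_theorem] shows by induction on the order of the recurrence that such
    functions vanish identically. Its analytic input is (IV), its algebraic input [mahler_constant]:
    if y(Omega z) = mu y(z) + c, then comparing the least exponents of y(Omega^j z) for two values
    of j supplied by [dickson] gives a vector with the same image under two powers of Omega, which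
    (I) forbids unless it is zero. Finally [gam_eq0] recovers the coefficients of P_{0,k} from [gam]
    by algebraic independence, so they would all be zero.

    The argument is carried out in [core_independence] for any complete absolute value with |d| >=
    1/d on positive integers d, which covers C and C_p together. [additive_iterated_value] and
    [multiplicative_iterated_value] evaluate the iterated functional equations, and [in_Qpbar_limit]
    places the values in the algebraic closure of Q_p. *)

Section ShiftOperators.
Variable B : comNzRingType.
Implicit Types (c d : nat -> B) (s t : seq B) (x y : B).

Definition shift_sub x c : nat -> B := fun k => c k.+1 - x * c k.
(** With S the shift, this is the product of the operators S - x: a constant coefficient recurrence
    given by its characteristic roots with multiplicity, which allows induction on its order. *)
Definition shift_subs s c : nat -> B := foldl (fun c x => shift_sub x c) c s.

Lemma shift_subC x y c :
  shift_sub x (shift_sub y c) = shift_sub y (shift_sub x c).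
Proof. by apply: funext => k; rewrite /shift_sub; ring. Qed.

Lemma shift_subs_cat s t c :
  shift_subs (s ++ t) c = shift_subs t (shift_subs s c).
Proof. exact: foldl_cat. Qed.

Lemma shift_subs_rcons s x c :
  shift_subs (rcons s x) c = shift_sub x (shift_subs s c).
Proof. by rewrite /shift_subs foldl_rcons. Qed.

Lemma shift_subs_sub s x c :
  shift_subs s (shift_sub x c) = shift_sub x (shift_subs s c).
Proof. by elim: s c => //= y s ih c; rewrite shift_subC ih. Qed.

Lemma shift_subs_comm s t c :
  shift_subs s (shift_subs t c) = shift_subs t (shift_subs s c).
Proof. by elim: t c => //= y t ih c; rewrite ih shift_subs_sub. Qed.

Lemma shift_subs_shift s c :
  shift_subs s (fun k => c k.+1) = (fun k => shift_subs s c k.+1).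
Proof. by elim: s c => //= y s ih c; rewrite -ih. Qed.

Lemma shift_subsD s c d :
  shift_subs s (fun k => c k + d k) =
    (fun k => shift_subs s c k + shift_subs s d k).
Proof.
elim: s c d => //= y s ih c d; rewrite -ih; congr shift_subs.
by apply: funext => k; rewrite /shift_sub; ring.
Qed.

Lemma shift_subsZ s x c :
  shift_subs s (fun k => x * c k) = (fun k => x * shift_subs s c k).
Proof.
elim: s c => //= y s ih c; rewrite -ih; congr shift_subs.
by apply: funext => k; rewrite /shift_sub; ring.
Qed.

Lemma shift_subs0 s : shift_subs s (fun=> 0) = fun=> 0.
Proof.
elim: s => //= y s; rewrite (_ : shift_sub y _ = fun=> 0) //.
by apply: funext => k; rewrite /shift_sub mulr0 subr0.
Qed.

End ShiftOperators.

Lemma shift_subs_rmorph (B C : comNzRingType) (h : {rmorphism B -> C})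
    (s : seq B) (c : nat -> B) :
  shift_subs (map h s) (h \o c) = h \o shift_subs s c.
Proof.
elim: s c => //= x s ih c; rewrite -ih; congr shift_subs.
by apply: funext => k; rewrite /shift_sub /= rmorphB rmorphM.
Qed.

Section ExponentialPolynomials.
Variables (L : fieldType) (B : comNzRingType) (h : {rmorphism L -> B}).
Implicit Types (c d : nat -> B) (s t : seq L).

(* Sequences k |-> sum_j x_j ^ k p_j(k) with nonzero x_j in L, p_j in B[k].   *)
Definition exp_poly c :=
  exists2 s : seq L, 0 \notin s & shift_subs (map h s) c = fun=> 0.

Lemma exp_poly_const x : exp_poly (fun=> x).
Proof.
exists [:: 1]; first by rewrite inE eq_sym oner_eq0.
by apply: funext => k /=; rewrite /shift_sub rmorph1 mul1r subrr.
Qed.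

Lemma exp_polyD c d : exp_poly c -> exp_poly d ->
  exp_poly (fun k => c k + d k).
Proof.
move=> [s s0 es] [t t0 et]; exists (s ++ t).
  by rewrite mem_cat negb_or s0 t0.
rewrite map_cat shift_subsD !shift_subs_cat es shift_subs0.
by rewrite shift_subs_comm et shift_subs0; apply: funext => k; rewrite addr0.
Qed.

(** With S the shift, (S - xy)(c d) = ((S - x) c) (S d) + x c ((S - y) d). Each summand is a product
    of sequences whose recurrences have smaller total order, so induction on that order applies. *)
Lemma exp_polyM c d : exp_poly c -> exp_poly d ->
  exp_poly (fun k => c k * d k).
Proof.
move=> [s s0 es] [t t0 et]; move: {2}(size s + size t)%N (leqnn (size s + size t)) => N.
elim: N s t c d s0 es t0 et => [|N ih] [|x s] [|y t] c d //= s0 es t0 et leN.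
- by exists [::] => //; apply: funext => k /=; rewrite es mul0r.
- by exists [::] => //; apply: funext => k /=; rewrite es mul0r.
- by exists [::] => //; apply: funext => k /=; rewrite es mul0r.
- by exists [::] => //; apply: funext => k /=; rewrite et mulr0.
move: (s0) (t0); rewrite !inE !negb_or => /andP[x0 s0'] /andP[y0 t0'].
have [u u0 eu] : exp_poly (fun k => shift_sub (h x) c k * d k.+1
                                    + (h x * c k) * shift_sub (h y) d k).
  apply: exp_polyD.
    have le1 : (size s + size (y :: t) <= N)%N by move: leN => /=; rewrite addSn.
    apply: (ih s (y :: t) _ _ s0' es t0 _ le1).
    by rewrite (shift_subs_shift (map h (y :: t)) d) /= et.
  have le2 : (size (x :: s) + size t <= N)%N by move: leN => /=; rewrite !addSn addnS.
  apply: (ih (x :: s) t _ _ s0 _ t0' et le2).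
  by rewrite shift_subsZ /= es; apply: funext => k; rewrite mulr0.
exists (x * y :: u).
  by rewrite inE negb_or u0 eq_sym mulf_neq0 // eq_sym.
rewrite /= -[RHS]eu; congr shift_subs.
by apply: funext => k; rewrite /shift_sub rmorphM; ring.
Qed.

Lemma exp_polyN c : exp_poly c -> exp_poly (fun k => - c k).
Proof.
move=> /(exp_polyM (exp_poly_const (-1))); congr exp_poly.
by apply: funext => k; rewrite mulN1r.
Qed.

Lemma exp_poly_sum (I : Type) (r : seq I) (P : pred I) (c : I -> nat -> B) :
  (forall i, P i -> exp_poly (c i)) -> exp_poly (fun k => \sum_(i <- r | P i) c i k).
Proof.
move=> hc; elim: r => [|i r ih].
  by under eq_fun => k do rewrite big_nil; apply: exp_poly_const.
under eq_fun => k do rewrite big_cons.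
by case: (boolP (P i)) => // Pi; apply: exp_polyD => //; apply: hc.
Qed.

Lemma exp_poly_prod (I : Type) (r : seq I) (P : pred I) (c : I -> nat -> B) :
  (forall i, P i -> exp_poly (c i)) -> exp_poly (fun k => \prod_(i <- r | P i) c i k).
Proof.
move=> hc; elim: r => [|i r ih].
  by under eq_fun => k do rewrite big_nil; apply: exp_poly_const.
under eq_fun => k do rewrite big_cons.
by case: (boolP (P i)) => // Pi; apply: exp_polyM => //; apply: hc.
Qed.

Lemma exp_polyX c j : exp_poly c -> exp_poly (fun k => c k ^+ j).
Proof.
move=> hc; elim: j => [|j ih].
  by under eq_fun => k do rewrite expr0; apply: exp_poly_const.
by under eq_fun => k do rewrite exprS; apply: exp_polyM.
Qed.

End ExponentialPolynomials.

Lemma exp_poly_rmorph (L : fieldType) (B C : comNzRingType)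
    (h : {rmorphism L -> B}) (h' : {rmorphism B -> C}) c :
  exp_poly h c -> exp_poly (h' \o h) (h' \o c).
Proof.
move=> [s s0 es]; exists s => //.
by rewrite map_comp shift_subs_rmorph es; apply: funext => k /=; rewrite rmorph0.
Qed.

(** By Cayley-Hamilton the product of the A - x over the eigenvalues x vanishes, and applying S - x
    to (M A^k)_ij inserts the factor A - x after M. No eigenvalue is zero, because the constant term
    of the characteristic polynomial is det A up to sign. *)
Lemma exp_poly_mxpow (F L : fieldType) (h : {rmorphism F -> L}) l
    (A : 'M[F]_l) (s : seq L) i j :
  \det A != 0 -> map_poly h (char_poly A) = \prod_(x <- s) ('X - x%:P) ->
  exp_poly idfun (fun k => h ((A ^+ k) i j)).
Proof.
case: l A i j => [|l] A i j; first by case: i.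
move=> dA es; pose A' := map_mx h A.
have As : \prod_(x <- s) (A' - x%:M) = 0.
  have := Cayley_Hamilton A'; rewrite -map_char_poly es.
  rewrite rmorph_prod /= => <-; apply: eq_bigr => x _.
  by rewrite rmorphB /= horner_mx_X horner_mx_C.
exists s.
  apply/negP => s0; case/negP: dA.
  have : root (map_poly h (char_poly A)) 0 by rewrite es root_prod_XsubC.
  rewrite -(rmorph0 h) fmorph_root rootE horner_coef0 char_poly_det.
  by rewrite mulf_eq0 signr_eq0.
suff hM (M : 'M[L]_l.+1) : shift_subs (map idfun s) (fun k => (M * A' ^+ k) i j) =
    fun k => (M * \prod_(x <- s) (A' - x%:M) * A' ^+ k) i j.
  rewrite (_ : (fun k => _) = fun k => (1 * A' ^+ k) i j).
    by rewrite hM As; apply: funext => k; rewrite mulr0 mul0r mxE.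
  by apply: funext => k; rewrite mul1r -rmorphXn mxE.
elim: s M {es As} => [|x s ih] M /=.
  by rewrite big_nil; apply: funext => k; rewrite mulr1.
rewrite (_ : shift_sub x _ = fun k => (M * (A' - x%:M) * A' ^+ k) i j).
  by rewrite ih big_cons; apply: funext => k; rewrite !mulrA.
apply: funext => k; rewrite /shift_sub exprS mulrBr mulrBl -[M * x%:M]/(M *m x%:M).
by rewrite mul_mx_scalar -scalerAl mulrA [in RHS]mxE; congr (_ + _); rewrite !mxE.
Qed.

Section MinorSolutions.
Variables (L : fieldType) (P : (nat -> L) -> Prop).
Hypothesis P0 : P (fun=> 0).
Hypothesis Psign : forall i : nat, P (fun=> (-1) ^+ i).
Hypothesis PD : forall c d, P c -> P d -> P (fun k => c k + d k).
Hypothesis PM : forall c d, P c -> P d -> P (fun k => c k * d k).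

(** Only large k matter, so a sequence counts as zero when it is eventually zero. P is a subring of
    sequences; the solutions found below are polynomials in the entries and hence stay in P. *)
Definition ev_zero (c : nat -> L) := exists N, forall k, (N <= k)%N -> c k = 0.

Lemma seq_class_sum (I : Type) (r : seq I) (Q : pred I) (c : I -> nat -> L) :
  (forall i, Q i -> P (c i)) -> P (fun k => \sum_(i <- r | Q i) c i k).
Proof.
move=> Pc; elim: r => [|i r ih].
  by rewrite (_ : (fun k => _) = fun=> 0) //; apply: funext => k; rewrite big_nil.
under eq_fun do rewrite big_cons.
by case: (boolP (Q i)) => // Qi; apply: PD => //; apply: Pc.
Qed.

Lemma seq_class_prod (I : Type) (r : seq I) (Q : pred I) (c : I -> nat -> L) :
  (forall i, Q i -> P (c i)) -> P (fun k => \prod_(i <- r | Q i) c i k).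
Proof.
move=> Pc; elim: r => [|i r ih].
  rewrite (_ : (fun k => _) = fun=> (-1) ^+ 0); first exact: Psign.
  by apply: funext => k; rewrite big_nil.
under eq_fun do rewrite big_cons.
by case: (boolP (Q i)) => // Qi; apply: PM => //; apply: Pc.
Qed.

Lemma seq_class_det n (M : nat -> 'M[L]_n) :
  (forall i j, P (fun k => M k i j)) -> P (fun k => \det (M k)).
Proof.
move=> PM'; rewrite /determinant; apply: seq_class_sum => s _.
by apply: PM; [exact: Psign | apply: seq_class_prod].
Qed.

(* McCoy's argument: expand along a maximal minor which is not eventually     *)
(* zero.                                                                      *)
Lemma ev_kernel r c (M : nat -> 'M[L]_(r, c)) : (r < c)%N ->
    (forall i j, P (fun k => M k i j)) ->
  exists2 x : 'I_c -> nat -> L, (forall j, P (x j)) &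
    (forall i, ev_zero (fun k => \sum_j M k i j * x j k)) /\
    exists j, ~ ev_zero (x j).
Proof.
move=> rc PM'.
pose good s := `[< exists f : 'I_s -> 'I_r, exists g : 'I_s -> 'I_c,
  ~ ev_zero (fun k => \det (\matrix_(a, b) M k (f a) (g b))) >].
have good0 : good 0%N.
  apply/asboolP; exists (fun i : 'I_0 => False_rect _ (notF (ltn_ord i))).
  exists (fun i : 'I_0 => False_rect _ (notF (ltn_ord i))) => -[N /(_ N (leqnn N))].
  by rewrite det_mx00 => /eqP; rewrite oner_eq0.
have good_le s : good s -> (s <= r)%N.
  move=> /asboolP[f [g nz]]; rewrite leqNgt; apply/negP => rs; apply: nz.
  have /injectivePn[a [b ab fab]] : ~~ injectiveb f.
    apply/injectiveP => finj; have := leq_card f finj.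
    by rewrite !card_ord leqNgt rs.
  exists 0%N => k _; apply: (determinant_alternate ab) => j.
  by rewrite !mxE fab.
have exg : exists s, good s by exists 0%N.
case: (ex_maxnP exg good_le) => s gs smax.
have sc : (s < c)%N by apply: leq_ltn_trans rc; apply: good_le.
have [f [g nz]] := asboolW gs.
have [j0 j0g] : exists j0, j0 \notin codom g.
  apply/existsP; apply: contraLR sc; rewrite negb_exists -leqNgt => /forallP h.
  have /subset_leq_card : [set: 'I_c] \subset codom g.
    by apply/fintype.subsetP => j _; have := h j; rewrite negbK.
  rewrite cardsT card_ord => /leq_trans; apply.
  by apply: leq_trans (card_size _) _; rewrite size_codom card_ord.
pose rsel i (a : 'I_s.+1) := if unlift ord_max a is Some a' then f a' else i.
pose csel (b : 'I_s.+1) := if unlift ord_max b is Some b' then g b' else j0.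
(* W i borders the maximal minor by row i, placed last, and by a column j0 outside it. Its cofactors
   along the last row do not depend on i. *)
pose W i k : 'M[L]_s.+1 := \matrix_(a, b) M k (rsel i a) (csel b).
pose cof (b : 'I_s.+1) k := (-1) ^+ (s + b) *
  \det (\matrix_(a < s, b' < s) M k (f a) (csel (lift b b'))).
have cofE i b k : cofactor (W i k) ord_max b = cof b k.
  rewrite /cofactor /cof; congr (_ * \det _); apply/matrixP => a b'.
  by rewrite !mxE /rsel liftK.
(* Regrouped by columns of M, the cofactors solve the system: row i of M times x is det (W i),
   eventually zero by maximality of s. The entry at j0 is the maximal minor up to sign. *)
pose x j k := \sum_(b | csel b == j) cof b k.
exists x.
  move=> j; apply: seq_class_sum => b _; apply: PM; first exact: Psign.
  by apply: seq_class_det => a b'; under eq_fun do rewrite mxE.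
split.
  move=> i.
  have [N hN] : ev_zero (fun k => \det (W i k)).
    apply: contrapT => h; suff: (s.+1 <= s)%N by rewrite ltnn.
    by apply: smax; apply/asboolP; exists (rsel i), csel.
  exists N => k /hN e; rewrite -[RHS]e (expand_det_row _ ord_max).
  rewrite /x; under eq_bigr do rewrite mulr_sumr.
  rewrite (exchange_big_dep xpredT) //=; apply: eq_bigr => b _.
  rewrite cofE mxE /rsel unlift_none.
  by rewrite (big_pred1 (csel b)).
exists j0 => -[N hN]; apply: nz; exists N => k /hN.
rewrite /x (big_pred1 ord_max) => [|b].
  rewrite /cof => /eqP; rewrite mulf_eq0 signr_eq0 /= => /eqP e.
  rewrite -[RHS]e; congr (\det _); apply/matrixP => a b.
  by rewrite !mxE /csel liftK.
rewrite /csel /=; case: unliftP => [b' ->|->]; last by rewrite !eqxx.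
rewrite [RHS]eq_sym (negPf (neq_lift _ _)).
by apply: contraNF j0g => /eqP <-; apply: codom_f.
Qed.

End MinorSolutions.

(** * Dickson's lemma *)

Section Dickson.

(** Choose repeatedly an index where the tail of u beyond the last choice attains its minimum. *)
Lemma nat_seq_mono (u : nat -> nat) :
  exists2 t : nat -> nat, {homo t : i j / (i < j)%N} &
    {homo u \o t : i j / (i <= j)%N}.
Proof.
have minE (N : nat) : exists k, (N <= k)%N /\ forall j, (N <= j)%N -> (u k <= u j)%N.
  have [v] : exists v, exists2 k, (N <= k)%N & u k = v by exists (u N), N.
  elim/ltn_ind: v => v ih [k Nk ukv].
  have [h|/existsNP[j /not_implyP[Nj /negP]]] :=
    pselect (forall j, (N <= j)%N -> (u k <= u j)%N); first by exists k.
  by rewrite -ltnNge => lt; apply: (ih (u j)); [rewrite -ukv|exists j].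
have /choice[m mP] := minE.
pose t := fix t i := if i is i'.+1 then m (t i').+1 else m 0%N.
have tS i : (t i < t i.+1)%N by have [] := mP (t i).+1.
have tmono : {homo t : i j / (i < j)%N} by apply: homo_ltn => //; apply: ltn_trans.
exists t => //.
apply: homo_leq => [//|i j k|i] /=; first exact: leq_trans.
case: i => [|i] /=; first by have [_ ->] := mP 0%N.
have [_ h] := mP (t i).+1; apply: h.
exact: (ltn_trans (tS i) (tS i.+1)).
Qed.

(** Pass to a nondecreasing subsequence one coordinate at a time. *)
Lemma dickson (T : finType) (u : nat -> T -> nat) :
  exists i j, (i < j)%N /\ forall x, (u i x <= u j x)%N.
Proof.
suff h (s : seq T) : exists2 t : nat -> nat, {homo t : i j / (i < j)%N} &
    forall i j, (i <= j)%N -> forall x, x \in s -> (u (t i) x <= u (t j) x)%N.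
  have [t tm ht] := h (enum T); exists (t 0%N), (t 1%N).
  by split=> [|x]; [exact: tm | apply: ht => //; rewrite mem_enum].
elim: s => [|x s [t tm ht]]; first by exists id.
have [t' tm' ht'] := nat_seq_mono (fun k => u (t k) x).
exists (t \o t') => [i j ij|i j ij y].
  by apply/tm/tm'.
rewrite inE => /predU1P[->|ys]; first exact: ht'.
by apply: ht => //; rewrite leq_eqVlt in ij; case/predU1P: ij => [->//|/tm'/ltnW].
Qed.

End Dickson.

(** * Power series and the substitution z |-> Omega z *)

Section LeastExponents.
Variables (n : nat) (R : idomainType).
Implicit Types (f g : powser n R) (m k : 'X_{1..n}).

Definition ps_cst : R -> powser n R := fun c => poly_ps c%:MP.

Lemma ps_cst_zmod : zmod_morphism ps_cst.
Proof. by move=> x y; rewrite /ps_cst !rmorphB. Qed.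
Lemma ps_cst_monoid : monoid_morphism ps_cst.
Proof. by split=> [|x y]; rewrite /ps_cst ?rmorph1 // !rmorphM. Qed.
HB.instance Definition _ :=
  GRing.isZmodMorphism.Build R (powser n R) ps_cst ps_cst_zmod.
HB.instance Definition _ :=
  GRing.isMonoidMorphism.Build R (powser n R) ps_cst ps_cst_monoid.

Lemma pcoefD f g m : pcoef (f + g) m = pcoef f m + pcoef g m.
Proof. by []. Qed.
Lemma pcoefN f m : pcoef (- f) m = - pcoef f m.
Proof. by []. Qed.
Lemma pcoef0 m : pcoef (0 : powser n R) m = 0.
Proof. by []. Qed.
Lemma pcoef1 m : pcoef (1 : powser n R) m = (m == 0%MM)%:R.
Proof. by []. Qed.
Lemma pcoef_poly (p : {mpoly R[n]}) m : pcoef (poly_ps p) m = p@_m.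
Proof. by []. Qed.

Lemma pcoef_sum (I : Type) (r : seq I) (P : pred I) (F : I -> powser n R) m :
  pcoef (\sum_(i <- r | P i) F i) m = \sum_(i <- r | P i) pcoef (F i) m.
Proof.
by apply: (big_morph (fun f => pcoef f m)) => [f g|]; rewrite ?pcoefD ?pcoef0.
Qed.

Lemma pcoefM d f g m : (mdeg m < d)%N ->
  pcoef (f * g) m = (ps_trunc d f * ps_trunc d g)@_m.
Proof. exact: ps_mulE. Qed.

Lemma pcoefM_low f f' g g' m :
    (forall k, (mdeg k <= mdeg m)%N -> pcoef f k = pcoef f' k) ->
    (forall k, (mdeg k <= mdeg m)%N -> pcoef g k = pcoef g' k) ->
  pcoef (f * g) m = pcoef (f' * g') m.
Proof.
move=> ef eg; rewrite !(@pcoefM (mdeg m).+1) //.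
by apply: mcoeffM_low => k lek; rewrite !ps_truncE // ?ef ?eg.
Qed.

Lemma pcoef_cstM c f m : pcoef (ps_cst c * f) m = c * pcoef f m.
Proof.
rewrite (@pcoefM (mdeg m).+1) // -(ps_truncE f (ltnSn (mdeg m))) -mcoeffCM.
by apply: mcoeffM_low => // k lek; rewrite ps_truncE.
Qed.

Lemma pcoefM0 f g : pcoef (f * g) 0%MM = pcoef f 0%MM * pcoef g 0%MM.
Proof.
rewrite (pcoefM_low (f' := ps_cst (pcoef f 0%MM)) (g' := g)) ?pcoef_cstM // => k.
by rewrite mdeg0 leqn0 mdeg_eq0 => /eqP ->; rewrite pcoef_poly mcoeffC eqxx mulr1.
Qed.

(** The monomial order is a well-order compatible with addition, so the least exponent plays the
    role of a valuation, additive on products by [least_expM]. *)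
Definition least_exp f m := pcoef f m != 0 /\ forall k, (k < m)%O -> pcoef f k = 0.

Lemma least_expP f : f != 0 -> exists m, least_exp f m.
Proof. by move=> /ps_neq0_lead[m [fm hm]]; exists m. Qed.

Lemma least_exp_neq0 f m : least_exp f m -> f != 0.
Proof. by case=> fm _; apply: contraNneq fm => ->. Qed.

Lemma least_exp_uniq f m k : least_exp f m -> least_exp f k -> m = k.
Proof.
move=> [fm hm] [fk hk]; case: (ltgtP m k) => // lt.
  by move: fm; rewrite hk ?eqxx.
by move: fk; rewrite hm ?eqxx.
Qed.

Lemma least_exp_mul_coef f g a b : least_exp f a -> least_exp g b ->
  pcoef (f * g) (a + b)%MM = pcoef f a * pcoef g b.
Proof.
move=> [fa fl] [gb gl].
have lea : (mdeg a < (mdeg (a + b)).+1)%N by rewrite mdegD ltnS leq_addr.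
have leb : (mdeg b < (mdeg (a + b)).+1)%N by rewrite mdegD ltnS leq_addl.
rewrite /= (bigD1 (BMultinom lea, BMultinom leb)) //= big1 ?addr0 //.
move=> [[c lc] [d ld]] /= /andP[/eqP e ne].
have [ca|ca|ca] := ltgtP c a; first by rewrite fl ?mul0r.
  have [db|db|db] := ltgtP d b; first by rewrite gl ?mulr0.
    by have := ltm_add ca db; rewrite -e ltxx.
  by have := ltmc_add2l a c b; rewrite ca -{2}db -e ltxx.
subst c; move: e => /eqP; rewrite eqm_add2l => /eqP e; subst d.
by case/eqP: ne; congr pair; apply: val_inj.
Qed.

Lemma least_expM f g a b : least_exp f a -> least_exp g b ->
  least_exp (f * g) (a + b)%MM.
Proof.
move=> la lb; have [fa fl] := la; have [gb gl] := lb; split.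
  by rewrite least_exp_mul_coef // mulf_neq0.
move=> k kab; apply: big1 => -[[c lc] [d ld]] /= /eqP e.
have [ca|ca|ca] := ltgtP c a; first by rewrite fl ?mul0r.
  have [db|db|db] := ltgtP d b; first by rewrite gl ?mulr0.
    by have := ltm_add ca db; rewrite -e ltNge (ltW kab).
  by have := ltmc_add2l a c b; rewrite ca -{2}db -e ltNge (ltW kab).
have [db|db|db] := ltgtP d b; first by rewrite gl ?mulr0.
  by move: kab; rewrite e ca ltmc_add2r ltNge (ltW db).
by move: kab; rewrite e ca db ltxx.
Qed.

Lemma least_exp_cstM c f m : c != 0 -> least_exp f m -> least_exp (ps_cst c * f) m.
Proof.
move=> c0 [fm hm]; split=> [|k /hm]; rewrite pcoef_cstM ?mulf_neq0 //.
by move->; rewrite mulr0.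
Qed.

Lemma least_expDl f g a b : least_exp f a -> least_exp g b -> (a < b)%O ->
  least_exp (f + g) a.
Proof.
move=> [fa fl] [gb gl] ab; split=> [|k ka]; rewrite pcoefD.
  by rewrite gl ?addr0.
by rewrite fl ?gl ?addr0 // (lt_trans ka).
Qed.

End LeastExponents.

Section MonomialAction.
Variables (n : nat) (Omega : 'M[nat]_n).
Implicit Types (m k : 'X_{1..n}).

Lemma mnm_actE k j : mnm_act Omega k j = (\sum_(i < n) k i * Omega i j)%N.
Proof. by rewrite mnmE. Qed.

Lemma mnm_actD m k : mnm_act Omega (m + k) = (mnm_act Omega m + mnm_act Omega k)%MM.
Proof.
apply/mnmP => j; rewrite mnmDE !mnm_actE -big_split /=.
by apply: eq_bigr => i _; rewrite mnmDE mulnDl.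
Qed.

Lemma mnm_act0 : mnm_act Omega 0 = 0%MM.
Proof. by apply/mnmP => j; rewrite mnm_actE mnm0E big1 // => i _; rewrite mnm0E. Qed.

(** As rational row vectors exponents can be subtracted, and Omega acts on them by right
    multiplication. *)
Definition mnm_row k : 'rV[rat]_n := \row_j (k j)%:R.
Definition mx_rat : 'M[rat]_n := map_mx (fun i => i%:R) Omega.

Lemma mnm_row_act k : mnm_row (mnm_act Omega k) = mnm_row k *m mx_rat.
Proof.
apply/rowP => j; rewrite !mxE mnm_actE natr_sum; apply: eq_bigr => i _.
by rewrite !mxE natrM.
Qed.

Lemma mnm_row_iter j k :
  mnm_row (iter j (mnm_act Omega) k) = mnm_row k *m mx_rat ^+ j.
Proof.
elim: j => [|j ih]; first by rewrite expr0 mulmx1.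
by rewrite iterS mnm_row_act ih exprSr mulmxA.
Qed.

Lemma mnm_row_inj : injective mnm_row.
Proof.
move=> m k /rowP e; apply/mnmP => j; have := e j.
by rewrite !mxE => /eqP; rewrite eqr_nat => /eqP.
Qed.

Lemma mnm_rowD m k : mnm_row (m + k) = mnm_row m + mnm_row k.
Proof. by apply/rowP => j; rewrite !mxE mnmDE natrD. Qed.

Hypothesis Omega_det : \det mx_rat != 0.

Lemma mx_rat_unit : mx_rat \in unitmx.
Proof. by rewrite unitmxE unitfE. Qed.

Lemma mnm_act_inj : injective (mnm_act Omega).
Proof.
move=> m k /(congr1 mnm_row); rewrite !mnm_row_act => e.
by apply/mnm_row_inj/(row_free_inj _ e); rewrite row_free_unit mx_rat_unit.
Qed.

Lemma Omega_row_gt0 i : (0 < \sum_j Omega i j)%N.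
Proof.
rewrite lt0n; apply: contraNneq Omega_det => /eqP; rewrite sum_nat_eq0 => /forallP z.
rewrite (expand_det_row _ i) big1 // => j _.
by rewrite mxE (eqP (z j)) mul0r.
Qed.

Lemma mdeg_mnm_act k : (mdeg k <= mdeg (mnm_act Omega k))%N.
Proof.
rewrite !mdegE; under [X in (_ <= X)%N]eq_bigr do rewrite mnm_actE.
rewrite exchange_big /=; apply: leq_sum => i _.
by rewrite -big_distrr /= leq_pmulr // Omega_row_gt0.
Qed.

End MonomialAction.

Section Substitution.
Variables (n : nat) (R : idomainType) (Omega : 'M[nat]_n).
Hypothesis Omega_det : \det (mx_rat Omega) != 0.
Implicit Types (f g : powser n R) (m k : 'X_{1..n}).

Notation phi := (@subst_ps n R Omega).
Notation act := (mnm_act Omega).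

Lemma pcoef_subst_act f k : pcoef (phi f) (act k) = pcoef f k.
Proof.
have lt : (mdeg k < (mdeg (act k)).+1)%N by rewrite ltnS mdeg_mnm_act.
rewrite /= (big_pred1 (BMultinom lt)) // => j /=.
by rewrite (inj_eq (mnm_act_inj Omega_det)) -val_eqE.
Qed.

Lemma pcoef_subst_out f m : (forall k, act k != m) -> pcoef (phi f) m = 0.
Proof. by move=> h; rewrite /= big_pred0 // => k; rewrite (negPf (h _)). Qed.

Lemma subst_actP f m :
  (exists2 k, m = act k & pcoef (phi f) m = pcoef f k) \/
  pcoef (phi f) m = 0 /\ forall k, act k != m.
Proof.
have [[k <-]|h] := pselect (exists k, act k = m).
  by left; exists k => //; rewrite pcoef_subst_act.
suff h' k : act k != m by right; split=> //; apply: pcoef_subst_out.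
by apply/eqP => e; apply: h; exists k.
Qed.

Lemma subst_ps_unique f g :
    (forall k, pcoef g (act k) = pcoef f k) ->
    (forall m, (forall k, act k != m) -> pcoef g m = 0) ->
  phi f = g.
Proof.
move=> h1 h2; apply: powserP => m; have [[k -> _]|[-> /h2 ->//]] := subst_actP f m.
by rewrite pcoef_subst_act h1.
Qed.

Lemma subst_ps_zmod : zmod_morphism phi.
Proof.
move=> f g; apply: subst_ps_unique => [k|m h]; rewrite pcoefD pcoefN.
  by rewrite !pcoef_subst_act.
by rewrite !pcoef_subst_out // subr0.
Qed.

Let subst_mpoly (p : {mpoly R[n]}) : {mpoly R[n]} :=
  mmap (@mpolyC n R) (fun i => \prod_(j < n) 'X_j ^+ Omega i j) p.

Let subst_mpolyX k : mmap1 (fun i => \prod_(j < n) 'X_j ^+ Omega i j : {mpoly R[n]}) k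
  = 'X_[act k].
Proof.
rewrite /mmap1 [RHS]mpolyXE_id; under eq_bigr do rewrite -prodrXl.
rewrite exchange_big /=; apply: eq_bigr => j _.
under eq_bigr do rewrite -exprM mulnC.
by rewrite prodrXr mnm_actE.
Qed.

Let subst_mpolyE p m : (subst_mpoly p)@_m = \sum_(k <- msupp p | act k == m) p@_k.
Proof.
rewrite /subst_mpoly /mmap raddf_sum /= [RHS]big_mkcond; apply: eq_bigr => k _.
rewrite subst_mpolyX mcoeffCM mcoeffX.
by case: eqP => _; rewrite ?mulr1 ?mulr0.
Qed.

Let subst_mpoly_low p q m :
    (forall k, (mdeg k <= mdeg m)%N -> p@_k = q@_k) ->
  (subst_mpoly p)@_m = (subst_mpoly q)@_m.
Proof.
move=> e; apply/eqP; rewrite -subr_eq0 -mcoeffB -rmorphB subst_mpolyE.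
rewrite big1 // => k /eqP ek; rewrite mcoeffB e ?subrr //.
by rewrite -ek mdeg_mnm_act.
Qed.

Let pcoef_subst d f m : (mdeg m < d)%N ->
  pcoef (phi f) m = (subst_mpoly (ps_trunc d f))@_m.
Proof.
move=> lt; rewrite subst_mpolyE; have [[k e ->]|[-> h]] := subst_actP f m; last first.
  by rewrite big1 // => k; rewrite (negPf (h k)).
have lk : (mdeg k < d)%N by apply: leq_ltn_trans lt; rewrite e mdeg_mnm_act.
transitivity (\sum_(j <- msupp (ps_trunc d f) | j == k) (ps_trunc d f)@_j).
  rewrite big_mkcond /= -(ps_truncE f lk).
  have [ks|ks] := boolP (k \in msupp (ps_trunc d f)).
    rewrite (bigD1_seq k) //= ?msupp_uniq // eqxx big1 ?addr0 // => j.
    by move=> /negPf ->.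
  rewrite (memN_msupp_eq0 ks) big_seq big1 // => j js.
  by case: eqP => // jk; rewrite -jk js in ks.
by apply: eq_bigl => j; rewrite e (inj_eq (mnm_act_inj Omega_det)).
Qed.

(** Multiplicativity is inherited from polynomials: Omega does not lower the degree of an exponent,
    so the coefficients of f(Omega z) up to some degree involve those of f up to the same degree
    only. *)
Lemma subst_ps_monoid : monoid_morphism phi.
Proof.
split.
  apply: subst_ps_unique => [k|m h]; rewrite !pcoef1.
    by rewrite -(mnm_act0 Omega) (inj_eq (mnm_act_inj Omega_det)) mnm_act0.
  by rewrite eq_sym -(mnm_act0 Omega) (negPf (h _)).
move=> f g; apply: powserP => m; have lt := ltnSn (mdeg m).
rewrite (pcoefM _ _ lt) (pcoef_subst _ lt).
transitivity (subst_mpoly (ps_trunc (mdeg m).+1 f * ps_trunc (mdeg m).+1 g))@_m.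
  by apply: subst_mpoly_low => k lek; rewrite ps_truncE // (@pcoefM n R (mdeg m).+1).
rewrite [subst_mpoly (_ * _)]rmorphM /=; apply: mcoeffM_low => k lek.
  by rewrite ps_truncE // -pcoef_subst.
by rewrite ps_truncE // -pcoef_subst.
Qed.

(** Packed by hand instead of declared as an instance, since it depends on the hypothesis det Omega
    != 0. *)
Definition subst_rmorphism : {rmorphism powser n R -> powser n R} :=
  HB.pack phi (GRing.isZmodMorphism.Build _ _ phi subst_ps_zmod)
    (GRing.isMonoidMorphism.Build _ _ phi subst_ps_monoid).

Lemma subst_ps0 : phi 0 = 0.
Proof. exact: (rmorph0 subst_rmorphism). Qed.
Lemma subst_psN f : phi (- f) = - phi f.
Proof. exact: (rmorphN subst_rmorphism). Qed.
Lemma subst_psD f g : phi (f + g) = phi f + phi g.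
Proof. exact: (rmorphD subst_rmorphism). Qed.
Lemma subst_psM f g : phi (f * g) = phi f * phi g.
Proof. exact: (rmorphM subst_rmorphism). Qed.
Lemma subst_cst c : phi (ps_cst n c) = ps_cst n c.
Proof.
apply: subst_ps_unique => [k|m h]; rewrite /ps_cst !pcoef_poly !mcoeffC.
  by rewrite -{1}(mnm_act0 Omega) (inj_eq (mnm_act_inj Omega_det)).
by rewrite eq_sym -{1}(mnm_act0 Omega) (negPf (h _)) mulr0.
Qed.

Lemma subst_ps_inj : injective phi.
Proof.
move=> f g e; apply: powserP => m; by rewrite -!(pcoef_subst_act _ m) e.
Qed.

End Substitution.

Arguments pcoef : simpl never.

(** * Solutions of y(Omega z) = mu y(z) + c *)

Section MahlerConstants.
Variables (n : nat) (L : fieldType) (Omega : 'M[nat]_n).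
Hypothesis Omega_det : \det (mx_rat Omega) != 0.
Hypothesis Omega_unity : forall s (d : 'rV[rat]_n),
  (0 < s)%N -> d *m mx_rat Omega ^+ s = d -> d = 0.
Implicit Types (f g a b : powser n L) (m k : 'X_{1..n}).

Notation phi := (@subst_ps n L Omega).
Notation act := (mnm_act Omega).

Let phi_actP f m :
  (exists2 k, m = act k & pcoef (phi f) m = pcoef f k) \/ pcoef (phi f) m = 0.
Proof. by have [h|[h _]] := subst_actP Omega_det f m; [left|right]. Qed.

Let phi_act f m : pcoef (phi f) (act m) = pcoef f m.
Proof. exact: pcoef_subst_act. Qed.

Lemma pcoef_iter_subst_act j f m :
  pcoef (iter j phi f) (iter j act m) = pcoef f m.
Proof. elim: j => [//|j ih]. by rewrite !iterS phi_act. Qed.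

Lemma pcoef_iter_subst j f M : pcoef (iter j phi f) M != 0 ->
  exists2 m, M = iter j act m & pcoef f m = pcoef (iter j phi f) M.
Proof.
elim: j M => [|j ih] M /=; first by exists M.
have [[k -> e]|->] := phi_actP (iter j phi f) M; last by rewrite eqxx.
by rewrite e => /ih[m -> em]; exists m.
Qed.

Lemma iter_subst_neq0 j f : f != 0 -> iter j phi f != 0.
Proof.
move=> /least_expP[m [fm _]]; apply: contraNneq fm => e.
by rewrite -(pcoef_iter_subst_act j) e.
Qed.

Lemma mx_rat_iter_inj i j (d : 'rV[rat]_n) : (i < j)%N ->
  d *m mx_rat Omega ^+ i = d *m mx_rat Omega ^+ j -> d = 0.
Proof.
move=> ij; have -> : j = (j - i + i)%N by rewrite subnK // ltnW.
rewrite exprD mulmxA => e; apply: (Omega_unity (s := j - i)); first by rewrite subn_gt0.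
apply/esym/(row_free_inj _ e); rewrite row_free_unit.
by elim: (i) => [|i' ih]; rewrite ?expr0 ?unitmx1 // exprS unitmx_mul mx_rat_unit.
Qed.

Lemma least_exp_iter_subst j f m : least_exp (iter j phi f) m ->
  exists2 k, m = iter j act k & pcoef f k = pcoef (iter j phi f) m.
Proof. by case=> /pcoef_iter_subst. Qed.

(* By Dickson's lemma the least exponents of phi^sj a and phi^sj b come from  *)
(* the same exponents of a and b for two values of j.                         *)
Lemma least_exp_pair s a b : (0 < s)%N -> a != 0 -> b != 0 ->
  exists i j, [/\ (i < j)%N & exists u w,
    [/\ least_exp (iter (s * i) phi a) (iter (s * i) act u),
        least_exp (iter (s * j) phi a) (iter (s * j) act u),
        least_exp (iter (s * i) phi b) (iter (s * i) act w) &
        least_exp (iter (s * j) phi b) (iter (s * j) act w)]].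
Proof.
move=> s0 a0 b0.
have ex f j : f != 0 -> exists k, least_exp (iter j phi f) (iter j act k).
  move=> f0; have [m lm] := least_expP (iter_subst_neq0 j f0).
  by have [k e _] := least_exp_iter_subst lm; exists k; rewrite -e.
have /choice[u hu] := fun j => ex a (s * j)%N a0.
have /choice[w hw] := fun j => ex b (s * j)%N b0.
pose e j (x : 'I_n + 'I_n) := match x with inl y => u j y | inr y => w j y end.
have [i [j [ij le]]] := dickson e.
(* an exponent below a least one, in the order used at step j, is equal to it *)
have eqe f x y (k : nat) : least_exp (iter k phi f) (iter k act y) ->
    pcoef f x != 0 -> (forall z, (x z <= y z)%N) -> x = y :> 'X_{1..n}.
  move=> [_ hy] fx xy; have e' : y = (x + (y - x))%MM.
    by apply/mnmP => z; rewrite mnmDE mnmBE subnKC.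
  have itD z t : iter k act (z + t)%MM = (iter k act z + iter k act t)%MM.
    by elim: (k) => //= k' ->; rewrite mnm_actD.
  have it_inj : injective (iter k act).
    by elim: (k) => //= k' ih z t /(mnm_act_inj Omega_det)/ih.
  have [//|ne] := eqVneq x y; case/eqP: fx; rewrite -(pcoef_iter_subst_act k) hy // lt_neqAle.
  by rewrite (inj_eq it_inj) ne {1}e' itD lemc_addr.
have supp f (k : nat) y : least_exp (iter k phi f) (iter k act y) -> pcoef f y != 0.
  by case; rewrite pcoef_iter_subst_act.
have ua : u i = u j.
  by apply: (eqe a _ _ (s * j)%N (hu j)) => [|z]; [exact: supp (hu i)|exact: (le (inl z))].
have wb : w i = w j.
  by apply: (eqe b _ _ (s * j)%N (hw j)) => [|z]; [exact: supp (hw i)|exact: (le (inr z))].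
exists i, j; split=> //; exists (u i), (w i).
by split; [exact: hu | rewrite ua | exact: hw | rewrite wb].
Qed.

(** For u and w from [least_exp_pair] the hypothesis gives (u - w) Omega^(s i) = A - B = (u - w)
    Omega^(s j) with i < j. No positive power of Omega fixes a nonzero vector, so u = w. *)
Lemma least_exp_invariant s a b A B : (0 < s)%N ->
    least_exp a A -> least_exp b B ->
    (forall j m k, least_exp (iter (s * j) phi a) m ->
       least_exp (iter (s * j) phi b) k -> (m + B = A + k)%MM) ->
  A = B.
Proof.
move=> s0 lA lB H.
have [i [j [ij [u [w [ai aj bi bj]]]]]] :=
  least_exp_pair s0 (least_exp_neq0 lA) (least_exp_neq0 lB).
have dE t m k : iter (s * t) act u = m -> iter (s * t) act w = k ->
    (m + B = A + k)%MM ->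
  (mnm_row u - mnm_row w) *m mx_rat Omega ^+ (s * t) = mnm_row A - mnm_row B.
  move=> eu ew /(congr1 (@mnm_row n)); rewrite !mnm_rowD mulmxBl -!mnm_row_iter eu ew.
  by move=> h; apply/eqP; rewrite subr_eq addrAC -h addrK.
have ei := dE i _ _ erefl erefl (H i _ _ ai bi).
have ej := dE j _ _ erefl erefl (H j _ _ aj bj).
have d0 : mnm_row u - mnm_row w = 0.
  apply: (@mx_rat_iter_inj (s * i) (s * j)); first by rewrite ltn_pmul2l.
  by rewrite ei.
by apply: mnm_row_inj; apply/eqP; rewrite -subr_eq0 -ei d0 mul0mx.
Qed.

(* y = a / b satisfies y(Omega z) = mu y(z) + c.                              *)
Lemma mahler_constant a b mu c : b != 0 -> mu != 0 ->
    phi a * b = (ps_cst n mu * a + ps_cst n c * b) * phi b ->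
  exists x, a = ps_cst n x * b.
Proof.
move=> b0 mu0.
(* Iteration gives y(Omega^j z) = mu^j y(z) + cc c j; [iterE] is this identity with denominators
   cleared. *)
pose cc c (j : nat) := c * \sum_(t < j) mu ^+ t.
have ccS c' j : cc c' j.+1 = cc c' j + mu ^+ j * c'.
  by rewrite /cc big_ord_recr /= mulrDr [c' * mu ^+ j]mulrC.
have ccD c' i j : cc c' (i + j)%N = cc c' i + mu ^+ i * cc c' j.
  rewrite /cc big_split_ord /= mulrDr mulrCA; congr (_ + c' * _).
  by rewrite mulr_sumr; apply: eq_bigr => t _; rewrite -exprD.
have iterE a' c' j : phi a' * b = (ps_cst n mu * a' + ps_cst n c' * b) * phi b ->
  iter j phi a' * b = (ps_cst n (mu ^+ j) * a' + ps_cst n (cc c' j) * b) * iter j phi b.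
  move=> e; elim: j => [|j ih].
    by rewrite /cc big_ord0 expr0 mulr0 rmorph1 rmorph0 mul1r mul0r addr0.
  have pb0 : phi b != 0 by apply: (iter_subst_neq0 1).
  apply: (mulIf pb0); rewrite !iterS mulrAC -subst_psM // ih subst_psM // subst_psD // !subst_psM //.
  rewrite !subst_cst // !mulrDl [X in X + _]mulrAC -![_ * phi a' * _]mulrA e.
  rewrite ccS exprSr !rmorphD !rmorphM /=; ring.
have [B lB] := least_expP b0.
have [a0|/least_expP[A lA]] := eqVneq a 0.
  by exists 0; rewrite rmorph0 mul0r.
move=> e.
have lcoef a' c' j x : phi a' * b = (ps_cst n mu * a' + ps_cst n c' * b) * phi b ->
    least_exp (ps_cst n (mu ^+ j) * a' + ps_cst n (cc c' j) * b) x ->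
    forall m k, least_exp (iter j phi a') m -> least_exp (iter j phi b) k ->
  (m + B = x + k)%MM /\ pcoef (iter j phi a') m * pcoef b B =
    pcoef (ps_cst n (mu ^+ j) * a' + ps_cst n (cc c' j) * b) x * pcoef (iter j phi b) k.
  move=> e' lx m k lm lk.
  have em := least_exp_uniq (least_expM lm lB).
  have ek : least_exp (iter j phi a' * b) (x + k) by rewrite (iterE _ _ _ e'); exact: least_expM.
  split; first exact: em.
  by rewrite -!least_exp_mul_coef // -(iterE _ _ _ e') (em _ ek).
have muj j : mu ^+ j != 0 by rewrite expf_neq0.
(* No nonzero solution has positive valuation. If cc c' s = 0 for some s > 0, then y(Omega^s z) =
   mu^s y(z) and [least_exp_invariant] equates the two least exponents. Otherwise the constant
   dominates for every j > 0; the two indices from [least_exp_pair] share their leading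
   coefficients, so cc c' takes one value twice and vanishes at the difference of the indices. *)
have pos a' c' A' : phi a' * b = (ps_cst n mu * a' + ps_cst n c' * b) * phi b ->
    least_exp a' A' -> (B < A')%O -> False.
  move=> e' lA' BA.
  have [s s0 cs] : exists2 s, (0 < s)%N & cc c' s = 0.
    apply: contrapT => h.
    have nz j : (0 < j)%N -> cc c' j != 0.
      by move=> j0; apply/eqP => z; apply: h; exists j.
    have [i [j [ij [u [w [ai aj bi bj]]]]]] := least_exp_pair
      (ltn0Sn 0) (iter_subst_neq0 1 (least_exp_neq0 lA')) (iter_subst_neq0 1 b0).
    have val t m k : iter t act u = m -> iter t act w = k ->
        least_exp (iter t phi (phi a')) m -> least_exp (iter t phi (phi b)) k ->
        pcoef (phi a') u = cc c' t.+1 * pcoef (phi b) w.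
      rewrite -!iterSr => eu ew lm lk.
      have lB' : least_exp (ps_cst n (mu ^+ t.+1) * a' + ps_cst n (cc c' t.+1) * b) B.
        rewrite addrC; apply: (least_expDl _ _ BA); apply: least_exp_cstM => //.
        exact: nz.
      have [_] := @lcoef a' c' t.+1 B e' lB' m k lm lk.
      have [bB _] := lB; have [_ hA] := lA'.
      rewrite pcoefD !pcoef_cstM (hA _ BA) mulr0 add0r mulrAC => /(mulIf bB).
      by rewrite -eu -ew iterSr pcoef_iter_subst_act iterSr pcoef_iter_subst_act.
    move: ai aj bi bj; rewrite !mul1n => ai aj bi bj.
    have [pw _] := bi; rewrite pcoef_iter_subst_act in pw.
    have := val i _ _ erefl erefl ai bi; rewrite (val j _ _ erefl erefl aj bj).
    have -> : j.+1 = (i.+1 + (j - i))%N by rewrite addSn subnKC // ltnW.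
    move=> /(mulIf pw)/eqP; rewrite ccD -subr_eq0 addrAC subrr add0r.
    by rewrite mulf_eq0 (negPf (muj _)) (negPf (nz _ _)) // subn_gt0.
  suff eAB : A' = B by rewrite eAB ltxx in BA.
  apply: (least_exp_invariant s0 lA' lB) => j m k lm lk.
  have csj : cc c' (s * j)%N = 0.
    elim: (j) => [|j' ih]; first by rewrite muln0 /cc big_ord0 mulr0.
    by rewrite mulnS ccD ih cs mulr0 addr0.
  have [|//] := @lcoef a' c' (s * j)%N A' e' _ m k lm lk.
  by rewrite csj rmorph0 mul0r addr0; apply: least_exp_cstM.
(* If A < B, the term mu^j y dominates the constant and [least_exp_invariant] gives A = B. If A = B,
   subtracting the quotient x of the leading coefficients leaves a solution of positive valuation,
   which by [pos] must be zero. *)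
have [lt|lt|AB] := ltgtP A B.
- suff : A = B by move=> eAB; rewrite eAB ltxx in lt.
  apply: (least_exp_invariant (ltn0Sn 0) lA lB) => j m k; rewrite mul1n => lm lk.
  have [|//] := @lcoef a c j A e _ m k lm lk.
  have [->|c0] := eqVneq (cc c j) 0.
    by rewrite rmorph0 mul0r addr0; apply: least_exp_cstM.
  by apply: least_expDl lt; apply: least_exp_cstM.
- by case: (pos _ _ _ e lA lt).
pose x := pcoef a A / pcoef b B; exists x.
apply/eqP; rewrite -subr_eq0; apply/negPn/negP => /least_expP[A' lA'].
apply: (pos (a - ps_cst n x * b) (mu * x + c - x) A' _ lA').
  rewrite subst_psD // subst_psN // subst_psM // subst_cst // mulrBl e !rmorphB !rmorphD !rmorphM /=.
  ring.
have [bB hb] := lB; have [aA ha] := lA; have [aA' _] := lA'.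
rewrite ltNge; apply: contraNN aA'; rewrite le_eqVlt => /predU1P[->|A'B].
  by rewrite pcoefD pcoefN pcoef_cstM /x AB divfK ?subrr // -AB.
by rewrite pcoefD pcoefN pcoef_cstM (hb _ A'B) ha ?AB // mulr0 subr0.
Qed.

End MahlerConstants.

(** * Convergent power series over a valued field *)

Section ProductCoefficients.
Variables (n : nat) (R : idomainType).
Implicit Types (f g : powser n R) (m : 'X_{1..n}).

Lemma pcoefM_box d f g m : (mdeg m < d)%N ->
  pcoef (f * g) m = \sum_(k : 'X_{1..n < d} * 'X_{1..n < d} | m == (k.1 + k.2)%MM)
     pcoef f k.1 * pcoef g k.2.
Proof.
move=> lt; rewrite (pcoefM _ _ lt).
have -> : (ps_trunc d f * ps_trunc d g)@_m = \sum_(k : 'X_{1..n < d, d} |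
    m == (k.1 + k.2)%MM) (ps_trunc d f)@_k.1 * (ps_trunc d g)@_k.2.
  exact: mcoeff_poly_mul.
by apply: eq_bigr => k _; rewrite !ps_truncE ?bmdeg.
Qed.

Lemma sum_mnm_act (V : nmodType) (Omega : 'M[nat]_n) d (G : 'X_{1..n} -> V) :
    \det (mx_rat Omega) != 0 ->
    (forall m, (forall k, mnm_act Omega k != m) -> G m = 0) ->
  \sum_(m : 'X_{1..n < d}) G m =
    \sum_(k : 'X_{1..n < d} | (mdeg (mnm_act Omega k) < d)%N) G (mnm_act Omega k).
Proof.
move=> Od G0; pose P (k : 'X_{1..n < d}) := (mdeg (mnm_act Omega k) < d)%N.
have ex (m : 'X_{1..n < d}) : G m = \sum_(k | P k && (mnm_act Omega k == m))
    G (mnm_act Omega k).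
  have [[k e]|h] := pselect (exists k, mnm_act Omega k = m).
    have lk : (mdeg k < d)%N.
      by apply: leq_ltn_trans (mdeg_mnm_act Od k) _; rewrite e bmdeg.
    rewrite (big_pred1 (BMultinom lk)) /= ?e // => j; rewrite /P /= -[RHS]val_eqE /= -e.
    rewrite (inj_eq (mnm_act_inj Od)) andbC.
    by have [->|//] := eqVneq (j : 'X_{1..n}) k; rewrite e bmdeg.
  rewrite big_pred0 => [|k]; last first.
    by apply/negbTE; rewrite negb_and; apply/orP; right; apply/eqP => e; apply: h; exists k.
  by apply: G0 => k; apply/eqP => e; apply: h; exists k.
under eq_bigr => m _ do rewrite ex.
rewrite (exchange_big_dep P) /= => [|m k _ /andP[]] //.
apply: eq_bigr => k Pk; rewrite (big_pred1 (BMultinom Pk)) // => m /=.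
by rewrite Pk /= -[RHS]val_eqE /= eq_sym.
Qed.

End ProductCoefficients.

Section AbsoluteValueTheory.
Variables (R : realType) (L : fieldType) (v : L -> R).
Hypothesis v_abs : is_absval v.

Lemma absv_ge0 x : 0 <= v x. Proof. by have [] := v_abs. Qed.
Lemma absv_eq0 x : (v x == 0) = (x == 0). Proof. by have [] := v_abs. Qed.
Lemma absvM x y : v (x * y) = v x * v y. Proof. by have [] := v_abs. Qed.
Lemma absvD x y : v (x + y) <= v x + v y. Proof. by have [] := v_abs. Qed.
Lemma absv0 : v 0 = 0. Proof. by apply/eqP; rewrite absv_eq0. Qed.
Lemma absv_gt0 x : (0 < v x) = (x != 0).
Proof. by rewrite lt_def absv_eq0 absv_ge0 andbT. Qed.
Lemma absv1 : v 1 = 1.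
Proof.
have v1 : v 1 != 0 by rewrite absv_eq0 oner_eq0.
by apply: (mulIf v1); rewrite -absvM !mul1r.
Qed.
Lemma absvN x : v (- x) = v x.
Proof.
suff vN1 : v (-1) = 1 by rewrite -mulN1r absvM vN1 mul1r.
have : v (-1) ^+ 2 == 1 by rewrite expr2 -absvM mulrNN mulr1 absv1.
rewrite sqrf_eq1 => /orP[/eqP //|/eqP e].
by have := absv_ge0 (-1); rewrite e ler0N1.
Qed.
Lemma absvB x y : v (x - y) <= v x + v y.
Proof. by rewrite -(absvN y) absvD. Qed.
Lemma absv_subC x y : v (x - y) = v (y - x).
Proof. by rewrite -absvN opprB. Qed.
Lemma absvX x k : v (x ^+ k) = v x ^+ k.
Proof. by elim: k => [|k ih]; rewrite ?absv1 // !exprS absvM ih. Qed.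
Lemma absvV x : v x^-1 = (v x)^-1.
Proof.
have [->|x0] := eqVneq x 0; first by rewrite invr0 absv0 invr0.
by apply: (mulfI (_ : v x != 0)); rewrite ?absv_eq0 // -absvM !divff ?absv1 ?absv_eq0.
Qed.
Lemma absv_sum (I : Type) (r : seq I) (P : pred I) (F : I -> L) :
  v (\sum_(i <- r | P i) F i) <= \sum_(i <- r | P i) v (F i).
Proof.
elim/big_rec2: _ => [|i y x _ le]; first by rewrite absv0.
by apply: le_trans (absvD _ _) _; rewrite lerD2l.
Qed.
Lemma absv_prod (I : Type) (r : seq I) (P : pred I) (F : I -> L) :
  v (\prod_(i <- r | P i) F i) = \prod_(i <- r | P i) v (F i).
Proof. exact: (big_morph _ absvM absv1). Qed.
Lemma absv_mmap1 n (z : 'I_n -> L) m : v (mmap1 z m) = mmap1 (v \o z) m.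
Proof. by rewrite absv_prod; apply: eq_bigr => i _; rewrite absvX. Qed.
Lemma absv_dist x y : v x - v y <= v (x - y).
Proof. by rewrite lerBlDr; have := absvD (x - y) y; rewrite subrK. Qed.

Lemma mmap1_ge0 n (x : 'I_n -> R) m : (forall j, 0 <= x j) -> 0 <= mmap1 x m.
Proof. by move=> x0; apply: prodr_ge0 => i _; rewrite exprn_ge0. Qed.

Lemma mmap1_le n (x y : 'I_n -> R) m : (forall j, 0 <= x j <= y j) ->
  mmap1 x m <= mmap1 y m.
Proof.
move=> xy; apply: ler_prod => i _; have /andP[x0 le] := xy i.
by rewrite exprn_ge0 // lerXn2r // ?nnegrE // (le_trans x0).
Qed.

Lemma mmap1_cst n (S : comNzRingType) (x : S) (m : 'X_{1..n}) :
  mmap1 (fun=> x) m = x ^+ mdeg m.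
Proof. by rewrite /mmap1 prodrXr mdegE. Qed.

Lemma mmap1D n (S : comNzRingType) (x : 'I_n -> S) m k :
  mmap1 x (m + k) = mmap1 x m * mmap1 x k.
Proof. by rewrite /mmap1 -big_split /=; apply: eq_bigr => i _; rewrite mnmDE exprD. Qed.

Section Summable.
Variable n : nat.
Implicit Types (f g : powser n L) (x : 'I_n -> R) (z : 'I_n -> L) (B C : R).

(** A weighted l^1 norm bounded through all truncations. It is submultiplicative by the triangle
    inequality alone, so that the complex and the p-adic cases are treated together. *)
Definition norm_le x B f :=
  forall d, \sum_(k : 'X_{1..n < d}) v (pcoef f k) * mmap1 x k <= B.
Definition summable x f := exists B, norm_le x B f.

Lemma norm_le_ge0 x B f : norm_le x B f -> 0 <= B.
Proof.
by move=> /(_ 0%N); apply: le_trans; rewrite big1 // => -[k lk].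
Qed.

Lemma norm_le_trans x B C f : B <= C -> norm_le x B f -> norm_le x C f.
Proof. by move=> BC h d; apply: le_trans BC. Qed.

Lemma norm_leW x y B f : (forall j, 0 <= x j <= y j) ->
  norm_le y B f -> norm_le x B f.
Proof.
move=> xy h d; apply: le_trans (h d); apply: ler_sum => k _.
by rewrite ler_wpM2l ?absv_ge0 // mmap1_le.
Qed.

Lemma norm_leD x B C f g : (forall j, 0 <= x j) ->
  norm_le x B f -> norm_le x C g -> norm_le x (B + C) (f + g).
Proof.
move=> x0 hf hg d; apply: le_trans (lerD (hf d) (hg d)).
rewrite -big_split /=; apply: ler_sum => k _.
by rewrite -mulrDl ler_wpM2r ?mmap1_ge0 // pcoefD absvD.
Qed.

Lemma norm_leM x B C f g : (forall j, 0 <= x j) ->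
  norm_le x B f -> norm_le x C g -> norm_le x (B * C) (f * g).
Proof.
move=> x0 hf hg d.
have S0 h : 0 <= \sum_(k : 'X_{1..n < d}) v (pcoef h k) * mmap1 x k.
  by apply: sumr_ge0 => k _; rewrite mulr_ge0 ?absv_ge0 ?mmap1_ge0.
apply: le_trans (ler_pM (S0 f) (S0 g) (hf d) (hg d)).
pose T (k : 'X_{1..n < d} * 'X_{1..n < d}) :=
  v (pcoef f k.1) * mmap1 x k.1 * (v (pcoef g k.2) * mmap1 x k.2).
have T0 k : 0 <= T k by rewrite !mulr_ge0 ?absv_ge0 ?mmap1_ge0.
rewrite big_distrlr /= pair_bigA /=.
have le1 : \sum_(m : 'X_{1..n < d}) v (pcoef (f * g) m) * mmap1 x m <=
    \sum_(m : 'X_{1..n < d}) \sum_(k : 'X_{1..n < d} * 'X_{1..n < d} | val m == (k.1 + k.2)%MM) T k.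
  apply: ler_sum => m _; rewrite (pcoefM_box _ _ (bmdeg m)).
  apply: le_trans (ler_wpM2r (mmap1_ge0 _ x0) (absv_sum _ _ _)) _.
  rewrite mulr_suml; apply: ler_sum => k /eqP ->.
  by rewrite absvM mmap1D mulrACA.
apply: (le_trans le1); rewrite (exchange_big_dep xpredT) //=; apply: ler_sum => k _.
have [lt|ge] := boolP (mdeg (k.1 + k.2) < d)%N.
  by rewrite (big_pred1 (BMultinom lt)).
rewrite big_pred0 ?T0 // => m; apply: contraNF ge => /eqP <-; exact: bmdeg.
Qed.

Lemma norm_le0 x : norm_le x 0 0.
Proof. by move=> d; rewrite big1 // => k _; rewrite pcoef0 absv0 mul0r. Qed.

Lemma norm_le_sum x (I : Type) (r : seq I) (P : pred I) (B : I -> R) F :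
    (forall j, 0 <= x j) -> (forall i, P i -> norm_le x (B i) (F i)) ->
  norm_le x (\sum_(i <- r | P i) B i) (\sum_(i <- r | P i) F i).
Proof.
move=> x0 h; elim/big_rec2: _ => [|i y1 y2 Pi ih]; first exact: norm_le0.
by apply: norm_leD => //; apply: h.
Qed.

Lemma norm_le_monomial x c m : (forall j, 0 <= x j) ->
  norm_le x (v c * mmap1 x m) (poly_ps (c *: 'X_[m])).
Proof.
move=> x0 d; have t0 : 0 <= v c * mmap1 x m by rewrite mulr_ge0 ?absv_ge0 ?mmap1_ge0.
have E (k : 'X_{1..n < d}) : v (pcoef (poly_ps (c *: 'X_[m])) k) * mmap1 x k =
    if m == k then v c * mmap1 x m else 0.
  rewrite pcoef_poly mcoeffZ mcoeffX; case: eqP => [<-|_].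
    by rewrite mulr1.
  by rewrite mulr0 absv0 mul0r.
rewrite (eq_bigr _ (fun k _ => E k)) -big_mkcond /=.
have [lt|ge] := boolP (mdeg m < d)%N.
  rewrite (big_pred1 (BMultinom lt)) // => k /=; exact/esym/val_eqE.
by rewrite big_pred0 // => k; apply: contraNF ge => /eqP ->; apply: bmdeg.
Qed.

Lemma norm_le_poly x p : (forall j, 0 <= x j) ->
  norm_le x (\sum_(k <- msupp p) v p@_k * mmap1 x k) (poly_ps p).
Proof.
move=> x0; have -> : poly_ps p = \sum_(k <- msupp p) poly_ps (p@_k *: 'X_[k]).
  by rewrite -raddf_sum -mpolyE.
by apply: norm_le_sum => // k _; apply: norm_le_monomial.
Qed.

Lemma norm_le_cst x c : (forall j, 0 <= x j) -> norm_le x (v c) (ps_cst n c).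
Proof.
move=> x0; have := @norm_le_monomial x c 0%MM x0.
rewrite mpolyX0 -mul_mpolyC mulr1 /mmap1 big1 ?mulr1 // => i _.
by rewrite mnm0E expr0.
Qed.

Lemma summableD x f g : (forall j, 0 <= x j) ->
  summable x f -> summable x g -> summable x (f + g).
Proof. by move=> x0 [B hB] [C hC]; exists (B + C); apply: norm_leD. Qed.

Lemma summableM x f g : (forall j, 0 <= x j) ->
  summable x f -> summable x g -> summable x (f * g).
Proof. by move=> x0 [B hB] [C hC]; exists (B * C); apply: norm_leM. Qed.

Lemma summable_poly x p : (forall j, 0 <= x j) -> summable x (poly_ps p).
Proof. by move=> x0; eexists; apply: norm_le_poly. Qed.

End Summable.
End AbsoluteValueTheory.

Section FiniteSums.
Variables (n : nat) (V : nmodType).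

Definition exponents d : seq 'X_{1..n} := map val (enum {: 'X_{1..n < d}}).

Lemma exponents_uniq d : uniq (exponents d).
Proof. by rewrite map_inj_uniq ?enum_uniq //; apply: val_inj. Qed.

Lemma mem_exponents d k : (k \in exponents d) = (mdeg k < d)%N.
Proof.
apply/mapP/idP => [[j _ ->]|lt]; first exact: bmdeg.
by exists (BMultinom lt); rewrite ?mem_enum.
Qed.

Lemma sum_exponents d (h : 'X_{1..n} -> V) (P : pred 'X_{1..n}) :
  \sum_(k : 'X_{1..n < d} | P k) h k = \sum_(k <- exponents d | P k) h k.
Proof. by rewrite big_map big_enum_cond. Qed.

Lemma sum_seq_sub (S T : seq 'X_{1..n}) (h : 'X_{1..n} -> V) :
    uniq S -> uniq T -> {subset S <= T} ->
  \sum_(k <- T) h k = \sum_(k <- S) h k + \sum_(k <- T | k \notin S) h k.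
Proof.
move=> uS uT ST; rewrite (bigID (mem S)) /=; congr (_ + _).
rewrite -big_filter; apply: perm_big; apply: uniq_perm => //.
  exact: filter_uniq.
by move=> k; rewrite mem_filter; case kS: (k \in S); rewrite //= ST.
Qed.

Lemma exponents_bound (S : seq 'X_{1..n}) : exists d, {subset S <= exponents d}.
Proof.
elim: S => [|k S [d hd]]; first by exists 0%N.
exists (maxn (mdeg k).+1 d) => j; rewrite inE => /predU1P[->|/hd].
  by rewrite mem_exponents leq_max leqnn.
by rewrite !mem_exponents => lt; rewrite leq_max lt orbT.
Qed.

Lemma exponentsS d d' : (d <= d')%N -> {subset exponents d <= exponents d'}.
Proof. by move=> le k; rewrite !mem_exponents => /leq_trans ->. Qed.

End FiniteSums.

Section PowerSeriesValues.
Variables (R : realType) (L : fieldType) (v : L -> R).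
Hypothesis v_abs : is_absval v.
Hypothesis v_complete : abs_complete v.

Definition tends (u : nat -> L) (s : L) :=
  forall e : R, 0 < e -> exists N, forall d, (N <= d)%N -> v (u d - s) < e.

Lemma tends_uniq u s t : tends u s -> tends u t -> s = t.
Proof.
move=> hs ht; apply/eqP; rewrite -subr_eq0 -(absv_eq0 v_abs) eq_le (absv_ge0 v_abs).
rewrite andbT leNgt; apply/negP => st; set e := v (s - t) in st.
have [N hN] := hs (e / 2) (divr_gt0 st (ltr0n _ 2)).
have [M hM] := ht (e / 2) (divr_gt0 st (ltr0n _ 2)).
have := ltrD (hN _ (leq_maxl N M)) (hM _ (leq_maxr N M)).
rewrite -splitr ltNge => /negP; apply; rewrite addrC (absv_subC v_abs _ s).
apply: le_trans (absvD v_abs _ _).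
by rewrite [X in _ <= v X]addrC addrA addrNK.
Qed.

Lemma tends_near u w s : (forall e : R, 0 < e -> exists N, forall d, (N <= d)%N ->
  v (u d - w d) < e) -> tends w s -> tends u s.
Proof.
move=> h hw e e0; have e2 := divr_gt0 e0 (ltr0n R 2).
have [N hN] := h _ e2; have [M hM] := hw _ e2.
exists (maxn N M) => d; rewrite geq_max => /andP[Nd Md].
have := ltrD (hN d Nd) (hM d Md); rewrite -splitr; apply: le_lt_trans.
by rewrite -[u d - s](subrKA (w d)) (absvD v_abs).
Qed.

Lemma tendsD u w s t : tends u s -> tends w t -> tends (fun d => u d + w d) (s + t).
Proof.
move=> hs ht e e0; have e2 := divr_gt0 e0 (ltr0n R 2).
have [N hN] := hs _ e2; have [M hM] := ht _ e2.
exists (maxn N M) => d; rewrite geq_max => /andP[Nd Md].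
have := ltrD (hN d Nd) (hM d Md); rewrite -splitr; apply: le_lt_trans.
by rewrite opprD addrACA (absvD v_abs).
Qed.

Lemma tends_bounded u s : tends u s -> exists2 B, 0 < B & exists N,
  forall d, (N <= d)%N -> v (u d) <= B.
Proof.
move=> /(_ 1 ltr01)[N hN]; exists (1 + v s).
  by rewrite ltr_pwDl // absv_ge0.
exists N => d /hN lt; rewrite -[u d](subrK s).
by apply: le_trans (absvD v_abs _ _) _; rewrite lerD2r ltW.
Qed.

Lemma tendsM u w s t : tends u s -> tends w t -> tends (fun d => u d * w d) (s * t).
Proof.
move=> hs ht e e0.
have [B B0 [K hK]] := tends_bounded hs.
have t1 : 0 < v t + 1 by rewrite ltr_wpDl ?(absv_ge0 v_abs).
have e1 : 0 < e / 2 / B by rewrite !divr_gt0.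
have e2 : 0 < e / 2 / (v t + 1) by rewrite !divr_gt0.
have [N hN] := hs _ e2; have [M hM] := ht _ e1.
exists (maxn K (maxn N M)) => d; rewrite !geq_max => /and3P[Kd Nd Md].
have -> : u d * w d - s * t = u d * (w d - t) + (u d - s) * t by ring.
apply: le_lt_trans (absvD v_abs _ _) _; rewrite !(absvM v_abs) [e]splitr.
apply: ler_ltD.
  apply: le_trans (ler_wpM2r (absv_ge0 v_abs _) (hK d Kd)) _.
  by rewrite mulrC -ler_pdivlMr // ltW // hM.
have := hN d Nd; rewrite ltr_pdivlMr //; apply: le_lt_trans.
by rewrite ler_wpM2l ?(absv_ge0 v_abs) // lerDl.
Qed.

Lemma tends_le u s B : tends u s -> (forall d, v (u d) <= B) -> v s <= B.
Proof.
move=> hs hB; apply/ler_addgt0Pl => e e0; have [N hN] := hs _ e0.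
rewrite -[s](subrK (u N)) addrC; apply: le_trans (absvD v_abs _ _) _.
by rewrite addrC lerD ?hB // (absv_subC v_abs) ltW // hN.
Qed.

Variable n : nat.
Implicit Types (f g : powser n L) (x : 'I_n -> R) (z : 'I_n -> L).

Let term_ge0 x f (k : 'X_{1..n}) : (forall j, 0 <= x j) -> 0 <= v (pcoef f k) * mmap1 x k.
Proof. by move=> x0; rewrite mulr_ge0 ?(absv_ge0 v_abs) ?mmap1_ge0. Qed.

Lemma norm_le_seq x B f (S : seq 'X_{1..n}) : (forall j, 0 <= x j) ->
  norm_le v x B f -> uniq S -> \sum_(k <- S) v (pcoef f k) * mmap1 x k <= B.
Proof.
move=> x0 hB uS; have [d hd] := exponents_bound S.
apply: le_trans (hB d); rewrite (sum_exponents d (fun k => v (pcoef f k) * mmap1 x k) xpredT).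
rewrite (sum_seq_sub _ uS (exponents_uniq _ _) hd) lerDl.
by apply: sumr_ge0 => k _; apply: term_ge0.
Qed.

(** Otherwise there would be arbitrarily many disjoint finite sets of exponents contributing at
    least e each, against the bound on the norm. *)
Lemma summable_tail x f : (forall j, 0 <= x j) -> summable v x f ->
  forall e : R, 0 < e -> exists N, forall S : seq 'X_{1..n}, uniq S ->
    (forall k, k \in S -> (N <= mdeg k)%N) ->
    \sum_(k <- S) v (pcoef f k) * mmap1 x k < e.
Proof.
move=> x0 [B hB] e e0; apply: contrapT => /forallNP h.
have big M : exists2 S : seq 'X_{1..n}, uniq S &
    M%:R * e <= \sum_(k <- S) v (pcoef f k) * mmap1 x k.
  elim: M => [|M [S uS hS]]; first by exists [::]; rewrite // big_nil mul0r.
  have [d hd] := exponents_bound S.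
  have /existsNP[T /not_implyP[uT /not_implyP[hT /negP]]] := h d.
  rewrite -leNgt => le; exists (S ++ T).
    rewrite cat_uniq uS uT andbT; apply/hasPn => k /hT dk.
    by apply/negP => /hd; rewrite mem_exponents ltnNge dk.
  by rewrite big_cat /= -[M.+1]addn1 natrD mulrDl mul1r lerD.
have [M hM] : exists M : nat, B / e < M%:R.
  by exists (Num.truncn (B / e)).+1; rewrite truncnS_gt.
have [S uS] := big M; rewrite leNgt => /negP; apply.
apply: le_lt_trans (norm_le_seq x0 hB uS) _.
by rewrite -ltr_pdivrMr.
Qed.

Definition partial_sum f z d : L := \sum_(k : 'X_{1..n < d}) pcoef f k * mmap1 z k.

Lemma partial_sumE f z d :
  partial_sum f z d = \sum_(k <- exponents n d) pcoef f k * mmap1 z k.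
Proof. exact: (sum_exponents d (fun k => pcoef f k * mmap1 z k) xpredT). Qed.

Lemma absv_term_le x f z (S : seq 'X_{1..n}) (P : pred 'X_{1..n}) :
    (forall j, v (z j) <= x j) ->
  v (\sum_(k <- S | P k) pcoef f k * mmap1 z k) <=
    \sum_(k <- S | P k) v (pcoef f k) * mmap1 x k.
Proof.
move=> zx; apply: le_trans (absv_sum v_abs _ _ _) _; apply: ler_sum => k _.
rewrite (absvM v_abs) (absv_mmap1 v_abs) ler_wpM2l ?(absv_ge0 v_abs) //.
by apply: mmap1_le => j; rewrite /= (absv_ge0 v_abs) zx.
Qed.

Lemma ps_sum_tends f z s : ps_sum v f z s -> tends (partial_sum f z) s.
Proof.
move=> h e /h[S0 hS]; have [N hN] := exponents_bound S0.
exists N => d Nd; rewrite partial_sumE; apply: hS (exponents_uniq _ _) _.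
by move=> k /hN; apply: exponentsS.
Qed.

Lemma ps_sum_uniq f z s t : ps_sum v f z s -> ps_sum v f z t -> s = t.
Proof. by move=> /ps_sum_tends hs /ps_sum_tends; apply: tends_uniq. Qed.

Lemma ps_valE f z s : ps_sum v f z s -> ps_val v f z = s.
Proof.
move=> hs; rewrite /ps_val; case: xgetP => [t _ ht|/(_ s)/(_ hs)//].
exact: ps_sum_uniq ht hs.
Qed.

Section AtPoint.
Variables (x : 'I_n -> R) (z : 'I_n -> L).
Hypothesis zx : forall j, v (z j) <= x j.

Let x0 j : 0 <= x j. Proof. exact: le_trans (absv_ge0 v_abs _) (zx j). Qed.

(** A tail of the norm bounds the error of every finite sum that contains all exponents of low
    degree; hence the partial sums are Cauchy and convergence is unconditional. *)
Lemma summable_ps_sum f : summable v x f -> exists s, ps_sum v f z s.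
Proof.
move=> sf.
have tail e : 0 < e -> exists N, forall S : seq 'X_{1..n}, uniq S ->
    {subset exponents n N <= S} ->
    v (\sum_(k <- S) pcoef f k * mmap1 z k - partial_sum f z N) < e.
  move=> e0; have [N hN] := summable_tail x0 sf e0; exists N => S uS NS.
  rewrite partial_sumE (sum_seq_sub _ (exponents_uniq _ _) uS NS) addrC addKr.
  apply: le_lt_trans (absv_term_le _ _ _ zx) _; rewrite -big_filter.
  apply: hN; first exact: filter_uniq.
  by move=> k; rewrite mem_filter mem_exponents -leqNgt => /andP[].
have [s hs] : exists s, tends (partial_sum f z) s.
  apply: v_complete => e e0; have e2 := divr_gt0 e0 (ltr0n R 2).
  have [N hN] := tail _ e2; exists N => i j Ni Nj.
  have hi := hN _ (exponents_uniq n i) (exponentsS Ni).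
  have hj := hN _ (exponents_uniq n j) (exponentsS Nj).
  have := ltrD hi hj; rewrite -splitr -!partial_sumE; apply: le_lt_trans.
  rewrite (absv_subC v_abs (partial_sum f z j)).
  by rewrite -[X in v X <= _](subrKA (partial_sum f z N)) (absvD v_abs).
exists s => e e0; have e2 := divr_gt0 e0 (ltr0n R 2).
have [N hN] := tail _ (divr_gt0 e2 (ltr0n R 2)); have [M hM] := hs _ e2.
exists (exponents n N) => S uS NS.
have hS := hN S uS NS.
have hj := hN _ (exponents_uniq n (maxn N M)) (exponentsS (leq_maxl N M)).
have := ltrD (ltrD hS hj) (hM _ (leq_maxr N M)); rewrite -!splitr; apply: le_lt_trans.
rewrite -partial_sumE (absv_subC v_abs (partial_sum f z _) (partial_sum f z N)).
rewrite -[X in v X <= _](subrKA (partial_sum f z (maxn N M))).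
rewrite -[X in v (X + _) <= _](subrKA (partial_sum f z N)).
by apply: le_trans (absvD v_abs _ _) _; rewrite lerD2r (absvD v_abs).
Qed.

Lemma ps_valP f : summable v x f -> ps_sum v f z (ps_val v f z).
Proof. by move=> /summable_ps_sum[s hs]; rewrite (ps_valE hs). Qed.

Lemma tends_ps_val f : summable v x f -> tends (partial_sum f z) (ps_val v f z).
Proof. by move=> /ps_valP/ps_sum_tends. Qed.

Lemma ps_val_tends f s : summable v x f -> tends (partial_sum f z) s ->
  ps_val v f z = s.
Proof. by move=> /tends_ps_val; apply: tends_uniq. Qed.

Lemma ps_valD f g : summable v x f -> summable v x g ->
  ps_val v (f + g) z = ps_val v f z + ps_val v g z.
Proof.
move=> sf sg; apply: ps_val_tends; first exact: summableD.
have -> : partial_sum (f + g) z = fun d => partial_sum f z d + partial_sum g z d.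
  apply: funext => d; rewrite /partial_sum -big_split /=.
  by apply: eq_bigr => k _; rewrite pcoefD mulrDl.
by apply: tendsD; apply: tends_ps_val.
Qed.

Lemma ps_val_poly p : ps_val v (poly_ps p) z = mmap idfun z p.
Proof.
apply: ps_val_tends; first exact: summable_poly.
move=> e e0; exists (msize p) => d le.
by rewrite /partial_sum (mmapE _ le) subrr (absv0 v_abs).
Qed.

Lemma ps_val_cst c : ps_val v (ps_cst n c) z = c.
Proof. by rewrite ps_val_poly mmapC. Qed.

(** The product of the partial sums up to degree d differs from the partial sum of the product by
    the pairs of exponents of total degree at least d. For d >= N + M the first has degree at least
    N or the second at least M, so the tails of the norms bound the difference. *)
Lemma ps_valM f g : summable v x f -> summable v x g ->
  ps_val v (f * g) z = ps_val v f z * ps_val v g z.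
Proof.
move=> sf sg; apply: ps_val_tends; first exact: summableM.
apply: (@tends_near _ (fun d => partial_sum f z d * partial_sum g z d)); last first.
  by apply: tendsM; apply: tends_ps_val.
move=> e e0; have [B hB] := sf; have [C hC] := sg.
have B1 : 0 < B + 1 by rewrite ltr_wpDl // (norm_le_ge0 hB).
have C1 : 0 < C + 1 by rewrite ltr_wpDl // (norm_le_ge0 hC).
have e1 : 0 < e / 2 / (C + 1) by rewrite !divr_gt0.
have e2 : 0 < e / 2 / (B + 1) by rewrite !divr_gt0.
have [N hN] := summable_tail x0 sf e1; have [M hM] := summable_tail x0 sg e2.
exists (N + M)%N => d ld.
pose F (k : 'X_{1..n}) := v (pcoef f k) * mmap1 x k.
pose G (k : 'X_{1..n}) := v (pcoef g k) * mmap1 x k.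
have tailE (h : 'X_{1..n} -> R) K : \sum_(k : 'X_{1..n < d} | (K <= mdeg k)%N) h k =
    \sum_(k <- [seq k <- exponents n d | (K <= mdeg k)%N]) h k.
  by rewrite big_filter -(sum_exponents d h (fun k => K <= mdeg k)%N).
have hF : \sum_(k : 'X_{1..n < d} | (N <= mdeg k)%N) F k < e / 2 / (C + 1).
  rewrite tailE; apply: hN; first by rewrite filter_uniq ?exponents_uniq.
  by move=> k; rewrite mem_filter => /andP[].
have hG : \sum_(k : 'X_{1..n < d} | (M <= mdeg k)%N) G k < e / 2 / (B + 1).
  rewrite tailE; apply: hM; first by rewrite filter_uniq ?exponents_uniq.
  by move=> k; rewrite mem_filter => /andP[].
pose t (p : 'X_{1..n < d} * 'X_{1..n < d}) :=
  (pcoef f p.1 * mmap1 z p.1) * (pcoef g p.2 * mmap1 z p.2).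
have eM : partial_sum f z d * partial_sum g z d = \sum_p t p.
  by rewrite /partial_sum big_distrlr /= pair_bigA.
have eP : partial_sum (f * g) z d = 
      \sum_(p : 'X_{1..n < d} * 'X_{1..n < d} | (mdeg (p.1 + p.2) < d)%N) t p.
  rewrite /partial_sum; under eq_bigr => m _ do
    rewrite (pcoefM_box _ _ (bmdeg m)) mulr_suml.
  rewrite (exchange_big_dep (fun p : 'X_{1..n < d} * 'X_{1..n < d} => mdeg (p.1 + p.2) < d)%N) /=; last first.
    by move=> m p _ /eqP <-; apply: bmdeg.
  apply: eq_bigr => p lt; rewrite (big_pred1 (BMultinom lt)) // => /=.
  by rewrite mmap1D mulrACA.
rewrite eP eM [X in _ - X](bigID (fun p : 'X_{1..n < d} * 'X_{1..n < d} => (mdeg (p.1 + p.2) < d)%N)) /=.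
rewrite opprD addrA subrr add0r (absvN v_abs).
apply: (@le_lt_trans _ _ (\sum_(p : 'X_{1..n < d} * 'X_{1..n < d})
   ((if (N <= mdeg p.1)%N then F p.1 else 0) * G p.2 +
    F p.1 * (if (M <= mdeg p.2)%N then G p.2 else 0)))).
  apply: le_trans (absv_sum v_abs _ _ _) _; rewrite big_mkcond /=.
  apply: ler_sum => p _.
  have F0 := @term_ge0 x f p.1 x0; have G0 := @term_ge0 x g p.2 x0.
  have tle : v (t p) <= F p.1 * G p.2.
    rewrite !(absvM v_abs) !(absv_mmap1 v_abs).
    by apply: ler_pM; rewrite ?mulr_ge0 ?(absv_ge0 v_abs) ?mmap1_ge0 ?ler_wpM2l
         ?(absv_ge0 v_abs) ?mmap1_le // => j /=; rewrite (absv_ge0 v_abs) ?zx.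
  have FG : 0 <= F p.1 * G p.2 by rewrite mulr_ge0.
  rewrite -leqNgt mdegD; case: ifP => [le|_]; last first.
    by rewrite addr_ge0 // mulr_ge0 //; case: ifP.
  have : (N <= mdeg p.1)%N || (M <= mdeg p.2)%N.
    by rewrite -[_ || _]negbK negb_or -!ltnNge; apply/negP => /andP[h1 h2];
       have := leq_trans (leq_add h1 h2) (leq_trans ld le);
       rewrite addSn ltnNge leq_add2l leqnSn.
  move=> /orP h; apply: le_trans tle _.
  by case: h => ->; rewrite ?lerDl ?lerDr mulr_ge0 //; case: ifP.
rewrite big_split /= -(pair_bigA _ (fun p q : 'X_{1..n < d} => (if (N <= mdeg p)%N then F p else 0) * G q)) /=.
rewrite -(pair_bigA _ (fun p q : 'X_{1..n < d} => F p * (if (M <= mdeg q)%N then G q else 0))) /=.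
rewrite -!big_distrlr /= -!big_mkcond /= [X in _ < X]splitr.
have S0 (P : pred 'X_{1..n < d}) h : (forall j, 0 <= h j) -> 0 <= \sum_(k | P k) h k :> R.
  by move=> h0; apply: sumr_ge0.
apply: ltrD.
  apply: (@le_lt_trans _ _ (\sum_(k : 'X_{1..n < d} | (N <= mdeg k)%N) F k * (C + 1))).
    rewrite -mulr_suml ler_wpM2l ?S0 // => [j|]; first exact: term_ge0.
    by apply: le_trans (hC d) _; rewrite lerDl.
  by rewrite -mulr_suml -ltr_pdivlMr.
apply: (@le_lt_trans _ _ ((B + 1) * \sum_(k : 'X_{1..n < d} | (M <= mdeg k)%N) G k)).
  rewrite ler_wpM2r ?S0 // => [j|]; first exact: term_ge0.
  by apply: le_trans (hB d) _; rewrite lerDl.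
by rewrite mulrC -ltr_pdivlMr.
Qed.

End AtPoint.
End PowerSeriesValues.

Lemma mmap1_mnm_act (F : fieldType) n (Omega : 'M[nat]_n) (z : 'I_n -> F) k :
  mmap1 z (mnm_act Omega k) = mmap1 (vec_act Omega z) k.
Proof.
rewrite /mmap1 /vec_act.
transitivity (\prod_(j < n) \prod_(i < n) z j ^+ (k i * Omega i j)).
  by apply: eq_bigr => j _; rewrite mnm_actE prodrXr.
rewrite exchange_big; apply: eq_bigr => i _; rewrite -prodrXl.
by apply: eq_bigr => j _; rewrite -exprM mulnC.
Qed.

Lemma sum_geometric_le (R : realType) (q : R) d : 0 <= q < 1 ->
  \sum_(i < d) q ^+ i <= (1 - q)^-1.
Proof.
move=> /andP[q0 q1]; have q1' : 0 < 1 - q by rewrite subr_gt0.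
rewrite -[leRHS]mul1r ler_pdivlMr // mulrC.
have -> : (1 - q) * \sum_(i < d) q ^+ i = 1 - q ^+ d.
  by rewrite -opprB -[RHS]opprB subrX1 mulNr.
by rewrite gerBl exprn_ge0.
Qed.

Lemma sum_mmap1_le (R : realType) n (q : 'I_n -> R) d : (forall j, 0 <= q j < 1) ->
  \sum_(k : 'X_{1..n < d}) mmap1 q k <= \prod_(j < n) (1 - q j)^-1.
Proof.
move=> hq; have q0 j : 0 <= q j by case/andP: (hq j).
apply: (@le_trans _ _ (\prod_(j < n) \sum_(i < d) q j ^+ i)); last first.
  apply: ler_prod => j _; rewrite sum_geometric_le // andbT.
  by apply: sumr_ge0 => i _; rewrite exprn_ge0.
rewrite bigA_distr_bigA /=.
case: d => [|d].
  by rewrite big1 => [|[k //]]; apply: sumr_ge0 => g _; apply: prodr_ge0 => j _; rewrite exprn_ge0.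
pose h (k : 'X_{1..n < d.+1}) : {ffun 'I_n -> 'I_d.+1} := [ffun j => inord (k j)].
have kd (k : 'X_{1..n < d.+1}) j : (k j < d.+1)%N.
  by apply: leq_ltn_trans (bmdeg k); rewrite mdegE (bigD1 j) //= leq_addr.
have h_inj : injective h.
  move=> k k' /ffunP e; apply/val_inj/mnmP => j; have := e j.
  by rewrite !ffunE => /(congr1 val) /=; rewrite !inordK.
rewrite [leRHS](bigID (mem (h @: [set: 'X_{1..n < d.+1}]%SET))) /= (big_imset _ (in2W h_inj)) /=.
have -> : \sum_(k : 'X_{1..n < d.+1}) mmap1 q k =
    \sum_(k in [set: 'X_{1..n < d.+1}]%SET) \prod_(j < n) q j ^+ h k j.
  apply: eq_big => [k|k _]; first by rewrite inE.
  by apply: eq_bigr => j _; rewrite ffunE inordK.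
by rewrite lerDl sumr_ge0 // => g _; apply: prodr_ge0 => j _; rewrite exprn_ge0.
Qed.

Section MoreValues.
Variables (R : realType) (L : fieldType) (v : L -> R).
Hypothesis v_abs : is_absval v.
Hypothesis v_complete : abs_complete v.
Variable n : nat.
Implicit Types (f g : powser n L) (x : 'I_n -> R) (z : 'I_n -> L).

Lemma absv_vec_act (Omega : 'M[nat]_n) z i :
  v (vec_act Omega z i) = vec_act Omega (v \o z) i.
Proof.
by rewrite /vec_act absv_prod //; apply: eq_bigr => j _; rewrite (absvX v_abs).
Qed.

Section Subst.
Variable Omega : 'M[nat]_n.
Hypothesis Omega_det : \det (mx_rat Omega) != 0.

Lemma norm_le_subst x B f : (forall j, 0 <= x j) ->
  norm_le v (vec_act Omega x) B f -> norm_le v x B (subst_ps Omega f).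
Proof.
move=> x0 hB d; apply: le_trans (hB d).
rewrite (@sum_mnm_act _ _ Omega d (fun m => v (pcoef (subst_ps Omega f) m) * mmap1 x m)) //.
  rewrite big_mkcond; apply: ler_sum => k _; rewrite pcoef_subst_act // mmap1_mnm_act.
  case: ifP => // _; rewrite mulr_ge0 ?(absv_ge0 v_abs) // -mmap1_mnm_act mmap1_ge0 //.
by move=> m h; rewrite pcoef_subst_out // absv0 // mul0r.
Qed.

Lemma summable_subst z y f : (forall j, v (vec_act Omega z j) <= y j) ->
  summable v y f -> summable v (v \o z) (subst_ps Omega f).
Proof.
move=> zy [B hB]; exists B; apply: norm_le_subst => [j|]; first exact: absv_ge0.
by apply: norm_leW hB => // j; rewrite -absv_vec_act (absv_ge0 v_abs) zy.
Qed.

(** A partial sum of f(Omega z) is that of f at Omega z without the exponents whose image under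
    Omega has degree at least d. For large d those all have degree at least N, so a tail of the norm
    bounds them. *)
Lemma ps_val_subst z y f : (forall j, v (vec_act Omega z j) <= y j) ->
  summable v y f -> ps_val v (subst_ps Omega f) z = ps_val v f (vec_act Omega z).
Proof.
move=> zy sf; apply: (ps_val_tends v_abs v_complete (x := v \o z)) => //.
  exact: summable_subst zy sf.
apply: tends_near (tends_ps_val v_abs v_complete zy sf) => // e e0.
have y0 j : 0 <= y j by apply: le_trans (absv_ge0 v_abs _) (zy j).
have [N hN] := summable_tail v_abs y0 sf e0.
have [D hD] := exponents_bound (map (mnm_act Omega) (exponents n N)).
exists D => d Dd; rewrite /partial_sum.
rewrite (@sum_mnm_act _ _ Omega d (fun m => pcoef (subst_ps Omega f) m * mmap1 z m)) //; last first.
  by move=> m h; rewrite pcoef_subst_out // mul0r.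
rewrite [X in _ - X](bigID (fun k : 'X_{1..n < d} => (mdeg (mnm_act Omega k) < d)%N)) /=.
rewrite opprD addrA; under eq_bigr do rewrite pcoef_subst_act // mmap1_mnm_act.
rewrite subrr add0r (absvN v_abs).
rewrite (sum_exponents d (fun k => pcoef f k * mmap1 (vec_act Omega z) k)
          (fun k => ~~ (mdeg (mnm_act Omega k) < d)%N)).
apply: le_lt_trans (absv_term_le v_abs _ _ _ zy) _; rewrite -big_filter.
apply: hN => [|k]; first by rewrite filter_uniq ?exponents_uniq.
rewrite mem_filter => /andP[ge _]; rewrite leqNgt; apply: contraNN ge => lt.
have : mnm_act Omega k \in exponents n D.
  by apply/hD/map_f; rewrite mem_exponents.
by rewrite mem_exponents => /leq_trans; apply.
Qed.

End Subst.

(** A form of the Schwarz lemma: shrinking the radius from delta to eta multiplies a monomial of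
    degree at least I by at most (eta / delta)^I. *)
Lemma ps_val_order_le (delta eta B : R) I f z :
    0 < delta -> 0 <= eta <= delta -> (forall j, v (z j) <= eta) ->
    (forall m, (mdeg m < I)%N -> pcoef f m = 0) ->
    norm_le v (fun=> delta) B f ->
  v (ps_val v f z) <= (eta / delta) ^+ I * B.
Proof.
move=> d0 /andP[e0 ed] ze hI hB.
have sf : summable v (fun=> delta) f by exists B.
have zd j : v (z j) <= delta by apply: le_trans (ze j) ed.
apply: (tends_le v_abs (tends_ps_val v_abs v_complete zd sf)) => d.
rewrite partial_sumE; apply: le_trans (absv_term_le v_abs _ _ xpredT ze) _.
have q0 : 0 <= eta / delta by rewrite divr_ge0 // ltW.
have dd k : eta ^+ k = (eta / delta) ^+ k * delta ^+ k.
  by rewrite -exprMn divfK // gt_eqF.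
apply: le_trans (ler_wpM2l (exprn_ge0 I q0) (hB d)).
rewrite (sum_exponents d (fun k => v (pcoef f k) * mmap1 (fun=> delta) k) xpredT).
rewrite mulr_sumr; apply: ler_sum => k _; rewrite !mmap1_cst.
have [lt|ge] := ltnP (mdeg k) I.
  by rewrite hI // absv0 // !mul0r mulr0.
rewrite dd [leRHS]mulrCA ler_wpM2l ?(absv_ge0 v_abs) // ler_wpM2r ?exprn_ge0 ?(ltW d0) //.
by apply: ler_wiXn2l; rewrite // ler_pdivrMr // mul1r.
Qed.

(** Abel's lemma: the terms at w are bounded, and those at z are smaller by factors whose sum is at
    most a product of geometric series with ratios |z_j| / |w_j|. *)
Lemma summable_of_ps_sum f z (w : 'I_n -> L) s : (forall j, v (z j) < v (w j)) ->
  ps_sum v f w s -> summable v (v \o z) f.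
Proof.
move=> zw hs; have w0 j : 0 < v (w j) by apply: le_lt_trans (zw j); apply: absv_ge0.
have [B B0 hB] : exists2 B, 0 <= B & forall k, v (pcoef f k * mmap1 w k) <= B.
  have [S0 hS] := hs 1 ltr01.
  (* A term outside S0 is the difference of two finite sums, each within 1 of s; a term of S0 is
     bounded by the displayed sum. *)
  exists (2 + \sum_(k <- undup S0) v (pcoef f k * mmap1 w k)) => [|k].
    by rewrite addr_ge0 // sumr_ge0 // => k _; apply: absv_ge0.
  have [kS|kS] := boolP (k \in undup S0).
    rewrite (bigD1_seq k) ?undup_uniq //= addrCA lerDl addr_ge0 // sumr_ge0 // => j _.
    exact: absv_ge0.
  rewrite ler_wpDr ?sumr_ge0 // => [j _|]; first exact: absv_ge0.
  have h1 := hS _ (undup_uniq S0) (fun j => _).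
  have h2 : v (\sum_(j <- k :: undup S0) pcoef f j * mmap1 w j - s) < 1.
    apply: hS => [|j js]; first by rewrite /= kS undup_uniq.
    by rewrite inE mem_undup js orbT.
  have {}h1 : v (\sum_(j <- undup S0) pcoef f j * mmap1 w j - s) < 1.
    by apply: h1 => j; rewrite mem_undup.
  have := ltrD h2 h1; rewrite big_cons => /ltW; apply: le_trans.
  apply: le_trans (absvB v_abs _ _).
  by rewrite opprB addrA addrNK addrK.
pose q j := v (z j) / v (w j).
have hq j : 0 <= q j < 1.
  by rewrite divr_ge0 ?(absv_ge0 v_abs) //= ltr_pdivrMr // mul1r zw.
exists (B * \prod_(j < n) (1 - q j)^-1) => d.
apply: le_trans (ler_wpM2l B0 (sum_mmap1_le d hq)); rewrite mulr_sumr.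
apply: ler_sum => k _; have -> : mmap1 (v \o z) k = mmap1 (v \o w) k * mmap1 q k.
  rewrite /mmap1 -big_split /=; apply: eq_bigr => j _.
  by rewrite -exprMn /q mulrC divfK // gt_eqF.
rewrite mulrA ler_wpM2r ?mmap1_ge0 // => [j|]; first by case/andP: (hq j).
by rewrite -absv_mmap1 // -(absvM v_abs).
Qed.

Lemma converges_near0_summable (delta : R) f : 0 < delta ->
  summable v (fun=> delta) f -> converges_near0 v f.
Proof.
move=> d0 sf; exists (fun=> delta) => // z hz.
by apply: (summable_ps_sum v_abs v_complete _ sf) => j; apply: ltW.
Qed.

(** The estimate of order 1 for f minus its constant term c makes the remainder at most |c| / 2 on a
    small polydisc. *)
Lemma ps_val_near0_ge (delta : R) f : 0 < delta -> summable v (fun=> delta) f ->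
    pcoef f 0%MM != 0 ->
  exists2 eta : R, 0 < eta <= delta &
    forall z, (forall j, v (z j) <= eta) -> v (pcoef f 0%MM) / 2 <= v (ps_val v f z).
Proof.
move=> d0 sf f0; pose c := pcoef f 0%MM.
have [B hB] : summable v (fun=> delta) (f - ps_cst n c).
  apply: summableD => // [j|]; first exact: ltW.
  have [C hC] : summable v (fun=> delta) (ps_cst n (- c)).
    by rewrite /ps_cst; apply: summable_poly => // j; apply: ltW.
  by exists C; rewrite -rmorphN.
have B1 : 0 < B + 1 by rewrite ltr_wpDl // (norm_le_ge0 hB).
have vc : 0 < v c by rewrite absv_gt0.
pose eta := Num.min delta (delta * (v c / 2 / (B + 1))).
have e0 : 0 < eta by rewrite lt_min d0 !mulr_gt0 ?invr_gt0.
have ed : eta <= delta by rewrite ge_min lexx.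
exists eta => [|z hz]; first by rewrite e0.
have hz' j : v (z j) <= delta by apply: le_trans (hz j) ed.
have le := @ps_val_order_le delta eta B 1 _ z d0 _ hz _ hB.
have {le} : v (ps_val v (f - ps_cst n c) z) <= (eta / delta) ^+ 1 * B.
  apply: le => [|m]; first by rewrite ltW.
  rewrite ltnS leqn0 mdeg_eq0 => /eqP ->.
  by rewrite pcoefD pcoefN pcoef_poly mcoeffC eqxx mulr1 subrr.
have -> : ps_val v (f - ps_cst n c) z = ps_val v f z - c.
  have sc : summable v (fun=> delta) (ps_cst n (- c)).
    by apply: (summable_poly v_abs) => j; apply: ltW.
  have := ps_valD v_abs v_complete hz' sf sc.
  by rewrite (ps_val_cst v_abs v_complete (x := fun=> delta)) // rmorphN.
rewrite expr1 => le; have {}le : v (ps_val v f z - c) <= v c / 2.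
  apply: le_trans le _.
  apply: (@le_trans _ _ (v c / 2 / (B + 1) * (B + 1))); last by rewrite divfK // gt_eqF.
  apply: ler_pM; rewrite ?lerDl ?(norm_le_ge0 hB) //.
    by rewrite divr_ge0 // ltW.
  by rewrite ler_pdivrMr // mulrC ge_min lexx orbT.
have := absv_dist v_abs c (c - ps_val v f z); rewrite subKr; apply: le_trans.
rewrite (absv_subC v_abs c) lerBrDr; apply: le_trans (lerD (lexx _) le) _.
by rewrite -splitr.
Qed.

End MoreValues.

(** * Recurrent sequences of functions that vanish along the orbit *)

Section VanishingTheorem.
Variables (R : realType) (L : fieldType) (v : L -> R).
Hypothesis v_abs : is_absval v.
Hypothesis v_complete : abs_complete v.
Variables (n : nat) (Omega : 'M[nat]_n).
Hypothesis Omega_det : \det (mx_rat Omega) != 0.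
Hypothesis Omega_unity : forall s (d : 'rV[rat]_n),
  (0 < s)%N -> d *m mx_rat Omega ^+ s = d -> d = 0.
Variable alpha : 'I_n -> L.
Let orb k := iter k (vec_act Omega) alpha.
Hypothesis orb_small : forall eta : R, 0 < eta ->
  exists N, forall k, (N <= k)%N -> forall j, v (orb k j) <= eta.
Hypothesis orb_generic : forall f : powser n L, f != 0 ->
  converges_near0 v f -> infinitely_many (fun k => ps_val v f (orb k) != 0).
Implicit Types (f g : powser n L).

Notation phi := (@subst_ps n L Omega).
Notation cst := (@ps_cst n L).

Section Delta.
Variable delta : R.
Hypothesis delta_gt0 : 0 < delta.
Hypothesis delta_le1 : delta <= 1.

Let delta_ge0 (j : 'I_n) : 0 <= (fun=> delta) j. Proof. exact: ltW. Qed.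

(** Since delta <= 1 and no row of Omega is zero, z -> Omega z maps the polydisc of radius delta
    into itself. *)
Lemma norm_le_subst_const B f :
  norm_le v (fun=> delta) B f -> norm_le v (fun=> delta) B (phi f).
Proof.
move=> hB; apply: norm_le_subst => //; apply: norm_leW hB => // j.
rewrite /vec_act prodrXr exprn_ge0 ?(ltW delta_gt0) //=.
case: (\sum_(i < n) Omega j i)%N (Omega_row_gt0 Omega_det j) => // s _.
by rewrite exprS ler_piMr ?exprn_ile1 ?(ltW delta_gt0).
Qed.

Lemma summable_subst_const f :
  summable v (fun=> delta) f -> summable v (fun=> delta) (phi f).
Proof. by move=> [B hB]; exists B; apply: norm_le_subst_const. Qed.

Lemma summable_cst c : summable v (fun=> delta) (cst c).
Proof. by apply: summable_poly. Qed.

Lemma summableN f : summable v (fun=> delta) f -> summable v (fun=> delta) (- f).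
Proof.
move=> sf; rewrite (_ : - f = cst (-1) * f); last by rewrite rmorphN1 mulN1r.
by apply: summableM => //; exact: summable_cst.
Qed.

Lemma summableB f g : summable v (fun=> delta) f -> summable v (fun=> delta) g ->
  summable v (fun=> delta) (f - g).
Proof.
by move=> sf sg; apply: summableD => //; apply: summableN.
Qed.

Lemma summable_shift_subs (s : seq L) (gam : nat -> powser n L) :
  (forall k, summable v (fun=> delta) (gam k)) ->
  forall k, summable v (fun=> delta) (shift_subs (map cst s) gam k).
Proof.
elim: s gam => //= x s ih gam h; apply: ih => k.
by apply: summableB => //; apply: summableM => //; exact: summable_cst.
Qed.

Let subst_shift_subs (s : seq L) (gam : nat -> powser n L) :
  shift_subs (map cst s) (fun k => phi (gam k)) =
    (fun k => phi (shift_subs (map cst s) gam k)).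
Proof.
have := shift_subs_rmorph (subst_rmorphism L Omega_det) (map cst s) gam.
rewrite -map_comp (eq_map (g := cst)) // => x /=; exact: subst_cst.
Qed.

(** Induction on the recurrence. Applying all its factors but the one with root lam leaves Lam_k =
    lam^k Lam_0. If Lam_0 = 0, a shorter recurrence already holds. Otherwise the combination [gam']
    has a shorter recurrence and vanishes along the orbit, hence is zero. Then y_k = gam_k / Lam_0
    satisfies y_(k+1)(Omega z) = lam y_k(z), which forces each y_k to be a constant x_k; if one of
    these were nonzero, Lam_0 would vanish at all late points of the orbit, against
    [orb_generic]. *)
Lemma vanishing_theorem (s : seq L) (gam : nat -> powser n L) :
    0 \notin s -> shift_subs (map cst s) gam = (fun=> 0) ->
    (forall k, summable v (fun=> delta) (gam k)) ->
    (exists N, forall k, (N <= k)%N -> ps_val v (gam k) (orb k) = 0) ->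
  forall k, gam k = 0.
Proof.
elim/last_ind: s gam => [|s lam ih] gam; first by move=> _ /= ->.
rewrite mem_rcons inE negb_or eq_sym => /andP[lam0 s0].
rewrite map_rcons shift_subs_rcons.
set Lam := shift_subs (map cst s) gam => LamE sgam [N hN].
have LamS k : Lam k.+1 = cst lam * Lam k.
  by have := congr1 (fun c => c k) LamE; rewrite /shift_sub => /eqP; rewrite subr_eq0 => /eqP.
have sLam k : summable v (fun=> delta) (Lam k) by apply: summable_shift_subs.
have [L0|L0] := eqVneq (Lam 0%N) 0.
  have LamK k : Lam k = 0 by elim: k => // k e; rewrite LamS e mulr0.
  by apply: ih => //; [exact: funext LamK | exists N].
have [M hM] := orb_small delta_gt0.
(* At Omega^k alpha the second term contains gam_(k+1) at Omega^(k+1) alpha, so both terms vanish.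
   The recurrence s turns them into lam^(k+1) Lam_0(Omega z) Lam_0(z) and its negative. *)
pose gam' k := (cst lam * phi (Lam 0%N)) * gam k + - Lam 0%N * phi (gam k.+1).
have gam'0 : forall k, gam' k = 0.
  apply: ih => //.
  - rewrite shift_subsD !shift_subsZ subst_shift_subs -/Lam.
    rewrite (shift_subs_shift (map cst s) gam) -/Lam.
    have LamX k : Lam k = cst (lam ^+ k) * Lam 0%N.
      elim: k => [|k e]; first by rewrite expr0 rmorph1 mul1r.
      by rewrite LamS e exprS rmorphM /= mulrA.
    apply: funext => k; rewrite (LamX k.+1) (LamX k) subst_psM // subst_cst //.
    by rewrite exprS rmorphM /=; ring.
  - move=> k; rewrite /gam' mulNr; apply: summableB.
      apply: summableM => //; apply: summableM => //; first exact: summable_cst.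
      exact: summable_subst_const.
    by apply: summableM => //; exact: summable_subst_const.
  exists (maxn N M) => k; rewrite geq_max => /andP[Nk Mk].
  have orbd j : v (orb k j) <= delta by apply: hM.
  have orbd' j : v (orb k.+1 j) <= delta by apply: hM; apply: leqW.
  rewrite /gam' (ps_valD v_abs v_complete orbd); first last.
  - apply: summableM => //; last exact: summable_subst_const.
    exact: summableN.
  - do 2?apply: summableM => //; first exact: summable_cst.
    exact: summable_subst_const.
  rewrite (ps_valM v_abs v_complete orbd) //; last first.
    by apply: summableM => //; [exact: summable_cst|exact: summable_subst_const].
  rewrite hN // mulr0 add0r (ps_valM v_abs v_complete orbd) //; last first.
  - exact: summable_subst_const.
  - exact: summableN.
  rewrite (ps_val_subst v_abs v_complete Omega_det orbd') //.
  by rewrite -[vec_act _ _]/(orb k.+1) hN ?mulr0 // leqW.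
have gamE k : cst lam * phi (Lam 0%N) * gam k = Lam 0%N * phi (gam k.+1).
  by have := gam'0 k; rewrite /gam' mulNr => /eqP; rewrite subr_eq0 => /eqP.
(* Induction on the recurrence t of th: for its first root mu, th_(k+1) - mu th_k is a multiple x
   Lam_0, so y = th_k / Lam_0 satisfies lam y = mu y(Omega z) + x and [mahler_constant] applies. *)
have constE (t : seq L) (th : nat -> powser n L) : 0 \notin t ->
    shift_subs (map cst t) th = (fun=> 0) ->
    (forall k, cst lam * phi (Lam 0%N) * th k = Lam 0%N * phi (th k.+1)) ->
    forall k, exists x, th k = cst x * Lam 0%N.
  elim: t th => [|mu t iht] th.
    by move=> _ /= -> _ k; exists 0; rewrite rmorph0 mul0r.
  rewrite inE negb_or eq_sym => /andP[mu0 t0] /= et hth k.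
  have [j|x hx] := iht (shift_sub (cst mu) th) t0 et _ k.
    rewrite /shift_sub mulrBr hth subst_psD // subst_psN // subst_psM // subst_cst //.
    by rewrite mulrBr; congr (_ - _); rewrite mulrCA hth; ring.
  apply: (@mahler_constant n L Omega Omega_det Omega_unity _ _ (lam / mu) (- x / mu)) => //.
    by rewrite mulf_neq0 ?invr_eq0.
  have e1 : th k.+1 = cst mu * th k + cst x * Lam 0%N.
    by rewrite -hx /shift_sub addrC subrK.
  have cmu0 : cst mu != 0.
    by rewrite -(rmorph0 cst); apply: contraNneq mu0 => /(congr1 (fun f => pcoef f 0%MM));
       rewrite !pcoef_poly !mcoeffC eqxx !mulr1 => ->.
  apply: (mulfI cmu0).
  have := hth k; rewrite e1 subst_psD // !subst_psM // !subst_cst // => e2.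
  rewrite [X in _ = X](_ : _ =
    (cst (mu * (lam / mu)) * th k + cst (mu * (- x / mu)) * Lam 0%N) * phi (Lam 0%N)).
    rewrite ![mu * (_ / mu)]mulrC !divfK // rmorphN /=.
    apply/eqP; rewrite -subr_eq0; move/eqP: e2; rewrite -subr_eq0 => /eqP e2.
    by rewrite -[X in _ == X]oppr0 -e2; apply/eqP; ring.
  by rewrite ![cst (mu * _)]rmorphM /=; ring.
have /choice[x hx] : forall k, exists x, gam k = cst x * Lam 0%N.
  apply: (constE (rcons s lam)) => //.
    by rewrite mem_rcons inE negb_or eq_sym lam0.
  by rewrite map_rcons shift_subs_rcons.
have phiL0 : phi (Lam 0%N) != 0.
  by rewrite -(subst_ps0 L Omega_det) (inj_eq (subst_ps_inj Omega_det)).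
have cst_inj : injective cst.
  move=> y y' /(congr1 (fun f => pcoef f 0%MM)).
  by rewrite !pcoef_poly !mcoeffC eqxx !mulr1.
have xS k : x k.+1 = lam * x k.
  have := gamE k; rewrite !hx subst_psM // subst_cst // => e.
  apply: cst_inj; apply: (mulIf phiL0); apply: (mulfI L0); rewrite rmorphM /=.
  by rewrite -e; ring.
suff x0 k : x k = 0 by move=> k; rewrite hx x0 rmorph0 mul0r.
apply/eqP/negPn/negP => xk0.
have xn0 j : (k <= j)%N -> x j != 0.
  by move=> /subnKC <-; elim: (j - k)%N => [|i e]; rewrite ?addn0 // addnS xS mulf_neq0.
have [|i] := orb_generic L0 _ (maxn k (maxn N M)).
  exact: converges_near0_summable (sLam _).
rewrite !gtn_max => /and3P[ki Ni Mi] /negP; apply.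
have := hN i (ltnW Ni); rewrite hx.
rewrite (ps_valM v_abs v_complete (hM i (ltnW Mi))) //; last exact: summable_cst.
rewrite (ps_val_cst v_abs v_complete (hM i (ltnW Mi))) => /eqP.
by rewrite mulf_eq0 (negPf (xn0 _ (ltnW ki))).
Qed.

End Delta.
End VanishingTheorem.

(** * Heights *)

Section Heights.
Variables (R : realType) (L : fieldType) (v : L -> R).
Hypothesis v_abs : is_absval v.
Hypothesis v_nat : forall d, (0 < d)%N -> (d%:R : R)^-1 <= v d%:R.
Variables (F : fieldExtType rat) (h : {rmorphism F -> L}).
Implicit Types (x y : L) (d e : nat) (a b s t : R).

Let D := \dim {:F}.
Let om (i : 'I_D) : L := h (vbasis {:F})`_i.

Let D_gt0 : (0 < D)%N. Proof. exact: adim_gt0. Qed.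
Let DR_ge1 : 1 <= D%:R :> R. Proof. by rewrite ler1n. Qed.

Lemma absv_nat_le d : v d%:R <= d%:R.
Proof.
elim: d => [|d ih]; first by rewrite (absv0 v_abs).
rewrite -addn1 !natrD; apply: le_trans (absvD v_abs _ _) _.
by rewrite (absv1 v_abs) lerD2r.
Qed.

Lemma absv_int_le (m : int) : v m%:~R <= `|m|%:~R.
Proof.
case: m => m; first exact: absv_nat_le.
by rewrite NegzE rmorphN /= (absvN v_abs) normrN absv_nat_le.
Qed.

Lemma natr_neq0 d : (0 < d)%N -> d%:R != 0 :> L.
Proof.
move=> d0; rewrite -(absv_eq0 v_abs) gt_eqF //.
by apply: lt_le_trans (v_nat d0); rewrite invr_gt0 ltr0n.
Qed.

(* Multiplication by d x on the Z-lattice spanned by a basis of the number    *)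
(* field has an integral matrix with entries of size at most a / D.           *)
Definition num_repr x d a := (0 < d)%N /\ exists M : 'M[int]_D,
  (forall i j, D%:R * `|M i j|%:~R <= a) /\
  forall i, d%:R * x * om i = \sum_j (M i j)%:~R * om j.

Lemma num_repr_ge0 x d a : num_repr x d a -> 0 <= a.
Proof.
move=> [_ [M [hM _]]]; apply: le_trans (hM (Ordinal D_gt0) (Ordinal D_gt0)).
by rewrite mulr_ge0 ?ler0n // ler0z.
Qed.

Lemma num_reprW x d a b : a <= b -> num_repr x d a -> num_repr x d b.
Proof.
by move=> ab [d0 [M [hM eM]]]; split=> //; exists M; split=> // i j; apply: le_trans ab.
Qed.

(** The factor D in the bound absorbs the D summands in each entry of the product matrix. *)
Lemma num_reprM x y d e a b : num_repr x d a -> num_repr y e b ->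
  num_repr (x * y) (d * e) (a * b).
Proof.
move=> hx hy; have a0 := num_repr_ge0 hx; have b0 := num_repr_ge0 hy.
have [d0 [M [hM eM]]] := hx; have [e0 [N [hN eN]]] := hy.
split; first by rewrite muln_gt0 d0.
exists (M *m N); split=> [i j|i].
  rewrite mxE; apply: (@le_trans _ _ (D%:R * \sum_k `|M i k|%:~R * `|N k j|%:~R)).
    rewrite ler_wpM2l ?ler0n // -(mulr1z 1).
    apply: le_trans (_ : (\sum_k `|M i k * N k j|)%:~R <= _).
      by rewrite ler_int ler_norm_sum.
    by rewrite rmorph_sum /=; apply: ler_sum => k _; rewrite normrM intrM.
  rewrite mulr_sumr; apply: (@le_trans _ _ (\sum_(k < D) (a * b / D%:R))).
    apply: ler_sum => k _; rewrite ler_pdivlMr ?ltr0n //.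
    rewrite [leLHS](_ : _ = (D%:R * `|M i k|%:~R) * (D%:R * `|N k j|%:~R)); last by ring.
    by apply: ler_pM; rewrite ?mulr_ge0 ?ler0n ?ler0z.
  by rewrite sumr_const card_ord -[(_ / _) *+ _]mulr_natr divfK // pnatr_eq0 -lt0n.
have -> : (d * e)%:R * (x * y) * om i = e%:R * y * (d%:R * x * om i).
  by rewrite natrM; ring.
rewrite eM mulr_sumr.
under eq_bigr => j _ do rewrite mulrCA eN mulr_sumr.
rewrite exchange_big /=; apply: eq_bigr => j _.
rewrite mxE rmorph_sum mulr_suml; apply: eq_bigr => k _.
by rewrite rmorphM /= mulrA.
Qed.

Lemma num_reprD x y d a b : num_repr x d a -> num_repr y d b ->
  num_repr (x + y) d (a + b).
Proof.
move=> [d0 [M [hM eM]]] [_ [N [hN eN]]]; split=> //; exists (M + N).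
split=> [i j|i].
  rewrite mxE; apply: le_trans (lerD (hM i j) (hN i j)); rewrite -mulrDr.
  by rewrite ler_wpM2l ?ler0n // -rmorphD /= ler_int ler_normD.
rewrite mulrDr mulrDl eM eN -big_split; apply: eq_bigr => j _.
by rewrite mxE rmorphD mulrDl.
Qed.

Lemma num_repr_scale x d e a : (0 < e)%N -> num_repr x d a ->
  num_repr x (d * e) (e%:R * a).
Proof.
move=> e0 [d0 [M [hM eM]]]; split; first by rewrite muln_gt0 d0.
exists (M *+ e); split=> [i j|i].
  rewrite mulmxnE normrMn rmorphMn /= -[_%:~R *+ e]mulr_natl mulrCA.
  by rewrite ler_wpM2l ?ler0n.
have -> : (d * e)%:R * x * om i = d%:R * x * om i * e%:R by rewrite natrM; ring.
rewrite eM mulr_suml.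
by apply: eq_bigr => j _; rewrite mulmxnE rmorphMn /= -[_%:~R *+ e]mulr_natr mulrAC.
Qed.

Lemma num_repr_nat (m : nat) : num_repr m%:R 1 (D%:R * m%:R).
Proof.
split=> //; exists (m%:R)%:M; split=> [i j|i].
  rewrite mxE ler_wpM2l ?ler0n //; case: eqP => _.
    by rewrite mulr1n ger0_norm ?ler0n // rmorph_nat.
  by rewrite normr0 ler0n.
rewrite mul1r (bigD1 i) //= big1 => [|j ji]; rewrite mxE.
  by rewrite eqxx mulr1n addr0 rmorph_nat.
by rewrite eq_sym (negPf ji) mul0r.
Qed.

Let ratL : {rmorphism rat -> L} := h \o in_alg F.

Lemma om_free (c : 'I_D -> rat) : \sum_i ratL (c i) * om i = 0 -> forall i, c i = 0.
Proof.
move=> e i; have /freeP := basis_free (vbasisP {:F}); apply.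
apply: (fmorph_inj h); rewrite rmorph0 rmorph_sum -[RHS]e; apply: eq_bigr => j _.
by rewrite -mulr_algl rmorphM.
Qed.

Lemma om_neq0 i : om i != 0.
Proof.
apply/eqP => e; have := @om_free (fun j => (j == i)%:R).
rewrite (bigD1 i) //= e mulr0 big1 ?addr0 => [/(_ erefl i)|j /negPf ->].
  by rewrite eqxx => /eqP; rewrite oner_eq0.
by rewrite mulr0n scale0r rmorph0 mul0r.
Qed.

Lemma det_int_le (k : nat) (M : 'M[int]_k) a : 0 <= a ->
  (forall i j, `|M i j|%:~R <= a) -> `|\det M|%:~R <= k`!%:R * a ^+ k.
Proof.
move=> a0 hM; apply: (@le_trans _ _ (\sum_(sg : 'S_k) a ^+ k)); last first.
  by rewrite sumr_const card_Sn mulr_natl.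
apply: (@le_trans _ _ (\sum_(sg : 'S_k) `|(-1) ^+ sg * \prod_i M i (sg i)|)%:~R).
  by rewrite ler_int ler_norm_sum.
rewrite rmorph_sum /=; apply: ler_sum => sg _.
rewrite normrM normr_sign mul1r normr_prod rmorph_prod /=.
rewrite -[k in a ^+ k]card_ord -prodr_const; apply: ler_prod => i _.
by rewrite ler0z normr_ge0 hM.
Qed.

(** The inverse of d x acts by adj M / det M, so |det M| is a denominator for 1/x with matrix
    sgn(det M) d adj M, and the Leibniz formula bounds both. M is nonsingular, since a row killed by
    it would be a rational relation between the basis elements. *)
Lemma num_repr_inv x d a : 1 <= a -> x != 0 -> num_repr x d a ->
  exists2 e, e%:R <= D`!%:R * a ^+ D &
    num_repr x^-1 e (D%:R * d%:R * (D`!%:R * a ^+ D)).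
Proof.
move=> a1 x0 [d0 [M [hM eM]]]; have a0 : 0 <= a by apply: le_trans a1.
have hM' i j : `|M i j|%:~R <= a.
  by apply: le_trans (hM i j); rewrite ler_peMl // ler0z.
have dx0 : d%:R * x != 0 by rewrite mulf_neq0 ?natr_neq0.
have detM : \det M != 0.
  apply/negP => dM; have : \det (map_mx (intr : int -> rat) M) == 0.
    by rewrite det_map_mx (eqP dM).
  move=> /det0P[c c0 cM]; case/eqP: c0; apply/rowP => i; rewrite mxE.
  apply: (om_free (c := fun i => c 0 i)); apply: (mulfI dx0); rewrite mulr0.
  rewrite mulr_sumr; under eq_bigr => j _ do rewrite mulrCA eM mulr_sumr.
  rewrite exchange_big big1 //= => j _.
  have := congr1 (fun B : 'rV[rat]_D => ratL (B 0 j)) cM.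
  rewrite !mxE rmorph0 rmorph_sum /= => e.
  transitivity ((\sum_i0 ratL (c 0 i0 * (map_mx intr M) i0 j)) * om j); last by rewrite e mul0r.
  rewrite mulr_suml; apply: eq_bigr => k _.
  by rewrite mxE rmorphM rmorph_int mulrA.
exists `|\det M|%N.
  by have := det_int_le a0 hM'; rewrite -abszE.
split; first by rewrite absz_gt0.
exists ((sgz (\det M) * d%:Z) *: \adj M); split=> [i j|i].
  rewrite mxE !normrM -!mulrA ler_wpM2l ?ler0n //.
  rewrite (_ : `|sgz (\det M)| = 1) ?mul1r; last first.
    by case: sgzP detM => //; rewrite ?eqxx // => _ _; rewrite ?normrN normr1.
  rewrite intrM ler_pM ?ler0z // mxE /cofactor normrM normr_sign mul1r.
  apply: le_trans (det_int_le a0 _) _; first by move=> p q; rewrite !mxE.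
  apply: ler_pM; rewrite ?ler0n ?exprn_ge0 //; last by rewrite ler_weXn2l ?leq_pred.
  by rewrite ler_nat; case: (D) => // d1; rewrite factS leq_pmull.
have key : (\det M)%:~R * om i = \sum_j (\adj M i j)%:~R * (d%:R * x * om j).
  under eq_bigr => j _ do rewrite eM mulr_sumr.
  rewrite exchange_big /=.
  have adjE k : \sum_j \adj M i j * M j k = (\det M) *+ (i == k).
    by have := congr1 (fun B : 'M_D => B i k) (mul_adj_mx M); rewrite !mxE.
  rewrite [RHS](_ : _ = \sum_k ((\det M) *+ (i == k))%:~R * om k).
    rewrite (bigD1 i) //= [X in _ + X]big1 => [|k]; first by rewrite eqxx mulr1n addr0.
    by rewrite eq_sym => /negPf ->; rewrite mulr0n mul0r.
  apply: eq_bigr => k _; rewrite -adjE rmorph_sum mulr_suml.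
  by apply: eq_bigr => j _; rewrite rmorphM /= mulrA.
have -> : (`|\det M|%N)%:R = (sgz (\det M))%:~R * (\det M)%:~R :> L.
  by rewrite -rmorphM /= -abszEsg -pmulrn.
apply: (mulfI x0); rewrite mulrA [x * _]mulrC -!mulrA (mulrA x^-1) mulVf // mul1r.
rewrite key !mulr_sumr; apply: eq_bigr => j _.
have -> : ((sgz (\det M) * d%:Z) *: \adj M) i j = sgz (\det M) * d%:Z * \adj M i j.
  by rewrite mxE.
by rewrite !rmorphM /=; ring.
Qed.

End Heights.

Section LogarithmicHeights.
Variables (R : realType) (L : fieldType) (v : L -> R).
Hypothesis v_abs : is_absval v.
Hypothesis v_nat : forall d, (0 < d)%N -> (d%:R : R)^-1 <= v d%:R.
Variables (F : fieldExtType rat) (h : {rmorphism F -> L}).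
Implicit Types (x y : L) (d e : nat) (a b s t : R).

Let D := \dim {:F}.
Let D_gt0 : (0 < D)%N. Proof. exact: adim_gt0. Qed.
Let DR_ge1 : 1 <= D%:R :> R. Proof. by rewrite ler1n. Qed.
Let DF_ge1 : 1 <= D`!%:R :> R. Proof. by rewrite ler1n fact_gt0. Qed.

Let DDF_ge1 : 1 <= D%:R * D`!%:R :> R.
Proof. by apply: le_trans DF_ge1 _; rewrite ler_peMl ?ler0n. Qed.

Definition min_height : R := ln (2 * D%:R * D`!%:R).

(** An upper bound s for a logarithmic height: e^s / 2 bounds both a denominator and the size of the
    numerator. Because of the halves, sums as well as products simply add these bounds; the floor
    [min_height] absorbs the constants 2, D and D!. *)
Definition lheight x s := min_height <= s /\
  exists d, d%:R <= expR s / 2 /\ num_repr h x d (expR s / 2).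

Lemma min_height_exp s : min_height <= s -> 2 * D%:R * D`!%:R <= expR s.
Proof.
rewrite -ler_expR /min_height lnK // posrE !mulr_gt0 ?ltr0n ?fact_gt0 //.
Qed.

Lemma min_height_exp2 s : min_height <= s -> 2 <= expR s.
Proof.
move=> /min_height_exp; apply: le_trans; rewrite -mulrA ler_peMr //.
Qed.

Lemma min_height_expD s : min_height <= s -> D%:R <= expR s / 2.
Proof.
move=> /min_height_exp; rewrite -mulrA => le; rewrite ler_pdivlMr // mulrC.
by apply: le_trans le; rewrite ler_wpM2l // ler_peMr // ler0n.
Qed.

Lemma min_height_ge0 : 0 <= min_height.
Proof.
apply: ln_ge0; rewrite -mulrA; apply: (@le_trans _ _ (2 * 1)).
  by rewrite mulr1 ler1n.
by rewrite ler_wpM2l.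
Qed.

Lemma lheightW x s t : s <= t -> lheight x s -> lheight x t.
Proof.
move=> st [s0 [d [hd nd]]]; split; first exact: le_trans st.
have le : expR s / 2 <= expR t / 2 by rewrite ler_wpM2r ?invr_ge0 // ler_expR.
by exists d; split; [exact: le_trans le | exact: num_reprW nd].
Qed.

Lemma lheightM x y s t : lheight x s -> lheight y t -> lheight (x * y) (s + t).
Proof.
move=> [s0 [d [hd nd]]] [t0 [e [he ne]]]; have m0 := min_height_ge0; split.
  by rewrite -[min_height]addr0 lerD // (le_trans m0).
have le : (expR s / 2) * (expR t / 2) <= expR (s + t) / 2.
  rewrite expRD [leLHS](_ : _ = expR s * expR t / 2 * 2^-1); last by field.
  by rewrite ler_piMr ?invf_le1 ?ler1n // !mulr_ge0 ?expR_ge0 ?invr_ge0.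
exists (d * e)%N; split; last by apply: num_reprW le _; apply: num_reprM.
by apply: le_trans le; rewrite natrM ler_pM ?ler0n.
Qed.

Lemma lheightD x y s t : lheight x s -> lheight y t -> lheight (x + y) (s + t).
Proof.
move=> [s0 [d [hd nd]]] [t0 [e [he ne]]]; have m0 := min_height_ge0; split.
  by rewrite -[min_height]addr0 lerD // (le_trans m0).
have es := expR_ge0 s; have et := expR_ge0 t.
have le : (expR s / 2) * (expR t / 2) + (expR s / 2) * (expR t / 2) <= expR (s + t) / 2.
  by rewrite expRD le_eqVlt; apply/orP; left; apply/eqP; field.
have pos : 0 <= (expR s / 2) * (expR t / 2) by rewrite !mulr_ge0 ?invr_ge0.
have [e0 _] := ne; have [d0 _] := nd.
exists (d * e)%N; split.
  apply: (@le_trans _ _ ((expR s / 2) * (expR t / 2))); last first.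
    by apply: le_trans le; rewrite lerDl.
  by rewrite natrM ler_pM ?ler0n.
apply: num_reprW le _; apply: num_reprD.
  apply: num_reprW (num_repr_scale e0 nd); rewrite mulrC.
  by rewrite ler_wpM2l // mulr_ge0 ?invr_ge0.
rewrite mulnC; apply: num_reprW (num_repr_scale d0 ne).
by rewrite ler_wpM2r // mulr_ge0 ?invr_ge0.
Qed.

Lemma lheight_nat (m : nat) s : (m <= 1)%N -> min_height <= s -> lheight m%:R s.
Proof.
move=> m1 s0; split=> //; have le := min_height_expD s0.
exists 1%N; split; first exact: le_trans le.
apply: num_reprW (num_repr_nat _ h m); apply: le_trans le.
by rewrite ler_piMr ?ler0n // lern1.
Qed.

(** In [num_repr_inv] the determinant costs e^(D s); one more factor e^s pays for d and another for
    the constants. The inverse of 0 is 0. *)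
Lemma lheightV x s : lheight x s -> lheight x^-1 (D.+2%:R * s).
Proof.
move=> hx; have [s0 [d [hd nd]]] := hx.
have sge0 : 0 <= s by apply: le_trans s0; apply: min_height_ge0.
have ss : min_height <= D.+2%:R * s.
  by apply: le_trans s0 _; rewrite ler_peMl // ler1n.
have [->|x0] := eqVneq x 0.
  by rewrite invr0; apply: (lheight_nat (m := 0)).
have e1 : 1 <= expR s / 2 by rewrite ler_pdivlMr // mul1r min_height_exp2.
have [e he ne] := num_repr_inv v_abs v_nat e1 x0 nd.
have eE : expR (D.+2%:R * s) = expR s ^+ D * (expR s * expR s).
  by rewrite expRM_natl -addn2 exprD expr2.
have pw : (expR s / 2) ^+ D <= expR s ^+ D.
  rewrite lerXn2r ?nnegrE ?mulr_ge0 ?expR_ge0 ?invr_ge0 //.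
  by rewrite ler_piMr ?expR_ge0 // invf_le1 ?ler1n.
have es := expR_ge0 s; have D1 := min_height_exp s0.
have DF : D`!%:R * (expR s / 2) ^+ D <= D`!%:R * expR s ^+ D by rewrite ler_wpM2l ?ler0n.
split=> //; exists e; split.
  apply: le_trans he _; apply: le_trans DF _; rewrite eE mulrC -mulrA.
  rewrite ler_wpM2l ?exprn_ge0 // ler_pdivlMr //.
  apply: (@le_trans _ _ (expR s * 1)); last by rewrite ler_wpM2l // (le_trans _ (min_height_exp2 s0)) ?ler1n.
  rewrite mulr1; apply: le_trans D1; rewrite mulrC ler_wpM2r ?ler0n //.
  by rewrite ler_peMr.
apply: num_reprW ne; rewrite eE.
apply: (@le_trans _ _ (D%:R * (expR s / 2) * (D`!%:R * expR s ^+ D))).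
  apply: ler_pM => //; rewrite ?mulr_ge0 ?ler0n ?exprn_ge0 ?mulr_ge0 ?invr_ge0 //.
  by rewrite ler_wpM2l ?ler0n.
have aux (a b c e' : R) : a * (b / 2) * (c * e') = (e' * b) * (a * c) / 2 by field.
rewrite aux.
rewrite ler_wpM2r ?invr_ge0 // [leRHS]mulrA ler_wpM2l ?mulr_ge0 ?exprn_ge0 //.
by apply: le_trans D1; rewrite -mulrA ler_peMl ?mulr_ge0 ?ler0n ?ler1n.
Qed.

Lemma lheight_absv : exists2 kap : R, 0 < kap &
  forall x s, lheight x s -> v x <= expR (kap * s).
Proof.
pose om (i : 'I_D) : L := h (vbasis {:F})`_i; pose i0 := Ordinal D_gt0.
have om0 : 0 < v (om i0) by rewrite absv_gt0 // /om om_neq0.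
pose W := \sum_j v (om j) / v (om i0).
have W0 : 0 <= W by apply: sumr_ge0 => j _; rewrite divr_ge0 // absv_ge0.
have l2 : 0 < ln (2 : R) by rewrite ln_gt0 // ltr1n.
(* One s pays for the denominator and one for the matrix entries; W <= e^W <= e^(s W / ln 2) because
   s >= ln 2. *)
exists (2 + W / ln 2) => [|x s [s0 [d [hd [d0 [M [hM eM]]]]]]].
  by rewrite ltr_wpDr // divr_ge0 // ltW.
have sl : ln 2 <= s by rewrite -ler_expR lnK ?posrE // min_height_exp2.
have vd : 0 < v d%:R by rewrite absv_gt0 // (natr_neq0 v_abs v_nat).
have eq1 : v d%:R * v x * v (om i0) <= expR s / 2 * (W * v (om i0)).
  rewrite -!(absvM v_abs) /om eM; apply: le_trans (absv_sum v_abs _ _ _) _.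
  rewrite mulr_suml mulr_sumr; apply: ler_sum => j _.
  rewrite (absvM v_abs) divfK ?gt_eqF // ler_wpM2r ?absv_ge0 //.
  apply: le_trans (absv_int_le v_abs _) _; apply: le_trans (hM i0 j).
  by rewrite ler_peMl // ler0z.
have eq2 : v x <= d%:R * (expR s / 2 * W).
  rewrite -(ler_pM2r om0); apply: (@le_trans _ _ (d%:R * (v d%:R * v x * v (om i0)))).
    rewrite -!mulrA !(mulrA d%:R) ler_peMl ?mulr_ge0 ?absv_ge0 //.
    by rewrite mulrC -ler_pdivrMr ?ltr0n // mul1r v_nat.
  by rewrite -[leRHS]mulrA -[X in _ <= _ * X]mulrA ler_wpM2l ?ler0n.
apply: le_trans eq2 _; rewrite mulrDl expRD.
have es := expR_ge0 s.
have hE : expR (2 * s) = expR s * expR s by rewrite expRM_natl expr2.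
rewrite hE mulrA; apply: ler_pM => //.
- by rewrite !mulr_ge0 ?ler0n ?invr_ge0.
- apply: ler_pM => //; rewrite ?ler0n ?mulr_ge0 ?invr_ge0 //.
    by apply: le_trans hd _; rewrite ler_piMr // invf_le1 ?ler1n.
  by rewrite ler_piMr // invf_le1 ?ler1n.
apply: (@le_trans _ _ (expR W)).
  by apply: le_trans (expR_ge1Dx W); rewrite lerDr.
rewrite ler_expR -mulrA ler_peMr // mulrC ler_pdivlMr // mul1r //.
Qed.

(** Liouville's inequality, obtained from the upper bound for the inverse. *)
Lemma lheight_absv_ge : exists2 kap : R, 0 < kap &
  forall x s, lheight x s -> x != 0 -> expR (- (kap * s)) <= v x.
Proof.
have [k k0 hk] := lheight_absv; exists (k * D.+2%:R) => [|x s hx x0].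
  by rewrite mulr_gt0 // ltr0n.
have := hk _ _ (lheightV hx); rewrite (absvV v_abs) mulrA => le.
have vx : 0 < v x by rewrite absv_gt0.
rewrite expRN -[v x]invrK lef_pV2 // ?posrE ?expR_gt0 ?invr_gt0 //.
Qed.

(** Multiplication by th has a rational matrix in the basis; d is the product of the denominators of
    its entries. *)
Lemma lheight_field (th : F) : exists s, lheight (h th) s.
Proof.
pose q (i j : 'I_D) := coord (vbasis {:F}) j (th * (vbasis {:F})`_i).
pose d := (\prod_i \prod_j `|denq (q i j)|)%N.
have den0 (x : rat) : (0 < `|denq x|)%N by rewrite absz_gt0 denq_neq0.
have d0 : (0 < d)%N by apply: prodn_gt0 => i; apply: prodn_gt0 => j.
have [m hm] : exists m : 'I_D -> 'I_D -> int, forall i j,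
    d%:R * q i j = (m i j)%:~R :> rat.
  have ex i j : exists z : int, d%:R * q i j = z%:~R.
    have /dvdnP[c hc] : (`|denq (q i j)| %| d)%N.
      rewrite /d (bigD1 i) //= dvdn_mulr // (bigD1 j) //= dvdn_mulr //.
    exists (c%:Z * numq (q i j)); rewrite -[q i j in LHS]divq_num_den hc natrM.
    rewrite intrM -!mulrA; congr (_ * _).
    rewrite [_%:R](_ : _ = (denq (q i j))%:~R); last first.
      by rewrite -{2}(absz_denq (q i j)).
    by rewrite mulrC divfK // intr_eq0 denq_neq0.
  have /choice[m hm] := fun ij : 'I_D * 'I_D => ex ij.1 ij.2.
  by exists (fun i j => m (i, j)) => i j; apply: (hm (i, j)).
have nr : num_repr h (h th) d (\sum_i \sum_j D%:R * `|m i j|%:~R : R).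
  split=> //; exists (\matrix_(i, j) m i j); split=> [i j|i].
    rewrite mxE (bigD1 i) //= (bigD1 j) //= -addrA lerDl addr_ge0 ?sumr_ge0 //.
      by move=> k _; rewrite mulr_ge0 ?ler0n ?ler0z.
    by move=> k _; apply: sumr_ge0 => l _; rewrite mulr_ge0 ?ler0n ?ler0z.
  rewrite -mulrA -rmorphM /= (coord_vbasis (memvf (th * _))) rmorph_sum mulr_sumr.
  apply: eq_bigr => j _; rewrite mxE -/(q i j).
  rewrite -mulr_algl rmorphM mulrA; congr (_ * _).
  have -> : d%:R = h (d%:R)%:A by rewrite scaler_nat rmorph_nat.
  rewrite -rmorphM /= -[X in h (X * _)]/(in_alg F d%:R) -[X in h (_ * X)]/(in_alg F _).
  by rewrite -rmorphM hm rmorph_int rmorph_int.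
set B := \sum_i _ in nr.
pose t := B + d%:R + 1; have B0 : 0 <= B := num_repr_ge0 nr.
exists (min_height + ln (2 * t)).
have t1 : 1 <= t by rewrite lerDr addr_ge0 ?ler0n.
have t0 : 0 < t by apply: lt_le_trans t1.
have te : t <= expR (min_height + ln (2 * t)) / 2.
  rewrite expRD lnK ?posrE ?mulr_gt0 // ler_pdivlMr // [t * 2]mulrC.
  by rewrite ler_peMl ?mulr_ge0 ?(ltW t0) // -expR0 ler_expR min_height_ge0.
split.
  rewrite lerDl ln_ge0 //; apply: (@le_trans _ _ (2 * 1)); first by rewrite mulr1 ler1n.
  by rewrite ler_wpM2l.
exists d; split.
  by apply: le_trans te; rewrite /t -addrA addrCA lerDl addr_ge0.
by apply: num_reprW nr; apply: le_trans te; rewrite /t -addrA lerDl addr_ge0 ?ler0n.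
Qed.

End LogarithmicHeights.

(** * Values of rational functions and extension of scalars *)

Lemma rmorph_mmap n (A B C : nzRingType) (Phi : {rmorphism B -> C}) (f : A -> B)
    (h : 'I_n -> B) (p : {mpoly A[n]}) :
  Phi (mmap f h p) = mmap (Phi \o f) (Phi \o h) p.
Proof.
rewrite /mmap rmorph_sum; apply: eq_bigr => m _; rewrite rmorphM /mmap1 rmorph_prod.
by congr (_ * _); apply: eq_bigr => i _; rewrite rmorphXn.
Qed.

Lemma eq_mmap n (A B : nzRingType) (f f' : A -> B) (h h' : 'I_n -> B) (p : {mpoly A[n]}) :
  f =1 f' -> h =1 h' -> mmap f h p = mmap f' h' p.
Proof.
move=> ef eh; apply: eq_bigr => m _; rewrite ef; congr (_ * _).
exact: mmap1_eq.
Qed.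

Lemma mmap_id n (A : nzRingType) (p : {mpoly A[n]}) :
  mmap (@mpolyC n A) (fun i => 'X_i) p = p.
Proof.
rewrite {2}[p]mpolyE; apply: eq_bigr => m _.
by rewrite mmap1_id mul_mpolyC.
Qed.

Section Translation.
Variables (n : nat) (K L : fieldType) (kap : {rmorphism K -> L}).
Implicit Types (p q : {mpoly K[n]}) (x : 'I_n -> L).

Definition translate x p : {mpoly L[n]} :=
  mmap (@mpolyC n L \o kap) (fun i => 'X_i + (x i)%:MP) p.

(** The Taylor expansion of p at a generic point; its coefficients are the Hasse derivatives of
    p. *)
Definition hasse p : {mpoly {mpoly K[n]}[n]} :=
  mmap (@mpolyC n {mpoly K[n]} \o @mpolyC n K)
    (fun i => 'X_i + ('X_i : {mpoly K[n]})%:MP) p.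

Lemma translateM x p q : translate x (p * q) = translate x p * translate x q.
Proof. exact: (rmorphM (mmap (@mpolyC n L \o kap) _)). Qed.

Lemma translate_hasse x p m : (translate x p)@_m = mmap kap x (hasse p)@_m.
Proof.
rewrite -(mcoeff_map_mpoly (mmap kap x)) /hasse rmorph_mmap; congr (_ @_ m).
apply: eq_mmap => [c|i] /=; first by rewrite map_mpolyC /= mmapC.
by rewrite rmorphD /= map_mpolyX map_mpolyC /= mmapX mmap1U.
Qed.

Lemma translate0 x p : (translate x p)@_0%MM = mmap kap x p.
Proof.
rewrite /translate -[LHS]/(mcoeff 0%MM _) rmorph_mmap; apply: eq_mmap => [c|i] /=.
  by rewrite mcoeffC eqxx mulr1.
rewrite mcoeffD mcoeffC eqxx mulr1 mcoeffX -mdeg_eq0 mdeg1 /= add0r //.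
Qed.

Lemma map_mpoly_inj : injective (@map_mpoly n K L kap).
Proof.
move=> p q /mpolyP e; apply/mpolyP => m; have := e m.
by rewrite !mcoeff_map_mpoly => /fmorph_inj.
Qed.

Lemma translate_inj x p : p != 0 -> translate x p != 0.
Proof.
apply: contraNneq => e.
have : mmap (@mpolyC n L) (fun i => 'X_i - (x i)%:MP) (translate x p) = map_mpoly kap p.
  rewrite /translate rmorph_mmap -[RHS]mmap_id /map_mpoly rmorph_mmap.
  apply: eq_mmap => [c|i] /=; first by rewrite !mmapC.
  by rewrite rmorphD /= !mmapX !mmap1U mmapC subrK.
by rewrite e rmorph0 -(rmorph0 (map_mpoly kap)) => /map_mpoly_inj <-.
Qed.

(* A value N'(x) / D'(x) of a rational function is the quotient of the        *)
(* leading Taylor coefficients at x of any other representation N / D.        *)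
Lemma ratfun_value_hasse (b : {fraction {mpoly K[n]}}) N D x y : D != 0 ->
    b = N%:F / D%:F -> ratfun_value kap b x y -> y != 0 ->
  exists m, [/\ m \in msupp (hasse D), mmap kap x (hasse D)@_m != 0 &
    y = mmap kap x (hasse N)@_m / mmap kap x (hasse D)@_m].
Proof.
move=> D0 eb [N' [D' [eb' Dx ey]]] y0.
have D'0 : D' != 0 by apply: contraNneq Dx => ->; rewrite rmorph0.
have e : N * D' = N' * D.
  apply/eqP; rewrite -tofrac_eq !tofracM -eqr_div ?tofrac_eq0 //.
  by rewrite -eb eb'.
have Nx : mmap kap x N' != 0 by apply: contraNneq y0 => h; rewrite ey h mul0r.
have l0 p : mmap kap x p != 0 -> least_exp (poly_ps (translate x p)) 0%MM.
  by move=> px; split; rewrite ?pcoef_poly ?translate0 // => k; rewrite ltNge le0x.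
have lD' := l0 _ Dx; have lN' := l0 _ Nx.
have [m lm] : exists m, least_exp (poly_ps (translate x D)) m.
  by apply: least_expP; rewrite -(rmorph0 (@poly_ps n L)) (inj_eq (@poly_ps_inj n L)) translate_inj.
have eT : poly_ps (translate x N) * poly_ps (translate x D') =
    poly_ps (translate x N') * poly_ps (translate x D).
  rewrite -[LHS](rmorphM (@poly_ps n L)) -[RHS](rmorphM (@poly_ps n L)).
  by rewrite -!translateM e.
have [k lk] : exists k, least_exp (poly_ps (translate x N)) k.
  apply: least_expP; apply: contra_neq (least_exp_neq0 (least_expM lN' lm)) => z.
  by rewrite -eT z mul0r.
have km : k = m.
  have := least_expM lk lD'; rewrite eT => /least_exp_uniq/(_ (least_expM lN' lm)).
  by rewrite addm0 add0m.
have := least_exp_mul_coef lk lD'; rewrite eT km addm0 -{1}[m]add0m.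
rewrite (least_exp_mul_coef lN' lm) !pcoef_poly !translate0 => ec.
have [Dm _] := lm; rewrite pcoef_poly in Dm.
have Dm' : mmap kap x (hasse D)@_m != 0.
  by apply: contraNneq Dm => z; apply/eqP/(etrans (translate_hasse x D m)).
exists m; split=> //.
  by rewrite mcoeff_msupp; apply: contraNneq Dm' => ->; rewrite rmorph0.
transitivity ((translate x N)@_m / (translate x D)@_m).
  by apply/eqP; rewrite ey eqr_div //; apply/eqP.
by congr (_ / _); exact: translate_hasse.
Qed.

End Translation.

Section HeightsOfValues.
Variables (R : realType) (L : fieldType) (v : L -> R).
Hypothesis v_abs : is_absval v.
Hypothesis v_nat : forall d, (0 < d)%N -> (d%:R : R)^-1 <= v d%:R.
Variables (F : fieldExtType rat) (h : {rmorphism F -> L}).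
Implicit Types (x y : L) (d e : nat) (a b s t : R).

Notation mh := (min_height R F).

Lemma min_height_gt0 : 0 < mh.
Proof.
have := min_height_exp2 (lexx mh); rewrite lt_def min_height_ge0 andbT => le.
by apply: contraTneq le => ->; rewrite expR0 -ltNge ltr1n.
Qed.

Lemma lheight_ge x s : lheight h x s -> mh <= s. Proof. by case. Qed.

Lemma lheight_ge0 x s : lheight h x s -> 0 <= s.
Proof. by move=> /lheight_ge; apply: le_trans; apply: min_height_ge0. Qed.

Lemma lheightX x s k : lheight h x s -> lheight h (x ^+ k) (k.+1%:R * s).
Proof.
move=> hx; elim: k => [|k ih].
  by rewrite expr0 mul1r; apply: (@lheight_nat _ _ _ h 1%N); rewrite ?(lheight_ge hx).
by rewrite exprS -[k.+2]add1n natrD mulrDl mul1r; apply: lheightM.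
Qed.

Lemma lheight_prod (I : Type) (r : seq I) (x : I -> L) (s : I -> R) c :
    mh <= c -> (forall i, lheight h (x i) (s i)) ->
  lheight h (\prod_(i <- r) x i) (\sum_(i <- r) s i + c).
Proof.
move=> c0 hx; elim/big_rec2: _ => [|j t y _ ih].
  by rewrite add0r; apply: (@lheight_nat _ _ _ h 1%N).
by rewrite -addrA; apply: lheightM.
Qed.

Section Polynomials.
Variables (n : nat) (K : fieldType) (kap : {rmorphism K -> L}).
Hypothesis kap_height : forall c, exists s, lheight h (kap c) s.

Lemma lheight_mmap (p : {mpoly K[n]}) : exists2 C, 0 <= C &
  forall (x : 'I_n -> L) s, mh <= s -> (forall i, lheight h (x i) s) ->
    lheight h (mmap kap x p) (C * s).
Proof.
rewrite /mmap; elim: (msupp p) => [|m r [C C0 hC]].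
  exists 1 => // x s s0 _; rewrite big_nil mul1r.
  by apply: (@lheight_nat _ _ _ h 0%N).
have [sm hsm] := kap_height p@_m.
have sm0 := lheight_ge0 hsm.
have Cm0 : 0 <= sm / mh by rewrite divr_ge0 ?min_height_ge0.
have S0 : 0 <= \sum_(i < n) (m i).+1%:R + 1 :> R.
  by rewrite addr_ge0 // sumr_ge0.
exists (sm / mh + (\sum_(i < n) (m i).+1%:R + 1) + C) => [|x s s0 hx].
  by rewrite addr_ge0 // addr_ge0.
rewrite big_cons !mulrDl; apply: lheightD; last exact: hC.
apply: lheightM.
  apply: lheightW hsm; rewrite mulrAC ler_pdivlMr ?min_height_gt0 //.
  by rewrite ler_wpM2l.
rewrite mul1r mulr_suml; apply: lheight_prod => // i.
exact: lheightX.
Qed.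

(** The representation that defines b at x may vary with x, and a fixed N / D may be 0 / 0 there. By
    [ratfun_value_hasse] every nonzero value is a quotient of coefficients of the fixed [hasse N]
    and [hasse D]; as [hasse D] has finitely many, C is uniform in x. *)
Lemma lheight_ratfun (b : {fraction {mpoly K[n]}}) : exists2 C, 0 <= C &
  forall (x : 'I_n -> L) s y, mh <= s -> (forall i, lheight h (x i) s) ->
    ratfun_value kap b x y -> lheight h y (C * s).
Proof.
have [N [D [D0 eb]]] := fracP b.
have ex (p : {mpoly K[n]}) : exists C, 0 <= C /\ forall (x : 'I_n -> L) s, mh <= s ->
    (forall i, lheight h (x i) s) -> lheight h (mmap kap x p) (C * s).
  by have [C C0 hC] := lheight_mmap p; exists C.
have /choice[CN hN] : forall m, _ := fun m => ex (hasse N)@_m.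
have /choice[CD hD] : forall m, _ := fun m => ex (hasse D)@_m.
pose k := (\dim {:F}).+2%:R : R.
pose C m := CN m + k * CD m.
have C0 m : 0 <= C m.
  by rewrite addr_ge0 ?mulr_ge0 //; [case: (hN m) | case: (hD m)].
exists (1 + \sum_(m <- msupp (hasse D)) C m) => [|x s y s0 hx hy].
  by rewrite addr_ge0 // sumr_ge0.
have sge0 : 0 <= s by apply: le_trans s0; apply: min_height_ge0.
have [->|y0] := eqVneq y 0.
  apply: (@lheightW _ _ _ _ 0 s); last by apply: (@lheight_nat _ _ _ h 0%N).
  by rewrite mulrDl mul1r lerDl mulr_ge0 // sumr_ge0.
have [m [mD Dm ->]] := ratfun_value_hasse D0 eb hy y0.
apply: (@lheightW _ _ _ _ _ (C m * s)).
  rewrite ler_wpM2r // (bigD1_seq m) ?msupp_uniq //= addrCA lerDl.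
  by rewrite addr_ge0 // sumr_ge0.
rewrite /C mulrDl -mulrA; apply: lheightM; first by have [_] := hN m; apply.
by apply: (lheightV v_abs v_nat); have [_] := hD m; apply.
Qed.

End Polynomials.

Lemma num_reprX x d a k : num_repr h x d a ->
  num_repr h (x ^+ k) (d ^ k) ((\dim {:F})%:R * a ^+ k).
Proof.
move=> hx; elim: k => [|k ih]; first exact: (num_repr_nat R h 1).
rewrite exprS expnS exprS mulrCA; exact: num_reprM.
Qed.

Lemma num_repr_pow_le x d s p k : (k <= p)%N -> mh <= s ->
    d%:R <= expR s / 2 -> num_repr h x d (expR s / 2) ->
  num_repr h (x ^+ k) (d ^ p) (expR (p.+1%:R * s)).
Proof.
move=> kp s0 hd nx; have [d0 _] := nx.
rewrite -(subnKC kp) expnD; apply: num_reprW (num_repr_scale _ (num_reprX k nx)).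
  rewrite natrX subnKC //; have es := expR_ge0 s.
  apply: (@le_trans _ _ (expR s * (expR s / 2) ^+ (p - k) * (expR s / 2) ^+ k)).
    rewrite mulrCA mulrA ler_wpM2r ?exprn_ge0 ?mulr_ge0 ?invr_ge0 //.
    apply: ler_pM; rewrite ?ler0n ?exprn_ge0 //.
      apply: le_trans (min_height_expD s0) _.
      by rewrite ler_piMr // invf_le1 ?ler1n.
    by rewrite lerXn2r ?nnegrE ?ler0n // mulr_ge0 ?invr_ge0.
  rewrite -mulrA -exprD subnK // expRM_natl exprS ler_wpM2l //.
  rewrite lerXn2r ?nnegrE ?mulr_ge0 ?invr_ge0 //.
  by rewrite ler_piMr // invf_le1 ?ler1n.
by rewrite expn_gt0 d0.
Qed.

(** The p-th power of the product of the denominators of the x i serves all these monomials at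
    once. *)
Lemma num_repr_monomial (I : finType) (x : I -> L) (s : I -> R) p :
    (forall i, lheight h (x i) (s i)) ->
  exists d, d%:R <= expR (p.+1%:R * \sum_i s i) /\
    forall ex : I -> nat, (forall i, ex i <= p)%N ->
    num_repr h (\prod_i x i ^+ ex i) d ((\dim {:F})%:R * expR (p.+1%:R * \sum_i s i)).
Proof.
move=> hx.
have /choice[d hd] : forall i, exists d, d%:R <= expR (s i) / 2 /\
    num_repr h (x i) d (expR (s i) / 2) by move=> i; case: (hx i).
have eE : expR (p.+1%:R * \sum_i s i) = \prod_i expR (p.+1%:R * s i) :> R.
  by rewrite mulr_sumr; apply: (big_morph _ (@expRD R) (@expR0 R)).
exists (\prod_i d i ^ p)%N; split.
  rewrite eE natr_prod; apply: ler_prod => i _; rewrite ler0n /= natrX.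
  have es := expR_ge0 (s i).
  apply: (@le_trans _ _ (expR (s i) ^+ p)).
    rewrite lerXn2r ?nnegrE ?ler0n //; apply: le_trans (proj1 (hd i)) _.
    by rewrite ler_piMr // invf_le1 ?ler1n.
  by rewrite -expRM_natl ler_expR ler_wpM2r ?(lheight_ge0 (hx i)) // ler_nat.
move=> ex hex; rewrite eE.
elim/big_rec3: _ => [|i y1 d2 y3 _ ih].
  exact: (num_repr_nat R h 1).
rewrite mulrCA; apply: num_reprM => //.
by apply: num_repr_pow_le (hex i) (lheight_ge (hx i)) _ _; have [] := hd i.
Qed.

(* The common denominator of the monomials makes the exponents of the x i     *)
(* enter the bound only once.                                                 *)
Lemma lheight_box_sum (I J : finType) (x : I -> L) (s : I -> R) p
    (c : J -> L) t (ex : J -> I -> nat) :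
    (forall i, lheight h (x i) (s i)) -> (forall j, lheight h (c j) t) ->
    (forall j i, ex j i <= p)%N ->
  lheight h (\sum_j c j * \prod_i x i ^+ ex j i)
    (#|J|%:R * t + p.+1%:R * (\sum_i s i) + mh).
Proof.
move=> hx hc hex; have [d [hd nd]] := num_repr_monomial p hx.
set b := _ * expR _ in nd.
have /choice[e he] : forall j, exists e, e%:R <= expR t / 2 /\
    num_repr h (c j) e (expR t / 2) by move=> j; case: (hc j).
have et := expR_ge0 t.
have b0 : 0 <= b by rewrite mulr_ge0 ?ler0n ?expR_ge0.
have d0 : (0 < d)%N by have [] := nd (fun=> 0%N) (fun=> leq0n _).
pose Sm r := \sum_(j <- r) c j * \prod_i x i ^+ ex j i.
have [De [B [hDe hB hS]]] : exists De B, [/\ De%:R <= expR ((size (enum J))%:R * t),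
    B <= expR ((size (enum J))%:R * t) & 0 <= B /\ num_repr h (Sm (enum J)) (De * d) (B * b)].
  rewrite /Sm; elim: (enum J) => [|j r [De [B [hDe hB [B0 hS]]]]].
    exists 1%N, 0; rewrite mul0r expR0; split=> //; split=> //.
    rewrite big_nil mul0r -(mulr0 d%:R) -(mulr0 (\dim {:F})%:R).
    exact: num_repr_scale (num_repr_nat _ h 0).
  have [ej nj] := he j; have [e0 _] := nj; have [Ded0 _] := hS.
  have De0 : (0 < De)%N by move: Ded0; rewrite muln_gt0 => /andP[].
  exists (e j * De)%N, (expR t / 2 * De%:R + (e j)%:R * B).
  have ee : expR ((size (j :: r))%:R * t) = expR t * expR ((size r)%:R * t).
    by rewrite -expRD /= -[(size r).+1]add1n natrD mulrDl mul1r.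
  split.
  - rewrite ee natrM ler_pM ?ler0n //; apply: le_trans ej _.
    by rewrite ler_piMr // invf_le1 ?ler1n.
  - rewrite ee [expR t in leRHS](_ : _ = expR t / 2 + expR t / 2); last by field.
    rewrite mulrDl lerD //; apply: ler_pM; rewrite ?ler0n ?mulr_ge0 ?invr_ge0 //.
  split; first by rewrite addr_ge0 ?mulr_ge0 ?ler0n ?invr_ge0.
  rewrite big_cons mulrDl; apply: num_reprD.
    rewrite mulnAC [X in num_repr _ _ _ X](_ : _ = De%:R * (expR t / 2 * b)); last by ring.
    by apply: num_repr_scale => //; apply: num_reprM => //; apply: nd.
  rewrite -mulnA mulnC -[(e j)%:R * B * b]mulrA.
  exact: num_repr_scale.
rewrite -[\sum_j _]big_enum /= -/(Sm (enum J)) cardE.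
have [B0 nS] := hS.
have t0 : 0 <= (size (enum J))%:R * t.
  case: (enum J) => [|j l]; first by rewrite mul0r.
  by rewrite mulr_ge0 ?(lheight_ge0 (hc j)).
have s0 : 0 <= p.+1%:R * \sum_i s i.
  by rewrite mulr_ge0 // sumr_ge0 // => i _; apply: lheight_ge0 (hx i).
split; first by rewrite lerDr addr_ge0.
exists (De * d)%N; rewrite !expRD; split.
  rewrite natrM -!mulrA ler_pM ?ler0n // mulrA; apply: le_trans hd _.
  rewrite -mulrA ler_peMr ?expR_ge0 // ler_pdivlMr // mul1r.
  exact: min_height_exp2.
apply: num_reprW nS; rewrite -!mulrA ler_pM //.
by rewrite /b mulrC ler_wpM2l ?expR_ge0 // min_height_expD.
Qed.

End HeightsOfValues.

(** Gaussian elimination: subtracting multiples of the first function, nonzero at some x0, makes the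
    others vanish at x0. This is defined over K and shortens a relation over L. *)
Lemma linear_independence_base_change (K L : fieldType) (kap : {rmorphism K -> L})
    (M : Type) N (w : 'I_N -> M -> K) :
    (forall q : 'I_N -> K, (forall x, \sum_t q t * w t x = 0) -> forall t, q t = 0) ->
  forall q : 'I_N -> L, (forall x, \sum_t q t * kap (w t x) = 0) -> forall t, q t = 0.
Proof.
elim: N w => [|N ih] w free q qw t; first by case: t.
have [x0 w0] : exists x0, w ord0 x0 != 0.
  apply: contrapT => /forallNP h; have := free (fun t => (t == ord0)%:R) _ ord0.
  rewrite eqxx => /(_ _)/eqP; rewrite oner_eq0 => /(_ _)/negP[] // x.
  rewrite (bigD1 ord0) //= mul1r big1 ?addr0 => [|s /negPf ->]; last by rewrite mul0r.
  by apply/eqP/negPn/negP/h.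
pose w' t x := w (lift ord0 t) x - w (lift ord0 t) x0 / w ord0 x0 * w ord0 x.
have free' : forall q' : 'I_N -> K, (forall x, \sum_s q' s * w' s x = 0) ->
    forall s, q' s = 0.
  move=> q' hq' s.
  pose Q t := if unlift ord0 t is Some t' then q' t' else
    - \sum_s q' s * (w (lift ord0 s) x0 / w ord0 x0).
  have <- : Q (lift ord0 s) = q' s by rewrite /Q liftK.
  apply: free => x.
  rewrite big_ord_recl /Q unlift_none -[RHS](hq' x) mulNr mulr_suml addrC -sumrB.
  by apply: eq_bigr => s' _; rewrite liftK /w' mulrBr !mulrA.
have q0 s : q (lift ord0 s) = 0.
  apply: (ih w' free' (fun s => q (lift ord0 s))) => x.
  have kw0 : kap (w ord0 x0) != 0 by rewrite fmorph_eq0.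
  have e0 := qw x0; have e := qw x; rewrite big_ord_recl in e0; rewrite big_ord_recl in e.
  have {e0}e0 : q ord0 = - \sum_s q (lift ord0 s) * kap (w (lift ord0 s) x0 / w ord0 x0).
    apply: (mulIf kw0); move/eqP: e0; rewrite addr_eq0 => /eqP ->.
    rewrite mulNr mulr_suml; congr (- _); apply: eq_bigr => s' _.
    by rewrite -mulrA -rmorphM /= divfK.
  rewrite -[RHS]e e0 mulNr mulr_suml addrC -sumrB; apply: eq_bigr => s' _.
  by rewrite /w' rmorphB !rmorphM /= mulrBr !mulrA.
case: (unliftP ord0 t) => [s ->//|->].
have := qw x0; rewrite big_ord_recl big1 ?addr0 => [|s _]; last by rewrite q0 mul0r.
by move=> /eqP; rewrite mulf_eq0 fmorph_eq0 (negPf w0) orbF => /eqP.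
Qed.

Lemma linear_independence_base_change_fin (K L : fieldType) (kap : {rmorphism K -> L})
    (M : Type) (T : finType) (w : T -> M -> K) :
    (forall q : T -> K, (forall x, \sum_t q t * w t x = 0) -> forall t, q t = 0) ->
  forall q : T -> L, (forall x, \sum_t q t * kap (w t x) = 0) -> forall t, q t = 0.
Proof.
move=> free q qw t.
have reind (S : fieldType) (g : T -> S) :
    \sum_t g t = \sum_(i < #|T|) g (enum_val i).
  by rewrite (reindex _ (onW_bij _ (@enum_val_bij T))).
have := @linear_independence_base_change K L kap M #|T| (fun i => w (enum_val i)) _
  (fun i => q (enum_val i)) _ (enum_rank t).
rewrite enum_rankK; apply => [q' hq' i|x]; last by rewrite -(reind _ (fun t => q t * kap (w t x))).
have := free (fun t => q' (enum_rank t)) _ (enum_val i); rewrite enum_valK; apply => x.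
rewrite reind -[RHS](hq' x); apply: eq_bigr => j _.
by rewrite enum_valK.
Qed.

Section MapSeries.
Variables (n : nat) (R S : idomainType) (h : {rmorphism R -> S}).

Notation mapk := (@map_ps n R S h).

Lemma map_ps_zmod : zmod_morphism mapk.
Proof. by move=> f g; apply: powserP => m; rewrite /= /pcoef /= -rmorphB. Qed.

Lemma map_ps_monoid : monoid_morphism mapk.
Proof.
split=> [|f g]; apply: powserP => m.
  by rewrite /map_ps /= /pcoef /= rmorph_nat.
rewrite /map_ps /= /pcoef /= rmorph_sum; apply: eq_bigr => k _.
by rewrite -rmorphM.
Qed.

HB.instance Definition _ := GRing.isZmodMorphism.Build
  (powser n R) (powser n S) mapk map_ps_zmod.
HB.instance Definition _ := GRing.isMonoidMorphism.Build
  (powser n R) (powser n S) mapk map_ps_monoid.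

Lemma pcoef_map_ps f m : pcoef (mapk f) m = h (pcoef f m).
Proof. by []. Qed.

Lemma map_ps_poly p : mapk (poly_ps p) = poly_ps (map_mpoly h p).
Proof. by apply: powserP => m; rewrite pcoef_map_ps !pcoef_poly mcoeff_map_mpoly. Qed.

Lemma map_ps_cst c : mapk (ps_cst n c) = ps_cst n (h c).
Proof. by rewrite /ps_cst map_ps_poly map_mpolyC. Qed.

End MapSeries.

Section CoefficientExtension.
Variables (n : nat) (K L : fieldType) (kap : {rmorphism K -> L}).

Notation mapk := (@map_ps n K L kap).

Lemma map_ps_inj : injective mapk.
Proof.
move=> f g e; apply: powserP => m; apply: (fmorph_inj kap).
by rewrite -!pcoef_map_ps e.
Qed.

Lemma map_ps_subst (Omega : 'M[nat]_n) f : mapk (subst_ps Omega f) = subst_ps Omega (mapk f).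
Proof.
by apply: powserP => m; rewrite /subst_ps /map_ps /pcoef /= rmorph_sum.
Qed.

Lemma mmap_poly_psE (F : fieldType) N (f : 'I_N -> powser n F)
    (q : {mpoly {mpoly F[n]}[N]}) d : (msize q <= d)%N ->
    (forall m, (msize q@_m <= d)%N) ->
  mmap (@poly_ps n F) f q = \sum_(j : 'X_{1..N < d} * 'X_{1..n < d})
    ps_cst n (q@_j.1)@_j.2 * (poly_ps 'X_[j.2] * mmap1 f j.1).
Proof.
move=> hq hm; rewrite (mmapE _ hq) -(pair_bigA _ (fun a b =>
  ps_cst n (q@_(val a))@_(val b) * (poly_ps 'X_[val b] * mmap1 f (val a)))) /=.
apply: eq_bigr => a _; rewrite {1}(mpolywE (hm a)) raddf_sum mulr_suml /=.
by apply: eq_bigr => b _; rewrite -mul_mpolyC rmorphM mulrA.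
Qed.

(** Once degrees are bounded, the claim is the linear independence of the finitely many series z^b
    f^a, seen as families of coefficients in K, and this persists over L. *)
Lemma alg_independent_base_change N (f : 'I_N -> powser n K) :
    alg_independent (@ratfun_ps n K) (fun i => (f i)%:F) ->
  forall q : {mpoly {mpoly L[n]}[N]},
    mmap (@poly_ps n L) (fun i => mapk (f i)) q = 0 -> q = 0.
Proof.
move=> ind q q0.
have indK (Q : {mpoly {mpoly K[n]}[N]}) : mmap (@poly_ps n K) f Q = 0 -> Q = 0.
  move=> Q0; have : map_mpoly (@FracField.tofrac {mpoly K[n]}) Q = 0.
    apply: ind; have := congr1 (fun x => x%:F) Q0; rewrite tofrac0 => e0; rewrite -[RHS]e0.
    rewrite [RHS](rmorph_mmap (@FracField.tofrac (powser n K))).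
    rewrite /map_mpoly rmorph_mmap; apply: eq_mmap => [c|i] /=.
      by rewrite mmapC /= /ratfun_ps map_frac_tofrac //; apply: poly_ps_inj.
    by rewrite mmapX mmap1U.
  move=> /mpolyP e; apply/mpolyP => m; have := e m.
  rewrite mcoeff_map_mpoly !mcoeff0 => /eqP; rewrite tofrac_eq0 => /eqP //.
pose d := maxn (msize q) (\max_(m <- msupp q) msize q@_m).
have hd : (msize q <= d)%N by apply: leq_maxl.
have hm m : (msize q@_m <= d)%N.
  have [ms|ms] := boolP (m \in msupp q); last by rewrite memN_msupp_eq0 // msize0.
  by rewrite leq_max; apply/orP; right; rewrite (big_rem m ms) /= leq_max leqnn.
pose J := ('X_{1..N < d} * 'X_{1..n < d})%type.
pose w (j : J) := poly_ps 'X_[j.2] * mmap1 f j.1 : powser n K.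
have free : forall c : J -> K, (forall x, \sum_j c j * pcoef (w j) x = 0) ->
    forall j, c j = 0.
  move=> c hc j.
  pose Q : {mpoly {mpoly K[n]}[N]} :=
    \sum_(j : J) ((c j)%:MP * 'X_[val j.2]) *: 'X_[val j.1].
  have Q0 : Q = 0.
    apply: indK; rewrite rmorph_sum /= -[RHS](_ : \sum_j ps_cst n (c j) * w j = 0).
      apply: eq_bigr => i _; rewrite mmapZ mmapX /w mulrA; congr (_ * _).
      by rewrite rmorphM.
    apply: powserP => x; rewrite pcoef_sum pcoef0 -[RHS](hc x).
    by apply: eq_bigr => i _; rewrite pcoef_cstM.
  have := congr1 (fun Q => Q@_(val j.1)@_(val j.2)) Q0.
  rewrite !mcoeff0 !raddf_sum (bigD1 j) //= big1 ?addr0.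
    rewrite mcoeffZ mcoeffX eqxx mulr1 mcoeffCM mcoeffX eqxx mulr1 //.
  move=> i ij; rewrite mcoeffZ mcoeffX; case: eqP => [e1|_]; last by rewrite mulr0 mcoeff0.
  rewrite mulr1 mcoeffCM mcoeffX; case: eqP => [e2|_]; last by rewrite mulr0.
  by case/eqP: ij; case: i j e1 e2 => [i1 i2] [j1 j2] /= /val_inj -> /val_inj ->.
have cL := linear_independence_base_change_fin (kap := kap) free.
apply/mpolyP => a; rewrite mcoeff0; apply/mpolyP => b; rewrite mcoeff0.
have [la|ga] := ltnP (mdeg a) d; last first.
  by rewrite [q@_a]memN_msupp_eq0 ?mcoeff0 // msize_mdeg_ge // (leq_trans hd).
have [lb|gb] := ltnP (mdeg b) d; last first.
  by rewrite memN_msupp_eq0 // msize_mdeg_ge // (leq_trans (hm a)).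
apply: (cL (fun j => (q@_(val j.1))@_(val j.2)) _ (BMultinom la, BMultinom lb)) => x.
have := congr1 (fun Q => pcoef Q x) q0; rewrite (mmap_poly_psE _ hd hm) pcoef0 pcoef_sum => e.
rewrite -[RHS]e; apply: eq_bigr => j _; rewrite pcoef_cstM -pcoef_map_ps; congr (_ * pcoef _ x).
rewrite /w rmorphM /= map_ps_poly map_mpolyX; congr (_ * _).
by rewrite /mmap1 rmorph_prod; apply: eq_bigr => i _; rewrite rmorphXn.
Qed.

End CoefficientExtension.

(** A row c with c A = 0 would give sum c_i f_i = sum c_i b_i, an algebraic relation over K(z). *)
Lemma mahler_matrix_invertible n l m (K : fieldType)
    (Omega : 'M[nat]_n) (f : 'I_l -> powser n K) (g : 'I_m -> powser n K)
    (A : 'M[K]_l) (b : 'I_l -> {fraction {mpoly K[n]}}) :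
    \col_i (f i)%:F = map_mx (fun a : K => ratfun_ps (a%:MP_[n])%:F) A
      *m (\col_i (subst_ps Omega (f i))%:F) + \col_i ratfun_ps (b i) ->
    alg_independent (@ratfun_ps n K)
      (join_fam (fun i => (f i)%:F) (fun h => (g h)%:F)) ->
  \det A != 0.
Proof.
move=> eqf ind; apply/negP => /det0P[c c0 cA].
pose cf (a : K) : {fraction {mpoly K[n]}} := (a%:MP_[n])%:F.
pose P : {mpoly {fraction {mpoly K[n]}}[l + m]} :=
  \sum_(i < l) cf (c 0 i) *: 'X_(lshift m i) - (\sum_i cf (c 0 i) * b i)%:MP.
have P0 : P = 0.
  apply: ind; rewrite rmorphB /= mmapC !rmorph_sum /=.
  rewrite (rmorph_sum (@ratfun_ps n K)) -sumrB; under eq_bigr => i _ do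
    rewrite mmapZ mmapX mmap1U /join_fam (unsplitK (inl i)) rmorphM -mulrBr.
  have fE i : (f i)%:F - ratfun_ps (b i) =
      \sum_j ratfun_ps (cf (A i j)) * (subst_ps Omega (f j))%:F.
    have := congr1 (fun B : 'cV_l => B i 0) eqf; rewrite !mxE => ->.
    by rewrite addrK; apply: eq_bigr => j _; rewrite !mxE.
  under eq_bigr => i _ do rewrite fE mulr_sumr.
  rewrite exchange_big big1 //= => j _.
  under eq_bigr => i _ do rewrite mulrA -rmorphM /= /cf -tofracM -mpolyCM.
  rewrite -mulr_suml -!raddf_sum /=.
  have := congr1 (fun B : 'rV_l => B 0 j) cA; rewrite !mxE => ->.
  by rewrite !raddf0 mul0r.
case/eqP: c0; apply/rowP => i; rewrite mxE.
have := congr1 (fun P => P@_(U_(lshift m i))%MM) P0.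
rewrite mcoeff0 mcoeffB mcoeffC raddf_sum (bigD1 i) //= big1 ?addr0.
  rewrite mcoeffZ mcoeffX eqxx mulr1 -mdeg_eq0 mdeg1 mulr0 subr0 => /eqP.
  by rewrite tofrac_eq0 mpolyC_eq0 => /eqP.
move=> j ji; rewrite mcoeffZ mcoeffX; case: eqP => [/mnmP/(_ (lshift m i))|_].
  by rewrite !mnm1E eqxx eq_lshift (negPf ji).
by rewrite mulr0.
Qed.

(** * The auxiliary function *)

Section SeriesCoefficientClasses.
Variables (n N : nat) (L : fieldType).
Notation T := {mpoly L[N]}.

Definition deg_le d (p : T) := forall m, (d < mdeg m)%N -> p@_m = 0.

Lemma deg_leW d e p : (d <= e)%N -> deg_le d p -> deg_le e p.
Proof. by move=> de h m lt; apply: h; apply: leq_ltn_trans lt. Qed.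

Lemma deg_leD d p q : deg_le d p -> deg_le d q -> deg_le d (p + q).
Proof. by move=> hp hq m lt; rewrite mcoeffD hp ?hq ?addr0. Qed.

Lemma deg_le0 d : deg_le d 0.
Proof. by move=> m _; rewrite mcoeff0. Qed.

Lemma deg_leM d e p q : deg_le d p -> deg_le e q -> deg_le (d + e) (p * q).
Proof.
move=> hp hq m lt; rewrite mcoeffM big1 // => -[a b] /= /eqP ab.
have [la|ga] := ltnP d (mdeg a); first by rewrite hp // mul0r.
rewrite [q@_b]hq ?mulr0 // ltnNge; apply/negP => gb.
by move: lt; rewrite ab mdegD ltnNge leq_add.
Qed.

Lemma deg_leX m : deg_le (mdeg m) 'X_[m].
Proof. by move=> k lt; rewrite mcoeffX; case: eqP lt => // ->; rewrite ltnn. Qed.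

Lemma deg_leC c : deg_le 0 c%:MP.
Proof. by move=> m lt; rewrite mcoeffC -mdeg_eq0 eqn0Ngt lt mulr0. Qed.

Definition ps_deg_le d (f : powser n T) := forall m, deg_le d (pcoef f m).

Lemma ps_deg_leD d f g : ps_deg_le d f -> ps_deg_le d g -> ps_deg_le d (f + g).
Proof. by move=> hf hg m; rewrite pcoefD; apply: deg_leD. Qed.

Lemma ps_deg_leM d e f g : ps_deg_le d f -> ps_deg_le e g -> ps_deg_le (d + e) (f * g).
Proof.
move=> hf hg m; rewrite (pcoefM_box _ _ (ltnSn (mdeg m))).
by elim/big_ind: _ => [|x y|k _]; [exact: deg_le0|exact: deg_leD|exact: deg_leM].
Qed.

Lemma ps_deg_leX d f k : ps_deg_le d f -> ps_deg_le (k * d) (f ^+ k).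
Proof.
move=> hf; elim: k => [|k ih]; last by rewrite exprS mulSn; apply: ps_deg_leM.
by move=> m; rewrite pcoef1 -(rmorph_nat (@mpolyC N L)); apply: deg_leW (deg_leC _).
Qed.

Lemma ps_deg_le_sum d (I : Type) (r : seq I) (P : pred I) (f : I -> powser n T) :
  (forall i, P i -> ps_deg_le d (f i)) -> ps_deg_le d (\sum_(i <- r | P i) f i).
Proof.
move=> h; elim/big_ind: _ => // [m|f1 f2]; last exact: ps_deg_leD.
by rewrite pcoef0; apply: deg_le0.
Qed.

Lemma ps_deg_le_poly d p : (forall m, deg_le d p@_m) -> ps_deg_le d (poly_ps p).
Proof. by []. Qed.

Variable P : (nat -> L) -> Prop.
Hypothesis P0 : P (fun=> 0).
Hypothesis Psign : forall i : nat, P (fun=> (-1) ^+ i).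
Hypothesis PD : forall c d, P c -> P d -> P (fun k => c k + d k).
Hypothesis PM : forall c d, P c -> P d -> P (fun k => c k * d k).

Definition ps_class (f : nat -> powser n T) :=
  forall m tau, P (fun k => (pcoef (f k) m)@_tau).

Lemma ps_classD f g : ps_class f -> ps_class g -> ps_class (fun k => f k + g k).
Proof.
move=> hf hg m tau; under eq_fun => k do rewrite pcoefD mcoeffD.
exact: PD.
Qed.

Lemma ps_classM f g : ps_class f -> ps_class g -> ps_class (fun k => f k * g k).
Proof.
move=> hf hg m tau.
under eq_fun => k do rewrite (pcoefM_box _ _ (ltnSn (mdeg m))) raddf_sum.
apply: (seq_class_sum P0 PD) => a _; under eq_fun => k do rewrite /= mcoeffM.
by apply: (seq_class_sum P0 PD) => b _; apply: PM.
Qed.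

Lemma ps_class_cst (p : nat -> T) : (forall tau, P (fun k => (p k)@_tau)) ->
  ps_class (fun k => ps_cst n (p k)).
Proof.
move=> hp m tau; under eq_fun => k do rewrite pcoef_poly mcoeffC.
case: eqP => _; first by under eq_fun => k do rewrite mulr1.
by under eq_fun => k do rewrite mulr0 mcoeff0.
Qed.

Let P1 : P (fun=> 1). Proof. exact: (Psign 0). Qed.

Lemma class_nat (b : bool) : P (fun=> b%:R).
Proof. by case: b. Qed.

Lemma ps_class1 : ps_class (fun=> 1).
Proof.
move=> m tau; under eq_fun => k do rewrite pcoef1.
case: (m == 0%MM); last by under eq_fun => k do rewrite mcoeff0.
by under eq_fun => k do rewrite mcoeff1; apply: class_nat.
Qed.

Lemma ps_classX f j : ps_class f -> ps_class (fun k => f k ^+ j).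
Proof.
move=> hf; elim: j => [|j ih]; first exact: ps_class1.
by under eq_fun => k do rewrite exprS; apply: ps_classM.
Qed.

Lemma ps_class_sum (I : Type) (r : seq I) (Q : pred I) (f : I -> nat -> powser n T) :
  (forall i, Q i -> ps_class (f i)) -> ps_class (fun k => \sum_(i <- r | Q i) f i k).
Proof.
move=> hf; elim: r => [|i r ih].
  under eq_fun => k do rewrite big_nil; move=> m tau.
  by under eq_fun => k do rewrite pcoef0 mcoeff0.
under eq_fun => k do rewrite big_cons.
by case: (boolP (Q i)) => // Qi; apply: ps_classD => //; apply: hf.
Qed.

Lemma ps_class_prod (I : Type) (r : seq I) (Q : pred I) (f : I -> nat -> powser n T) :
  (forall i, Q i -> ps_class (f i)) -> ps_class (fun k => \prod_(i <- r | Q i) f i k).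
Proof.
move=> hf; elim: r => [|i r ih].
  by under eq_fun => k do rewrite big_nil; apply: ps_class1.
under eq_fun => k do rewrite big_cons.
by case: (boolP (Q i)) => // Qi; apply: ps_classM => //; apply: hf.
Qed.

Definition ffun_mnm N' p (e : {ffun 'I_N' -> 'I_p}) : 'X_{1..N'} :=
  [multinom (e i : nat) | i < N'].

Lemma ffun_mnm_inj N' p : injective (@ffun_mnm N' p).
Proof.
move=> e e' /mnmP h; apply/ffunP => i; apply: val_inj.
by have := h i; rewrite !mnmE.
Qed.

Notation box p := ({ffun 'I_n -> 'I_p} * {ffun 'I_N -> 'I_p})%type.

Definition box_monomial p (a : box p) : powser n T :=
  poly_ps ('X_[ffun_mnm a.2] *: 'X_[ffun_mnm a.1]).

Definition box_series p (c : box p -> L) : powser n T :=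
  \sum_a ps_cst n (c a)%:MP * box_monomial a.

Lemma card_bmultinom_le r d : (#|{: 'X_{1..r < d}}| <= d ^ r)%N.
Proof.
case: d => [|d].
  by rewrite eq_card0 // => -[k lk].
pose e (k : 'X_{1..r < d.+1}) : {ffun 'I_r -> 'I_d.+1} := [ffun j => inord (k j)].
have e_inj : injective e.
  move=> k k' /ffunP h; apply/val_inj/mnmP => j; have := h j.
  have kd (i : 'X_{1..r < d.+1}) : (i j < d.+1)%N.
    by apply: leq_ltn_trans (bmdeg i); rewrite mdegE (bigD1 j) //= leq_addr.
  by rewrite !ffunE => /(congr1 val) /=; rewrite !inordK.
by have := leq_card e e_inj; rewrite card_ffun !card_ord.
Qed.

(** By induction on the degree, the coefficient of F E at m reduces to the constant term of F times
    that of E at m. *)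
Lemma ps_divr_order I (F E : powser n T) : pcoef F 0%MM != 0 ->
    (forall m, (mdeg m < I)%N -> pcoef (F * E) m = 0) ->
  forall m, (mdeg m < I)%N -> pcoef E m = 0.
Proof.
move=> F0 h m; move: {2}(mdeg m) (leqnn (mdeg m)) => d.
elim: d m => [|d ih] m md mI.
  move: md; rewrite leqn0 mdeg_eq0 => /eqP m0; have := h m mI.
  by rewrite m0 pcoefM0 => /eqP; rewrite mulf_eq0 (negPf F0) => /eqP.
have lm := ltnSn (mdeg m).
have l0 : (mdeg (0%MM : 'X_{1..n}) < (mdeg m).+1)%N by rewrite mdeg0.
have := h m mI; rewrite (pcoefM_box _ _ lm).
rewrite (bigD1 (BMultinom l0, BMultinom lm)) /= ?add0m ?eqxx // big1 ?addr0.
  by move/eqP; rewrite mulf_eq0 (negPf F0) => /eqP.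
move=> [[a la] [b lb]] /= /andP[/eqP mab ne]; rewrite [pcoef E b]ih ?mulr0 //.
  rewrite -ltnS; apply: leq_trans md; rewrite mab mdegD -add1n leq_add2r.
  rewrite lt0n mdeg_eq0; apply: contraNneq ne => a0; have mb : m = b by rewrite mab a0 add0m.
  by apply/eqP; congr (_, _); apply: val_inj.
by apply: leq_ltn_trans mI; rewrite mab mdegD leq_addl.
Qed.

(* The dimension count: p^(1+n+N) unknowns against (ps)^n (C p)^N equations,  *)
(* where p > C^N s^n.                                                         *)
Theorem auxiliary_series s delta (F : nat -> powser n T) : (0 < s)%N ->
    ps_class F -> (forall k, ps_deg_le delta (F k)) ->
    (forall k, pcoef (F k) 0%MM != 0) ->
  exists p (x : 'I_p -> box p -> nat -> L) (s0 : 'I_p), [/\ forall j a, P (x j a),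
    exists a, ~ ev_zero (x s0 a) &
    exists N0, forall k, (N0 <= k)%N -> forall m, (mdeg m < p * s)%N ->
      pcoef (\sum_(j < p | (s0 <= j)%N) box_series (fun a => x j a k) * F k ^+ (j - s0)) m = 0].
Proof.
move=> s_gt0 cF dF F0.
pose C := (N + delta).+1; pose p := (C ^ N * s ^ n).+1.
(* A box monomial has degree at most N p in t and a power of F at most delta p, so q exceeds the
   degrees in t of the coefficients to be annihilated. *)
pose q := ((N + delta) * p).+1; pose Eq := ('X_{1..n < (p * s)} * 'X_{1..N < q})%type.
pose J := ('I_p * box p)%type.
have card_lt : (#|{: Eq}| < #|{: J}|)%N.
  rewrite !card_prod !card_ffun !card_ord.
  apply: leq_ltn_trans (leq_mul (card_bmultinom_le _ _) (card_bmultinom_le _ _)) _.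
  have qC : (q <= C * p)%N by rewrite /q /C mulSn -add1n leq_add2r.
  apply: (@leq_ltn_trans ((p * s) ^ n * (C * p) ^ N)).
    rewrite leq_mul2l; apply/orP; right; case: (N) => // N'.
    by rewrite leq_exp2r.
  have -> : ((p * s) ^ n * (C * p) ^ N = (C ^ N * s ^ n) * (p ^ n * p ^ N))%N.
    rewrite !expnMn; move: (p ^ n)%N (s ^ n)%N (C ^ N)%N (p ^ N)%N => a b c d.
    by rewrite mulnACA [(a * c)%N]mulnC mulnACA.
  by rewrite ltn_pmul2r // muln_gt0 !expn_gt0.
pose G (c : J) k := box_monomial c.2 * F k ^+ c.1.
have dG c k : ps_deg_le ((N + delta) * p) (G c k).
  rewrite mulnDl; apply: ps_deg_leM.
    apply: ps_deg_le_poly => m; rewrite mcoeffZ mcoeffX.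
    have d1 : (mdeg (ffun_mnm c.2.2) <= N * p)%N.
      rewrite mdegE; apply: (@leq_trans (\sum_(i < N) p)).
        by apply: leq_sum => i _; rewrite mnmE ltnW.
      by rewrite sum_nat_const card_ord.
    case: eqP => _; last by rewrite mulr0; apply: deg_le0.
    by rewrite mulr1; apply: deg_leW (@deg_leX _).
  have := @ps_deg_leX delta (F k) c.1 (dF k); rewrite mulnC => h m; apply: deg_leW (h m).
  by rewrite leq_mul2l ltnW ?orbT.
have cG c : ps_class (G c).
  apply: ps_classM; last exact: ps_classX.
  move=> m tau; under eq_fun => k do rewrite pcoef_poly mcoeffZ mcoeffX.
  case: (_ == _); last by under eq_fun => k do rewrite mulr0 mcoeff0.
  by under eq_fun => k do rewrite mulr1 mcoeffX; apply: class_nat.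
pose ei (i : 'I_#|{: Eq}|) : Eq := enum_val i.
pose ej (j : 'I_#|{: J}|) : J := enum_val j.
pose M k : 'M[L]_(#|{: Eq}|, #|{: J}|) :=
  \matrix_(i, j) (pcoef (G (ej j) k) (ei i).1)@_((ei i).2).
have cM i j : P (fun k => M k i j) by under eq_fun => k do rewrite mxE; apply: cG.
have [y cy [ysol [j1 yj1]]] := ev_kernel P0 Psign PD PM card_lt cM.
pose x (j : 'I_p) (a : box p) := y (enum_rank (j, a)).
have [N1 hN1] : exists N1, forall k, (N1 <= k)%N -> forall i, \sum_j M k i j * y j k = 0.
  have /choice[b hb] := ysol; exists (\max_i b i)%N => k hk i.
  by apply: hb; apply: leq_trans hk; apply: leq_bigmax.
(* s0 is the least j whose coefficients are not all eventually zero. For large k the combination is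
   divisible by F^s0, and the division keeps the order. *)
pose bad (j : 'I_p) := `[< exists a, ~ ev_zero (x j a) >].
have bad1 : bad (ej j1).1.
  by apply/asboolP; exists (ej j1).2; rewrite /x -surjective_pairing enum_valK.
case: (@arg_minnP _ (ej j1).1 bad (fun j => j) bad1) => s0 /asboolP bads0 mins0.
exists p, x, s0; split=> //; first by move=> j a; apply: cy.
have [N2 hN2] : exists N2, forall k, (N2 <= k)%N -> forall (j : 'I_p) a,
    (j < s0)%N -> x j a k = 0.
  have h (c : J) : exists b, forall k, (b <= k)%N -> (c.1 < s0)%N -> x c.1 c.2 k = 0.
    have [lt|ge] := ltnP c.1 s0; last by exists 0%N.
    have [b hb] : ev_zero (x c.1 c.2).
      apply: contrapT => nz; have := mins0 c.1; rewrite leqNgt lt => /(_ _)/negP[] //.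
      by apply/asboolP; exists c.2.
    by exists b => k /hb.
  have /choice[b hb] := h; exists (\max_c b c)%N => k hk j a lt.
  by apply: (hb (j, a)) => //; apply: leq_trans hk; apply: leq_bigmax.
exists (maxn N1 N2) => k; rewrite geq_max => /andP[k1 k2].
apply: (ps_divr_order (F := F k ^+ s0)).
  rewrite -[pcoef _ _]/(pcoef (F k ^+ s0) 0%MM).
  elim: (s0 : nat) => [|i ih]; first by rewrite expr0 pcoef1 eqxx oner_eq0.
  by rewrite exprS pcoefM0 mulf_neq0.
move=> m mI.
have -> : F k ^+ s0 * (\sum_(j < p | (s0 <= j)%N) box_series (fun a => x j a k) * F k ^+ (j - s0))
    = \sum_(c : J) ps_cst n (x c.1 c.2 k)%:MP * G c k.
  rewrite -(pair_bigA _ (fun j a => ps_cst n (x j a k)%:MP * G (j, a) k)) /=.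
  rewrite mulr_sumr big_mkcond /=; apply: eq_bigr => j _; case: (leqP s0 j) => [le|lt].
    rewrite mulrCA -exprD subnKC // /box_series mulr_suml.
    by apply: eq_bigr => a _; rewrite mulrA.
  by rewrite big1 // => a _; rewrite hN2 // !rmorph0 mul0r.
apply/mpolyP => tau; rewrite mcoeff0 pcoef_sum raddf_sum /=.
have [lt|ge] := ltnP (mdeg tau) q; last first.
  by rewrite big1 // => c _; rewrite pcoef_cstM mcoeffCM dG ?mulr0.
have := hN1 k k1 (enum_rank (BMultinom mI, BMultinom lt)) => e; rewrite -[RHS]e.
rewrite (reindex _ (onW_bij _ (@enum_val_bij J))) /=; apply: eq_bigr => j _.
by rewrite pcoef_cstM mcoeffCM mxE /ei enum_rankK mulrC /x -surjective_pairing enum_valK.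
Qed.

End SeriesCoefficientClasses.

Section RelationSeries.
Variables (n l m : nat) (L : fieldType).
Variables (f : 'I_l -> powser n L) (g : 'I_m -> powser n L).
Notation N := (l + m)%N.
Notation T := {mpoly L[N]}.

Definition lift_ps : powser n L -> powser n T := @map_ps n L T (@mpolyC N L).

Definition iter_var (A : 'M[L]_l) (i : 'I_N) : powser n T :=
  match split i with
  | inl i' => \sum_j ps_cst n (A i' j)%:MP * lift_ps (f j) + ps_cst n 'X_i
  | inr h => ps_cst n 'X_i * lift_ps (g h)
  end.

(* P(A f + u, w g), the variables of T standing for the components of u, w.   *)
Definition relation_series (P : T) (A : 'M[L]_l) : powser n T :=
  mmap (@ps_cst n T \o @mpolyC N L) (iter_var A) P.

Definition iter_val (t : 'I_N -> L) (A : 'M[L]_l) (i : 'I_N) : powser n L :=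
  match split i with
  | inl i' => \sum_j ps_cst n (A i' j) * f j + ps_cst n (t i)
  | inr h => ps_cst n (t i) * g h
  end.

Definition specialize (t : 'I_N -> L) : powser n T -> powser n L :=
  @map_ps n T L (mmap idfun t).

Lemma specialize_lift t (q : powser n L) : specialize t (lift_ps q) = q.
Proof. by apply: powserP => k; rewrite /specialize /lift_ps !pcoef_map_ps /= mmapC. Qed.

Lemma specialize_iter t A i : specialize t (iter_var A i) = iter_val t A i.
Proof.
rewrite /iter_var /iter_val; case: split => [i'|h].
  rewrite /specialize rmorphD rmorph_sum /= map_ps_cst /= mmapX mmap1U; congr (_ + _).
  apply: eq_bigr => j _; rewrite rmorphM /= map_ps_cst /= mmapC; congr (_ * _).
  exact: specialize_lift.
rewrite /specialize rmorphM /= map_ps_cst /= mmapX mmap1U; congr (_ * _).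
exact: specialize_lift.
Qed.

Lemma specialize_relation t P A :
  specialize t (relation_series P A) = mmap (@ps_cst n L) (iter_val t A) P.
Proof.
rewrite /specialize /relation_series rmorph_mmap; apply: eq_mmap => [c|i] /=.
  by rewrite map_ps_cst /= mmapC.
exact: specialize_iter.
Qed.

Lemma ps_deg_le_cst d (c : T) : deg_le d c -> ps_deg_le (n := n) d (ps_cst n c).
Proof.
move=> dc k; rewrite pcoef_poly mcoeffC; case: eqP => _; first by rewrite mulr1.
by rewrite mulr0; apply: deg_le0.
Qed.

Lemma ps_deg_le_lift q : ps_deg_le 0 (lift_ps q).
Proof. by move=> k; rewrite /lift_ps pcoef_map_ps; apply: deg_leC. Qed.

Lemma deg_le_var i : deg_le 1 ('X_i : T).
Proof. by have := @deg_leX N L U_(i); rewrite mdeg1. Qed.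

Lemma iter_var_deg A i : ps_deg_le 1 (iter_var A i).
Proof.
rewrite /iter_var; case: split => [i'|h].
  apply: ps_deg_leD; last by apply: ps_deg_le_cst; apply: deg_le_var.
  apply: ps_deg_le_sum => j _ k; apply: deg_leW (leq0n 1) _.
  by apply: (ps_deg_leM (d := 0) (e := 0)); [apply: ps_deg_le_cst; apply: deg_leC|apply: ps_deg_le_lift].
rewrite -[1%N]addn0; apply: ps_deg_leM; last exact: ps_deg_le_lift.
by apply: ps_deg_le_cst; apply: deg_le_var.
Qed.

Lemma relation_series_deg P A : ps_deg_le (msize P) (relation_series P A).
Proof.
rewrite /relation_series /mmap big_seq; apply: ps_deg_le_sum => k kP.
rewrite -[msize P]add0n; apply: ps_deg_leM.
  by apply: ps_deg_le_cst; apply: deg_leC.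
have le := ltnW (msize_mdeg_lt kP).
suff h : ps_deg_le (mdeg k) (mmap1 (iter_var A) k) by move=> j; apply: deg_leW (h j).
rewrite mdegE /mmap1; elim/big_rec2: _ => [|i y d _ ih].
  by move=> j; rewrite pcoef1 -(rmorph_nat (@mpolyC N L)); apply: deg_leC.
apply: ps_deg_leM => //; rewrite -[X in ps_deg_le X]muln1; apply: ps_deg_leX.
exact: iter_var_deg.
Qed.

Definition const_coef : powser n T -> T := fun q => pcoef q 0%MM.

Lemma const_coef_zmod : zmod_morphism const_coef.
Proof. by move=> q r; rewrite /const_coef pcoefD pcoefN. Qed.
Lemma const_coef_monoid : monoid_morphism const_coef.
Proof. by rewrite /const_coef; split=> [|q r]; rewrite ?pcoef1 ?eqxx ?pcoefM0. Qed.
HB.instance Definition _ :=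
  GRing.isZmodMorphism.Build (powser n T) T const_coef const_coef_zmod.
HB.instance Definition _ :=
  GRing.isMonoidMorphism.Build (powser n T) T const_coef const_coef_monoid.

(** At z = 0 the series is P after the affine change of variables u -> A f(0) + u, w -> g(0) w,
    whose inverse is [inv]. *)
Lemma relation_series_neq0 P A : P != 0 -> (forall h, pcoef (g h) 0%MM != 0) ->
  pcoef (relation_series P A) 0%MM != 0.
Proof.
move=> P0 g0; apply: contra_neq P0 => e.
pose a i' := \sum_j A i' j * pcoef (f j) 0%MM.
pose inv (i : 'I_N) : T := match split i with
  | inl i' => 'X_i - (a i')%:MP
  | inr h => (pcoef (g h) 0%MM)^-1%:MP * 'X_i end.
have := congr1 (mmap (@mpolyC N L) inv) e; rewrite rmorph0.
rewrite -[pcoef _ _]/(const_coef _) /relation_series !rmorph_mmap => <-.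
rewrite -{1}[P]mmap_id; apply: eq_mmap => [c|i] /=.
  by rewrite /const_coef pcoef_poly mcoeffC eqxx mulr1 mmapC.
rewrite /iter_var /const_coef; case es: (split i) => [i'|h] /=.
  rewrite pcoefD pcoef_sum pcoef_poly mcoeffC eqxx mulr1 rmorphD /= mmapX mmap1U.
  rewrite {2}/inv es rmorph_sum /= [X in _ = X + _](_ : _ = (a i')%:MP).
    by rewrite addrC subrK.
  rewrite /a rmorph_sum /=; apply: eq_bigr => j _.
  rewrite pcoefM0 pcoef_poly mcoeffC eqxx mulr1 rmorphM /= mmapC.
  by rewrite /lift_ps pcoef_map_ps mmapC -rmorphM.
rewrite pcoefM0 pcoef_poly mcoeffC eqxx mulr1 rmorphM /= mmapX mmap1U.
rewrite /lift_ps pcoef_map_ps mmapC /inv es mulrAC -rmorphM /= mulVf //.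
by rewrite mpolyC1 mul1r.
Qed.

Section Classes.
Variable Q : (nat -> L) -> Prop.
Hypothesis Q0 : Q (fun=> 0).
Hypothesis Qsign : forall i : nat, Q (fun=> (-1) ^+ i).
Hypothesis QD : forall c d, Q c -> Q d -> Q (fun k => c k + d k).
Hypothesis QM : forall c d, Q c -> Q d -> Q (fun k => c k * d k).
Hypothesis Qf : forall i k, Q (fun=> pcoef (f i) k).
Hypothesis Qg : forall h k, Q (fun=> pcoef (g h) k).

Lemma relation_series_class P (A : nat -> 'M[L]_l) : (forall k, Q (fun=> P@_k)) ->
  (forall i j, Q (fun k => A k i j)) -> ps_class Q (fun k => relation_series P (A k)).
Proof.
move=> QP QA.
have Cst (c : nat -> L) : Q c -> ps_class Q (fun k => ps_cst n (c k)%:MP).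
  move=> Qc; apply: ps_class_cst => // tau; under eq_fun => k do rewrite mcoeffC.
  by apply: QM => //; apply: class_nat.
have Lift q : (forall k, Q (fun=> pcoef q k)) -> ps_class Q (fun=> lift_ps q).
  move=> Qq k tau; under eq_fun => j do rewrite /lift_ps pcoef_map_ps mcoeffC.
  by apply: QM => //; apply: class_nat.
have Var i : ps_class Q (fun=> ps_cst n ('X_i : T)).
  by apply: ps_class_cst => // tau; under eq_fun => k do rewrite mcoeffX; apply: class_nat.
rewrite /relation_series /mmap; apply: ps_class_sum => // k _.
apply: ps_classM => //; first exact: Cst.
rewrite /mmap1; apply: ps_class_prod => // i _; apply: ps_classX => //.
rewrite /iter_var; case: split => [i'|h].
  apply: ps_classD => //; apply: ps_class_sum => // j _.
  by apply: ps_classM => //; [exact: Cst | exact: Lift].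
by apply: ps_classM => //; exact: Lift.
Qed.

End Classes.
End RelationSeries.

(** * Growth of norms and heights along the iteration *)

Section Growth.
Variable R : realType.
Implicit Types (a rho : R).

Lemma bernoulli rho k : 1 <= rho -> 1 + k%:R * (rho - 1) <= rho ^+ k.
Proof.
move=> r1; elim: k => [|k ih]; first by rewrite mul0r addr0.
rewrite exprS; apply: le_trans (ler_wpM2l (le_trans ler01 r1) ih).
have : 0 <= k%:R * (rho - 1) ^+ 2 by rewrite mulr_ge0 ?ler0n ?sqr_ge0.
rewrite -[k.+1]addn1 natrD; nra.
Qed.

Lemma linear_le_pow rho : 1 < rho -> exists2 C, 0 < C & forall k, k.+1%:R <= C * rho ^+ k.
Proof.
move=> r1; have r0 : 0 < rho - 1 by rewrite subr_gt0.
exists (1 + (rho - 1)^-1) => [|k]; first by rewrite addr_gt0 // invr_gt0.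
have := bernoulli k (ltW r1) => le.
rewrite -[k.+1]add1n natrD mulrDl mul1r lerD //.
  by apply: le_trans le; rewrite lerDl mulr_ge0 ?ler0n // ltW.
rewrite mulrC ler_pdivlMr //; apply: le_trans le.
by rewrite lerDr.
Qed.

(** Write rho = s^2: one factor s^k dominates the linear term and the other tends to infinity. *)
Lemma linear_lt_pow rho a : 1 < rho -> exists N, forall k, (N <= k)%N ->
  a * k.+1%:R < rho ^+ k.
Proof.
move=> r1; pose s := Num.sqrt rho.
have s1 : 1 < s by rewrite -sqrtr1 ltr_sqrt // (lt_trans ltr01).
have [C C0 hC] := linear_le_pow s1.
have s0 : 0 < s by apply: lt_trans s1.
have sE k : rho ^+ k = s ^+ k * s ^+ k.
  by rewrite -expr2 exprAC sqr_sqrtr // ltW // (lt_trans ltr01).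
have [N hN] : exists N : nat, `|a| * C / (s - 1) < N%:R.
  by exists (Num.truncn (`|a| * C / (s - 1))).+1; rewrite truncnS_gt.
exists N => k Nk; rewrite sE.
apply: (@le_lt_trans _ _ (`|a| * C * s ^+ k)).
  apply: le_trans (ler_wpM2r (ler0n _ _) (ler_norm a)) _.
  by rewrite -mulrA ler_wpM2l.
rewrite ltr_pM2r ?exprn_gt0 //; apply: lt_le_trans (bernoulli k (ltW s1)).
rewrite ltr_wpDl //; move: hN; rewrite ltr_pdivrMr ?subr_gt0 // => /lt_le_trans; apply.
by rewrite ler_wpM2r ?subr_ge0 ?(ltW s1) // ler_nat.
Qed.

End Growth.

Section BoundedNorms.
Variables (R : realType) (L : fieldType) (v : L -> R).
Hypothesis v_abs : is_absval v.
Hypothesis v_complete : abs_complete v.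
Variable n : nat.
Implicit Types (f g : powser n L) (x : 'I_n -> R) (z : 'I_n -> L).

Section SummableClosure.
Variable x : 'I_n -> R.
Hypothesis x0 : forall j, 0 <= x j.

Lemma summable_sum (I : Type) (r : seq I) (P : pred I) (F : I -> powser n L) :
  (forall i, P i -> summable v x (F i)) -> summable v x (\sum_(i <- r | P i) F i).
Proof.
move=> h; elim/big_ind: _ => // [|f g]; last exact: summableD.
by exists 0; apply: norm_le0.
Qed.

Lemma summable_prod (I : Type) (r : seq I) (P : pred I) (F : I -> powser n L) :
  (forall i, P i -> summable v x (F i)) -> summable v x (\prod_(i <- r | P i) F i).
Proof.
move=> h; elim/big_ind: _ => // [|f g]; last exact: summableM.
by rewrite -(rmorph1 (@ps_cst n L)); apply: summable_poly.
Qed.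

Lemma summable_psc c : summable v x (ps_cst n c).
Proof. by apply: summable_poly. Qed.

Lemma summableX f k : summable v x f -> summable v x (f ^+ k).
Proof.
move=> sf; elim: k => [|k ih]; last by rewrite exprS; apply: summableM.
by rewrite expr0 -(rmorph1 (@ps_cst n L)); apply: summable_poly.
Qed.

Lemma summable_mmap N (y : 'I_N -> powser n L) (p : {mpoly L[N]}) :
  (forall i, summable v x (y i)) -> summable v x (mmap (@ps_cst n L) y p).
Proof.
move=> sy; apply: summable_sum => k _; apply: summableM => //.
  exact: summable_psc.
by apply: summable_prod => i _; apply: summableX.
Qed.

End SummableClosure.

Section Values.
Variables (x : 'I_n -> R) (z : 'I_n -> L).
Hypothesis zx : forall j, v (z j) <= x j.

Let x0 j : 0 <= x j. Proof. exact: le_trans (absv_ge0 v_abs _) (zx j). Qed.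

Lemma ps_val_sum (I : Type) (r : seq I) (P : pred I) (F : I -> powser n L) :
    (forall i, P i -> summable v x (F i)) ->
  ps_val v (\sum_(i <- r | P i) F i) z = \sum_(i <- r | P i) ps_val v (F i) z.
Proof.
move=> h; elim: r => [|i r ih].
  by rewrite !big_nil -(rmorph0 (@ps_cst n L)) (ps_val_cst v_abs v_complete zx).
rewrite !big_cons; case: ifP => // Pi.
by rewrite (ps_valD v_abs v_complete zx) ?ih //; [exact: h | exact: summable_sum].
Qed.

Lemma ps_val_prod (I : Type) (r : seq I) (P : pred I) (F : I -> powser n L) :
    (forall i, P i -> summable v x (F i)) ->
  ps_val v (\prod_(i <- r | P i) F i) z = \prod_(i <- r | P i) ps_val v (F i) z.
Proof.
move=> h; elim: r => [|i r ih].
  by rewrite !big_nil -(rmorph1 (@ps_cst n L)) (ps_val_cst v_abs v_complete zx).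
rewrite !big_cons; case: ifP => // Pi.
by rewrite (ps_valM v_abs v_complete zx) ?ih //; [exact: h | exact: summable_prod].
Qed.

Lemma ps_valX f k : summable v x f -> ps_val v (f ^+ k) z = ps_val v f z ^+ k.
Proof.
move=> sf; elim: k => [|k ih].
  by rewrite !expr0 -(rmorph1 (@ps_cst n L)) (ps_val_cst v_abs v_complete zx).
by rewrite !exprS (ps_valM v_abs v_complete zx) ?ih //; apply: summableX.
Qed.

Lemma ps_val_mmap N (y : 'I_N -> powser n L) (p : {mpoly L[N]}) :
    (forall i, summable v x (y i)) ->
  ps_val v (mmap (@ps_cst n L) y p) z = mmap idfun (fun i => ps_val v (y i) z) p.
Proof.
move=> sy; have sm k : summable v x (mmap1 y k).
  by apply: summable_prod => // i _; apply: summableX.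
rewrite /mmap ps_val_sum => [|k _]; last by apply: summableM => //; apply: summable_psc.
apply: eq_bigr => k _; rewrite (ps_valM v_abs v_complete zx) //; last exact: summable_psc.
rewrite (ps_val_cst v_abs v_complete zx); congr (_ * _).
rewrite /mmap1 ps_val_prod => [|i _]; last exact: summableX.
by apply: eq_bigr => i _; rewrite ps_valX.
Qed.

End Values.

Section ExponentialNorms.
Variable delta : R.
Hypothesis delta_gt0 : 0 < delta.

Let d0 (j : 'I_n) : 0 <= (fun=> delta) j. Proof. exact: ltW. Qed.

(** Growth exp(O(k)) of the norms is negligible against the decay exp(-c rho^k) of the orbit. *)
Definition exp_norm (f : nat -> powser n L) := exists B, exists2 N : nat, 0 <= B &
  forall k, (N <= k)%N -> norm_le v (fun=> delta) (expR (B * k.+1%:R)) (f k).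

Lemma expR_lin_le (B C : R) k : B <= C -> expR (B * k.+1%:R) <= expR (C * k.+1%:R).
Proof. by move=> BC; rewrite ler_expR ler_wpM2r. Qed.

Lemma exp_normD (f g : nat -> powser n L) : exp_norm f -> exp_norm g -> exp_norm (fun k => f k + g k).
Proof.
(* The extra 1 pays for the factor 2 in a + b <= 2 a b, valid for a, b >= 1. *)
move=> [B [N B0 hf]] [C [M C0 hg]]; exists (B + C + 1), (maxn N M).
  by rewrite !addr_ge0.
move=> k; rewrite geq_max => /andP[/hf{}hf /hg{}hg].
apply: norm_le_trans (norm_leD v_abs d0 hf hg).
have k1 : 1 <= k.+1%:R :> R by rewrite ler1n.
have a1 : 1 <= expR (B * k.+1%:R) by apply: le_trans (expR_ge1Dx _); rewrite lerDl mulr_ge0.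
have b1 : 1 <= expR (C * k.+1%:R) by apply: le_trans (expR_ge1Dx _); rewrite lerDl mulr_ge0.
have c2 : 2 <= expR (1 * k.+1%:R) :> R.
  apply: le_trans (expR_ge1Dx _); rewrite mul1r -[2]/(1 + 1) lerD2l //.
rewrite !mulrDl !expRD; move: a1 b1 c2.
set a := expR _; set b := expR _; set e := expR _ => a1 b1 c2.
have ab : a + b <= a * b * 2 by nra.
by apply: le_trans ab _; rewrite ler_wpM2l // mulr_ge0 // (le_trans ler01).
Qed.

Lemma exp_normM (f g : nat -> powser n L) : exp_norm f -> exp_norm g -> exp_norm (fun k => f k * g k).
Proof.
move=> [B [N B0 hf]] [C [M C0 hg]]; exists (B + C), (maxn N M).
  by rewrite !addr_ge0.
move=> k; rewrite geq_max => /andP[/hf{}hf /hg{}hg].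
by rewrite mulrDl expRD; apply: norm_leM.
Qed.

Lemma exp_norm_cst (c : nat -> L) (B : R) (N : nat) :
  (forall k, (N <= k)%N -> v (c k) <= expR (B * k.+1%:R)) -> exp_norm (fun k => ps_cst n (c k)).
Proof.
move=> hc; exists (Num.max B 0), N; first by rewrite le_max lexx orbT.
move=> k /hc le; apply: norm_le_trans (norm_le_cst v_abs _ d0).
by apply: le_trans le _; apply: expR_lin_le; rewrite le_max lexx.
Qed.

Lemma exp_norm_const f : summable v (fun=> delta) f -> exp_norm (fun=> f).
Proof.
move=> [B hB]; have B0 := norm_le_ge0 hB; exists B, 0%N => // k _.
apply: norm_le_trans hB; apply: le_trans (expR_ge1Dx _).
apply: le_trans (_ : B * 1 <= _); first by rewrite mulr1.
by rewrite -[leLHS]add0r lerD // ler_wpM2l // ler1n.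
Qed.

Lemma exp_norm_sum (I : Type) (r : seq I) (P : pred I) (F : I -> nat -> powser n L) :
  (forall i, P i -> exp_norm (F i)) -> exp_norm (fun k => \sum_(i <- r | P i) F i k).
Proof.
move=> hf; elim: r => [|i r ih].
  under eq_fun => k do rewrite big_nil; apply: exp_norm_const.
  by exists 0; apply: norm_le0.
under eq_fun => k do rewrite big_cons.
by case: (boolP (P i)) => // Pi; apply: exp_normD => //; apply: hf.
Qed.

Lemma exp_normX (f : nat -> powser n L) j : exp_norm f -> exp_norm (fun k => f k ^+ j).
Proof.
move=> hf; elim: j => [|j ih].
  by apply: exp_norm_const; rewrite -(rmorph1 (@ps_cst n L)); apply: summable_poly.
by under eq_fun => k do rewrite exprS; apply: exp_normM.
Qed.

Lemma exp_norm_prod (I : Type) (r : seq I) (P : pred I) (F : I -> nat -> powser n L) :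
  (forall i, P i -> exp_norm (F i)) -> exp_norm (fun k => \prod_(i <- r | P i) F i k).
Proof.
move=> hf; elim: r => [|i r ih].
  under eq_fun => k do rewrite big_nil; apply: exp_norm_const.
  by rewrite -(rmorph1 (@ps_cst n L)); apply: summable_poly.
under eq_fun => k do rewrite big_cons.
by case: (boolP (P i)) => // Pi; apply: exp_normM => //; apply: hf.
Qed.

End ExponentialNorms.
End BoundedNorms.

Section MatrixPowerHeights.
Variables (R : realType) (L : fieldType) (F : fieldExtType rat) (h : {rmorphism F -> L}).

Lemma num_repr_common (I : finType) (x : I -> L) :
    (forall i, exists s : R, lheight h (x i) s) ->
  exists d (a : R), 1 <= a /\ forall i, num_repr h (x i) d a.
Proof.
move=> hx.
have /choice[e he] : forall i, exists e, exists2 s : R, 0 <= s & num_repr h (x i) e s.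
  move=> i; have [s [_ [d [_ nd]]]] := hx i.
  by exists d, (expR s / 2) => //; apply: num_repr_ge0 nd.
have e0 i : (0 < e i)%N by have [s _ []] := he i.
have /choice[b hb] : forall i, exists b : R, num_repr h (x i) (\prod_j e j) b.
  move=> i; have [s s0 ns] := he i; eexists; rewrite (bigD1 i) //=.
  by apply: num_repr_scale ns; apply: prodn_cond_gt0.
exists (\prod_j e j)%N, (1 + \sum_i b i).
have b0 i : 0 <= b i by apply: num_repr_ge0 (hb i).
split; first by rewrite lerDl sumr_ge0.
move=> i; apply: num_reprW (hb i).
by rewrite (bigD1 i) //= addrCA lerDl addr_ge0 // sumr_ge0.
Qed.

(** A common denominator d of the entries yields the denominator d^k and the bound D (l a)^k for
    A^k, hence a height linear in k. Adding heights along A^(k+1) = A A^k would multiply them by l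
    at each step. *)
Lemma lheight_mxpow l (A : 'M[L]_l) :
    (forall i j, exists s : R, lheight h (A i j) s) ->
  exists C : R, forall k i j, lheight h ((A ^+ k) i j) (C * k.+1%:R).
Proof.
move=> hA.
have [d [a [a1 hd]]] := @num_repr_common ('I_l * 'I_l)%type (fun ij => A ij.1 ij.2)
  (fun ij => hA ij.1 ij.2).
have a0 : 0 <= a by apply: le_trans a1.
pose D : R := (\dim {:F})%:R; have D0 : 0 <= D by rewrite ler0n.
have key k i j : num_repr h ((A ^+ k) i j) (d ^ k) (D * (l%:R * a) ^+ k).
  elim: k i j => [|k ih] i j.
    rewrite expr0 mulr1 mxE; have := num_repr_nat R h (i == j).
    by apply: num_reprW; rewrite ler_piMr // lern1 leq_b1.
  rewrite exprS mxE expnS.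
  have -> : D * (l%:R * a) ^+ k.+1 = \sum_(t < l) a * (D * (l%:R * a) ^+ k).
    by rewrite sumr_const card_ord -[RHS]mulr_natl exprS; ring.
  have [d0 _] := num_reprM (hd (i, j)) (ih i j).
  elim/big_rec2: _ => [|t y1 y2 _ ih2].
    have d0' : (0 < d * d ^ k)%N by have [] := num_reprM (hd (i, j)) (ih i j).
    have := num_repr_scale d0' (num_repr_nat R h 0).
    by rewrite !mulr0 mul1n.
  by apply: num_reprD => //; apply: num_reprM => //; exact: (hd (i, t)).
pose b := d%:R + l%:R * a + 1 : R.
have b1 : 1 <= b by rewrite lerDr addr_ge0 ?mulr_ge0 ?ler0n.
have mh0 := min_height_ge0 R F.
exists (min_height R F + ln b) => k i j.
have lb : 0 <= ln b by apply: ln_ge0.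
have k1 : 1 <= k.+1%:R :> R by rewrite ler1n.
have le0 : min_height R F <= (min_height R F + ln b) * k.+1%:R.
  by rewrite mulrDl -[leLHS]addr0 lerD ?mulr_ge0 // ler_peMr.
have eb (y : R) : 0 <= y -> y <= b -> y ^+ k <= expR (ln b * k.+1%:R).
  move=> y0 yb; apply: (@le_trans _ _ (b ^+ k.+1)).
    apply: (@le_trans _ _ (b ^+ k)); first by rewrite lerXn2r // ?nnegrE ?(le_trans y0).
    by rewrite ler_weXn2l.
  by rewrite mulrC expRM_natl lnK // posrE (lt_le_trans ltr01).
have half (e : R) : e <= expR (min_height R F) / 2 ->
    e <= expR (min_height R F * k.+1%:R) / 2.
  move=> he; apply: le_trans he _; rewrite ler_wpM2r ?invr_ge0 // ler_expR ler_peMr //.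
split=> //; exists (d ^ k)%N; rewrite mulrDl expRD mulrAC; split.
  rewrite natrX -[leLHS]mul1r; apply: ler_pM; rewrite ?exprn_ge0 ?ler0n //.
    apply: half; rewrite ler_pdivlMr // mul1r; exact: min_height_exp2.
  by apply: eb; rewrite ?ler0n // /b -addrA lerDl addr_ge0 ?mulr_ge0 ?ler0n.
apply: num_reprW (key k i j); apply: ler_pM; rewrite ?exprn_ge0 ?mulr_ge0 ?ler0n //.
  by apply: half; apply: min_height_expD.
by apply: eb; rewrite ?mulr_ge0 ?ler0n // /b addrAC lerDr addr_ge0 ?ler0n.
Qed.

End MatrixPowerHeights.

(** * Mahler's method over a complete valued field *)

Section CoreArgument.
Variables (R : realType) (L : fieldType) (v : L -> R).
Hypothesis v_abs : is_absval v.
Hypothesis v_complete : abs_complete v.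
Hypothesis v_nat : forall d, (0 < d)%N -> (d%:R : R)^-1 <= v d%:R.
Variables (F : fieldExtType rat) (h : {rmorphism F -> L}).
Variables (n l m : nat) (Omega : 'M[nat]_n).
Hypothesis Omega_det : \det (mx_rat Omega) != 0.
Hypothesis Omega_unity : forall s (d : 'rV[rat]_n),
  (0 < s)%N -> d *m mx_rat Omega ^+ s = d -> d = 0.
Variable alpha : 'I_n -> L.
Let orb k := iter k (vec_act Omega) alpha.
Hypothesis orb_generic : forall f : powser n L, f != 0 ->
  converges_near0 v f -> infinitely_many (fun k => ps_val v f (orb k) != 0).
Variables (rho c0 delta : R).
Hypothesis rho_gt1 : 1 < rho.
Hypothesis c0_gt0 : 0 < c0.
Hypothesis delta_gt0 : 0 < delta.
Hypothesis delta_le1 : delta <= 1.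
Hypothesis orb_decay : exists N, forall k, (N <= k)%N -> forall j,
  v (orb k j) <= expR (- (c0 * rho ^+ k)).
Hypothesis orb_height : exists C, forall k j, lheight h (orb k j) (C * rho ^+ k).
Variables (f : 'I_l -> powser n L) (g : 'I_m -> powser n L) (A : 'M[L]_l).
Hypothesis f_summable : forall i, summable v (fun=> delta) (f i).
Hypothesis g_summable : forall i, summable v (fun=> delta) (g i).
Hypothesis f_height : forall i k, exists s : R, lheight h (pcoef (f i) k) s.
Hypothesis g_height : forall i k, exists s : R, lheight h (pcoef (g i) k) s.
Hypothesis A_height : forall i j, exists s : R, lheight h (A i j) s.
Hypothesis A_unit : A \in unitmx.
Hypothesis A_exp : forall i j, exp_poly idfun (fun k => (A ^+ k) i j).
Hypothesis g0 : forall i, pcoef (g i) 0%MM != 0.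
Notation N := (l + m)%N.
Hypothesis fg_ind : forall q : {mpoly {mpoly L[n]}[N]},
  mmap (@poly_ps n L) (join_fam f g) q = 0 -> q = 0.
Variables (fa : 'I_l -> L) (ga : 'I_m -> L) (u : nat -> 'I_l -> L) (w : nat -> 'I_m -> L).
Let t k : 'I_N -> L := join_fam (u k) (w k).
Hypothesis t_height : exists C, forall k i, lheight h (t k i) (C * rho ^+ k).
Hypothesis fa_iter : exists N0, forall k, (N0 <= k)%N -> forall i,
  fa i = \sum_j (A ^+ k) i j * ps_val v (f j) (orb k) + u k i.
Hypothesis ga_iter : exists N0, forall k, (N0 <= k)%N -> forall i,
  ga i = w k i * ps_val v (g i) (orb k).
Hypothesis ga_neq0 : forall i, ga i != 0.
Variable P : {mpoly L[N]}.
Hypothesis P_height : forall k, exists s : R, lheight h P@_k s.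
Hypothesis P_root : mmap idfun (join_fam fa ga) P = 0.

Notation cst := (@ps_cst n L).
Notation box p := ({ffun 'I_n -> 'I_p} * {ffun 'I_N -> 'I_p})%type.

Let d0 (j : 'I_n) : 0 <= (fun=> delta) j. Proof. exact: ltW. Qed.

Lemma decay_small (eta : R) : 0 < eta ->
  exists N0, forall k, (N0 <= k)%N -> expR (- (c0 * rho ^+ k)) <= eta.
Proof.
move=> eta0; have [N2 h2] := linear_lt_pow (- ln eta / c0) rho_gt1.
exists N2 => k k2; rewrite -[leRHS]lnK ?posrE // ler_expR.
have [le0|lt0] := leP 0 (ln eta).
  by apply: le_trans le0; rewrite oppr_le0 mulr_ge0 ?exprn_ge0 // ltW // (lt_trans ltr01).
have := h2 k k2 => /ltW; rewrite mulrAC ler_pdivrMr // [_ * c0]mulrC => le.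
rewrite lerNl; apply: le_trans le; rewrite -[leLHS]mulr1 ler_wpM2l ?ler1n //.
by rewrite oppr_ge0 ltW.
Qed.

Lemma orb_small (eta : R) : 0 < eta ->
  exists N0, forall k, (N0 <= k)%N -> forall j, v (orb k j) <= eta.
Proof.
move=> eta0; have [N1 h1] := orb_decay; have [N2 h2] := decay_small eta0.
exists (maxn N1 N2) => k; rewrite geq_max => /andP[k1 k2] j.
exact: le_trans (h1 k k1 j) (h2 k k2).
Qed.

Let orb_delta : exists N0, forall k, (N0 <= k)%N -> forall j, v (orb k j) <= (fun=> delta) j.
Proof. exact: orb_small. Qed.

(** The ring in which the linear system is solved: the recurrence is for [vanishing_theorem], the
    linear height for Liouville's inequality. *)
Definition good_seq (c : nat -> L) := exp_poly idfun c /\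
  exists C : R, forall k, lheight h (c k) (C * k.+1%:R).

Lemma good_const x : (exists s : R, lheight h x s) -> good_seq (fun=> x).
Proof.
move=> [s hs]; split; first exact: exp_poly_const.
exists s => k; apply: (lheightW _ hs); rewrite ler_peMr ?ler1n //.
exact: lheight_ge0 hs.
Qed.

Lemma goodD c d : good_seq c -> good_seq d -> good_seq (fun k => c k + d k).
Proof.
move=> [ec [C hC]] [ed [D hD]]; split; first exact: exp_polyD.
by exists (C + D) => k; rewrite mulrDl; apply: lheightD.
Qed.

Lemma goodM c d : good_seq c -> good_seq d -> good_seq (fun k => c k * d k).
Proof.
move=> [ec [C hC]] [ed [D hD]]; split; first exact: exp_polyM.
by exists (C + D) => k; rewrite mulrDl; apply: lheightM.
Qed.

Lemma good0 : good_seq (fun=> 0).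
Proof. by apply: good_const; rewrite -(rmorph0 h); apply: lheight_field. Qed.

Lemma good_sign i : good_seq (fun=> (-1) ^+ i).
Proof.
by apply: good_const; rewrite -(rmorphN1 h) -rmorphXn; apply: lheight_field.
Qed.

Lemma good_mxpow i j : good_seq (fun k => (A ^+ k) i j).
Proof. by split=> //; have [C hC] := lheight_mxpow A_height; exists C => k. Qed.

Lemma good_absv c : good_seq c -> exists B : R,
  forall k, v (c k) <= expR (B * k.+1%:R).
Proof.
move=> [_ [C hC]]; have [kap k0 hk] := lheight_absv v_abs v_nat h.
by exists (kap * C) => k; rewrite -mulrA; apply: hk.
Qed.

Let Fs k := relation_series f g P (A ^+ k).

Lemma Fs_class : ps_class good_seq Fs.
Proof.
apply: relation_series_class => //; first exact: good0.
- exact: good_sign.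
- exact: goodD.
- exact: goodM.
- by move=> i k; apply: good_const.
- by move=> i k; apply: good_const.
- by move=> k; apply: good_const.
- exact: good_mxpow.
Qed.

Let Y k i := iter_val f g (t k) (A ^+ k) i.

(** The height of t_k bounds its size only by exp(O(rho^k)). The functional equations give more: u_k
    = f(alpha) - A^k f(Omega^k alpha) is exp(O(k)), and w_k = g(alpha) / g(Omega^k alpha) is bounded
    because g(0) != 0. *)
Lemma exp_norm_t i : exp_norm v delta (fun k => cst (t k i)).
Proof.
have [N0 hd] := orb_delta.
rewrite /t /join_fam; case: split => [i'|j].
  have [N1 h1] := fa_iter.
  have /choice[B hB] := fun j => good_absv (good_mxpow i' j).
  have /choice[Z hZ] : forall j, exists Z, forall k, (N0 <= k)%N -> v (ps_val v (f j) (orb k)) <= Z.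
    move=> j; have [Z hZ] := f_summable j; exists Z => k k0.
    apply: (tends_le v_abs (tends_ps_val v_abs v_complete (hd k k0) (f_summable j))) => e.
    by rewrite partial_sumE; apply: le_trans (absv_term_le v_abs _ _ xpredT (hd k k0)) _;
       apply: norm_le_seq => //; apply: exponents_uniq.
  pose W := v (fa i') + \sum_j Num.max 0 (Z j).
  have W0 : 0 <= W by rewrite addr_ge0 ?absv_ge0 // sumr_ge0 // => j _; rewrite le_max lexx.
  pose Bm := \sum_j Num.max 0 (B j).
  have Bm0 : 0 <= Bm by rewrite sumr_ge0 // => j _; rewrite le_max lexx.
  apply: (@exp_norm_cst _ _ _ _ _ _ _ _ (W + Bm) (maxn N0 N1)) => // k.
  rewrite geq_max => /andP[k0 k1].
  have -> : u k i' = fa i' - \sum_j (A ^+ k) i' j * ps_val v (f j) (orb k).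
    by rewrite (h1 k k1 i') addrC addKr.
  apply: le_trans (absvB v_abs _ _) _.
  have eB : 1 <= expR (Bm * k.+1%:R).
    by apply: le_trans (expR_ge1Dx _); rewrite lerDl mulr_ge0.
  apply: (@le_trans _ _ (W * expR (Bm * k.+1%:R))); last first.
    rewrite [(W + Bm) * _]mulrDl expRD ler_wpM2r ?expR_ge0 //.
    apply: le_trans (expR_ge1Dx _); apply: (@le_trans _ _ (W * k.+1%:R)).
      by rewrite ler_peMr // ler1n.
    by rewrite lerDr.
  rewrite /W mulrDl lerD //; first by rewrite ler_peMr ?absv_ge0.
  apply: le_trans (absv_sum v_abs _ _ _) _; rewrite mulr_suml; apply: ler_sum => j _.
  rewrite (absvM v_abs) mulrC; apply: ler_pM; rewrite ?absv_ge0 //.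
    by apply: le_trans (hZ j k k0) _; rewrite le_max lexx orbT.
  apply: le_trans (hB j k) _; apply: expR_lin_le; rewrite /Bm (bigD1 j) //=.
  apply: le_trans (_ : Num.max 0 (B j) <= _); first by rewrite le_max lexx orbT.
  by rewrite lerDl sumr_ge0 // => j' _; rewrite le_max lexx.
have [N1 h1] := ga_iter.
have [eta /andP[eta0 _] heta] := ps_val_near0_ge v_abs v_complete delta_gt0 (g_summable j) (g0 j).
have [N2 h2] := orb_small eta0.
have vg : 0 < v (pcoef (g j) 0%MM) / 2 by rewrite divr_gt0 // absv_gt0.
pose W := v (ga j) / (v (pcoef (g j) 0%MM) / 2).
have W0 : 0 <= W := divr_ge0 (absv_ge0 v_abs _) (ltW vg).
apply: (@exp_norm_cst _ _ _ _ _ _ _ _ W (maxn N1 N2)) => // k.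
rewrite geq_max => /andP[k1 k2].
have gk := heta _ (h2 k k2).
have : v (w k j) <= W.
  rewrite ler_pdivlMr //; apply: le_trans (ler_wpM2l (absv_ge0 v_abs _) gk) _.
  by rewrite -(absvM v_abs) -h1.
move=> le; apply: le_trans le _; apply: le_trans (expR_ge1Dx _).
apply: (@le_trans _ _ (W * k.+1%:R)); first by rewrite ler_peMr // ler1n.
by rewrite lerDr.
Qed.

Lemma exp_norm_good c : good_seq c -> exp_norm v delta (fun k => cst (c k)).
Proof. by move=> /good_absv[B hB]; apply: (@exp_norm_cst _ _ _ _ _ _ _ _ B 0). Qed.

Lemma exp_norm_Y i : exp_norm v delta (fun k => Y k i).
Proof.
rewrite /Y /iter_val; case es: (split i) => [i'|j].
  apply: exp_normD => //; last exact: exp_norm_t.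
  apply: exp_norm_sum => // j _; apply: exp_normM => //.
    by apply: exp_norm_good; apply: good_mxpow.
  exact: exp_norm_const.
by apply: exp_normM => //; [exact: exp_norm_t | exact: exp_norm_const].
Qed.

Lemma Y_summable k i : summable v (fun=> delta) (Y k i).
Proof.
rewrite /Y /iter_val; case: split => [i'|j].
  apply: summableD => //; last exact: summable_cst.
  apply: (summable_sum v_abs d0) => j _.
  by apply: summableM => //; exact: summable_cst.
by apply: summableM => //; exact: summable_cst.
Qed.

Lemma Y_val : exists N0, forall k, (N0 <= k)%N -> forall i,
  ps_val v (Y k i) (orb k) = join_fam fa ga i.
Proof.
have [N0 hd] := orb_delta; have [N1 h1] := fa_iter; have [N2 h2] := ga_iter.
exists (maxn N0 (maxn N1 N2)) => k; rewrite !geq_max => /and3P[k0 k1 k2] i.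
have sc x : summable v (fun=> delta) (cst x) by apply: summable_cst.
rewrite /Y /iter_val /join_fam; case es: (split i) => [i'|j].
  have sA j : summable v (fun=> delta) (cst ((A ^+ k) i' j) * f j).
    exact: summableM.
  rewrite (ps_valD v_abs v_complete (hd k k0)) //; last first.
    by apply: (summable_sum v_abs d0).
  rewrite (ps_val_sum v_abs v_complete (hd k k0)) //.
  rewrite (ps_val_cst v_abs v_complete (hd k k0)) (h1 k k1); congr (_ + _); last first.
    by rewrite /t /join_fam es.
  apply: eq_bigr => j _; rewrite (ps_valM v_abs v_complete (hd k k0)) //.
  by rewrite (ps_val_cst v_abs v_complete (hd k k0)).
rewrite (ps_valM v_abs v_complete (hd k k0)) //.
by rewrite (ps_val_cst v_abs v_complete (hd k k0)) (h2 k k2) // /t /join_fam es.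
Qed.

Section Box.
Variables (p : nat) (x : box p -> nat -> L).
Hypothesis x_good : forall a, good_seq (x a).

(** The number that is squeezed between the estimate for a high order of vanishing and Liouville's
    inequality. *)
Definition theta k : L := \sum_a x a k *
  (\prod_j orb k j ^+ a.1 j * \prod_i t k i ^+ a.2 i).

Lemma specialize_box k : specialize (t k) (box_series (fun a => x a k)) =
  \sum_a cst (x a k * \prod_i t k i ^+ a.2 i) * poly_ps 'X_[ffun_mnm a.1].
Proof.
rewrite /specialize /box_series rmorph_sum; apply: eq_bigr => a _.
rewrite rmorphM /= map_ps_cst /= mmapC /box_monomial -mul_mpolyC rmorphM /= -/(ps_cst n _).
rewrite rmorphM /= map_ps_cst /= mmapX mulrA -rmorphM /=; congr (cst (_ * _) * _).
  by rewrite /mmap1; apply: eq_bigr => i _; rewrite mnmE.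
by rewrite map_ps_poly map_mpolyX.
Qed.

Lemma specialize_box_summable k :
  summable v (fun=> delta) (specialize (t k) (box_series (fun a => x a k))).
Proof.
rewrite specialize_box; apply: (summable_sum v_abs d0) => a _.
apply: summableM => //; first exact: summable_cst.
by apply: (summable_poly v_abs) => j; apply: ltW.
Qed.

Lemma theta_val : exists N0, forall k, (N0 <= k)%N ->
  ps_val v (specialize (t k) (box_series (fun a => x a k))) (orb k) = theta k.
Proof.
have [N0 hd] := orb_delta; exists N0 => k k0; rewrite specialize_box.
have sc y : summable v (fun=> delta) (cst y) by apply: summable_cst.
have sp q : summable v (fun=> delta) (poly_ps q) by apply: (summable_poly v_abs) => j; apply: ltW.
rewrite (ps_val_sum v_abs v_complete (hd k k0)); last first.
  by move=> a _; apply: summableM.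
apply: eq_bigr => a _; rewrite (ps_valM v_abs v_complete (hd k k0)) //.
rewrite (ps_val_cst v_abs v_complete (hd k k0)) (ps_val_poly v_abs v_complete (hd k k0)).
rewrite mmapX -mulrA [_ * mmap1 _ _]mulrC; congr (_ * (_ * _)).
by rewrite /mmap1; apply: eq_bigr => i _; rewrite mnmE.
Qed.

Lemma exp_norm_box : exp_norm v delta
  (fun k => specialize (t k) (box_series (fun a => x a k))).
Proof.
under eq_fun => k do rewrite specialize_box.
apply: exp_norm_sum => // a _; apply: exp_normM => //; last first.
  by apply: exp_norm_const => //; apply: (summable_poly v_abs) => j; apply: ltW.
under eq_fun => k do rewrite rmorphM rmorph_prod.
apply: exp_normM => //; first exact: exp_norm_good.
apply: exp_norm_prod => // i _; under eq_fun => k do rewrite rmorphXn.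
by apply: exp_normX => //; apply: exp_norm_t.
Qed.

(** Along the orbit u = f(alpha) - A^k f and w = g(alpha) / g. Multiplying w^e by g^p clears the
    denominator, leaving g(alpha)^e g^(p - e). *)
Definition gam_factor k i e : powser n L := match split i with
  | inl i' => (cst (fa i') - \sum_j cst ((A ^+ k) i' j) * f j) ^+ e
  | inr j => cst (ga j ^+ e) * g j ^+ (p - e) end.

(* Theta with the components of t expressed through f and g, times g^p.       *)
Definition gam k : powser n L := \sum_a cst (x a k) *
  (poly_ps 'X_[ffun_mnm a.1] * \prod_i gam_factor k i (a.2 i)).

Let cst_exp (c : nat -> L) : exp_poly idfun c -> exp_poly cst (fun k => cst (c k)).
Proof. exact: (exp_poly_rmorph cst). Qed.

(** The vectors t_k need not satisfy a recurrence; after their elimination only x and A^k depend on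
    k. *)
Lemma gam_exp : exp_poly cst gam.
Proof.
apply: exp_poly_sum => a _; apply: exp_polyM; first by apply: cst_exp; case: (x_good a).
apply: exp_polyM; first exact: exp_poly_const.
apply: exp_poly_prod => i _; rewrite /gam_factor; case: split => [i'|j]; last exact: exp_poly_const.
apply: exp_polyX; apply: exp_polyD; first exact: exp_poly_const.
apply: exp_polyN; apply: exp_poly_sum => j _; apply: exp_polyM; first exact: cst_exp.
exact: exp_poly_const.
Qed.

Lemma gam_factor_summable k i e : summable v (fun=> delta) (gam_factor k i e).
Proof.
have sc y : summable v (fun=> delta) (cst y) by apply: summable_cst.
rewrite /gam_factor; case: split => [i'|j].
  apply: summableX => //; apply: (summableB v_abs delta_gt0) => //.
  by apply: (summable_sum v_abs d0) => j _; apply: summableM.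
by apply: summableM => //; apply: summableX.
Qed.

Lemma gam_summable k : summable v (fun=> delta) (gam k).
Proof.
apply: (summable_sum v_abs d0) => a _; apply: summableM => //; first exact: summable_cst.
apply: summableM => //; first by apply: (summable_poly v_abs) => j; apply: ltW.
by apply: (summable_prod v_abs d0) => i _; apply: gam_factor_summable.
Qed.

Lemma gam_val : exists N0, forall k, (N0 <= k)%N ->
  exists c, ps_val v (gam k) (orb k) = c * theta k.
Proof.
have [N0 hd] := orb_delta; have [N1 h1] := fa_iter; have [N2 h2] := ga_iter.
exists (maxn N0 (maxn N1 N2)) => k; rewrite !geq_max => /and3P[k0 k1 k2].
have sc y : summable v (fun=> delta) (cst y) by apply: summable_cst.
have sp q : summable v (fun=> delta) (poly_ps q) by apply: (summable_poly v_abs) => j; apply: ltW.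
have sf := gam_factor_summable k.
have spr a : summable v (fun=> delta) (\prod_i gam_factor k i (a i)).
  by apply: (summable_prod v_abs d0) => i _; apply: sf.
pose ci (i : 'I_N) := match split i with inl _ => 1 | inr j => ps_val v (g j) (orb k) ^+ p end.
have vf i (e : 'I_p) : ps_val v (gam_factor k i e) (orb k) = t k i ^+ e * ci i.
  rewrite /gam_factor /ci /t /join_fam; case: split => [i'|j].
    have sA j : summable v (fun=> delta) (cst ((A ^+ k) i' j) * f j) by apply: summableM.
    have ss : summable v (fun=> delta) (\sum_j cst ((A ^+ k) i' j) * f j).
      by apply: (summable_sum v_abs d0).
    rewrite (ps_valX v_abs v_complete (hd k k0)); last exact: (summableB v_abs delta_gt0).
    rewrite mulr1; congr (_ ^+ _); rewrite (ps_valD v_abs v_complete (hd k k0)) //; last first.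
      exact: (summableN v_abs delta_gt0).
    rewrite -mulN1r -(rmorphN1 cst) (ps_valM v_abs v_complete (hd k k0)) //; last exact: sc.
    rewrite !(ps_val_cst v_abs v_complete (hd k k0)) mulN1r.
    rewrite (ps_val_sum v_abs v_complete (hd k k0)) // (h1 k k1).
    rewrite addrC [X in _ + (X + _)](_ : _ = \sum_j ps_val v (cst ((A ^+ k) i' j) * f j) (orb k)).
      by rewrite addKr.
    apply: eq_bigr => j _; rewrite (ps_valM v_abs v_complete (hd k k0)) //.
    by rewrite (ps_val_cst v_abs v_complete (hd k k0)).
  rewrite (ps_valM v_abs v_complete (hd k k0)) //; last exact: summableX.
  rewrite (ps_val_cst v_abs v_complete (hd k k0)) (ps_valX v_abs v_complete (hd k k0)) //.
  by rewrite (h2 k k2) exprMn -mulrA -exprD subnKC // ltnW.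
exists (\prod_i ci i); rewrite /gam (ps_val_sum v_abs v_complete (hd k k0)); last first.
  by move=> a _; apply: summableM => //; apply: summableM.
rewrite /theta mulr_sumr; apply: eq_bigr => a _.
rewrite (ps_valM v_abs v_complete (hd k k0)) //; last exact: summableM.
rewrite (ps_val_cst v_abs v_complete (hd k k0)) (ps_valM v_abs v_complete (hd k k0)) //.
rewrite (ps_val_poly v_abs v_complete (hd k k0)) mmapX.
rewrite (ps_val_prod v_abs v_complete (hd k k0)) //.
rewrite (eq_bigr (fun i => t k i ^+ a.2 i * ci i)) // big_split /=.
rewrite [\prod_i ci i * _]mulrC -!mulrA; congr (_ * (_ * _)).
by rewrite /mmap1; apply: eq_bigr => i _; rewrite mnmE.
Qed.

(** By independence the polynomial q behind gam_k is zero. The invertible substitution X -> A^(-k)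
    (f(alpha) - X) in the variables of f turns its factors into powers X^e, while those of g are
    g(alpha)^e X^(p - e). Distinct boxes thus give distinct monomials, and g(alpha) != 0. *)
Lemma gam_eq0 k : gam k = 0 -> forall a, x a k = 0.
Proof.
move=> gk.
pose cc (y : L) : {mpoly {mpoly L[n]}[N]} := y%:MP%:MP.
pose Zq (i : 'I_N) e : {mpoly {mpoly L[n]}[N]} := match split i with
  | inl i' => (cc (fa i') - \sum_j cc ((A ^+ k) i' j) * 'X_(lshift m j)) ^+ e
  | inr j => cc (ga j ^+ e) * 'X_i ^+ (p - e) end.
pose q : {mpoly {mpoly L[n]}[N]} :=
  \sum_a ((x a k)%:MP * 'X_[ffun_mnm a.1]) *: \prod_i Zq i (a.2 i).
have ccE y : mmap (@poly_ps n L) (join_fam f g) (cc y) = cst y by rewrite mmapC.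
have q0 : q = 0.
  apply: fg_ind; rewrite -gk /gam /q rmorph_sum; apply: eq_bigr => a _.
  rewrite /= mmapZ rmorphM mulrA; congr (_ * _); rewrite rmorph_prod; apply: eq_bigr => i _.
  rewrite /Zq /gam_factor; case es: (split i) => [i'|j].
    rewrite rmorphXn rmorphB rmorph_sum /= ccE; congr ((_ - _) ^+ _).
    apply: eq_bigr => j _; rewrite rmorphM /= ccE mmapX mmap1U; congr (_ * _).
    by rewrite /join_fam (unsplitK (inl j)).
  by rewrite rmorphM rmorphXn /= ccE mmapX mmap1U /join_fam es.
have Ak : A ^+ k \in unitmx.
  by elim: (k) => [|k' ih]; rewrite ?expr0 ?unitmx1 // exprS unitmx_mul A_unit.
pose Ai := invmx (A ^+ k).
pose Psi (i : 'I_N) : {mpoly {mpoly L[n]}[N]} := match split i with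
  | inl i' => \sum_j cc (Ai i' j) * (cc (fa j) - 'X_(lshift m j))
  | inr j => 'X_i end.
pose rv (b : {ffun 'I_N -> 'I_p}) : 'X_{1..N} :=
  [multinom (match split i with inl _ => b i : nat | inr _ => (p - b i)%N end) | i < N].
pose gc (b : {ffun 'I_N -> 'I_p}) := \prod_i (match split i with inl _ => 1 | inr j => ga j ^+ b i end).
have PsiC y : mmap (@mpolyC N {mpoly L[n]}) Psi (cc y) = cc y by rewrite mmapC.
have ccD : {morph cc : y z / y + z} by move=> y z; rewrite /cc !rmorphD.
have ccM : {morph cc : y z / y * z} by move=> y z; rewrite /cc !rmorphM.
have cc0 : cc 0 = 0 by rewrite /cc !rmorph0.
have PsiL i' : \sum_j cc ((A ^+ k) i' j) * Psi (lshift m j) = cc (fa i') - 'X_(lshift m i').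
  rewrite (eq_bigr (fun j => \sum_s (cc ((A ^+ k) i' j * Ai j s) * (cc (fa s) - 'X_(lshift m s))))).
    rewrite exchange_big (bigD1 i') //= [X in _ + X]big1 ?addr0.
      rewrite -mulr_suml -(big_morph cc ccD cc0) [X in cc X](_ : _ = 1) ?[cc 1]rmorph1 ?mul1r //.
      have := congr1 (fun M : 'M_l => M i' i') (mulmxV Ak); rewrite !mxE eqxx mulr1n => e; rewrite -[RHS]e.
      by apply: eq_bigr.
    move=> s si; rewrite -mulr_suml -(big_morph cc ccD cc0) [X in cc X](_ : _ = 0) ?cc0 ?mul0r //.
    have := congr1 (fun M : 'M_l => M i' s) (mulmxV Ak); rewrite !mxE eq_sym (negPf si) mulr0n => e; rewrite -[RHS]e.
    by apply: eq_bigr.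
  move=> j _; rewrite /Psi (unsplitK (inl j)) mulr_sumr; apply: eq_bigr => s _.
  by rewrite ccM mulrA.
have qE : mmap (@mpolyC N {mpoly L[n]}) Psi q =
    \sum_a ((x a k * gc a.2)%:MP * 'X_[ffun_mnm a.1]) *: 'X_[rv a.2].
  rewrite /q rmorph_sum; apply: eq_bigr => a _; rewrite /= mmapZ rmorph_prod.
  rewrite (eq_bigr (fun i => cc (match split i with inl _ => 1 | inr j => ga j ^+ a.2 i end)
    * 'X_i ^+ rv a.2 i)) => [|i _].
    rewrite big_split /= -(big_morph cc ccM (rmorph1 _)) -mpolyXE_id -/(gc a.2) [cc _ * _]mul_mpolyC.
    by rewrite [(_ * _)%:MP * _]mul_mpolyC scalerA mulrAC -rmorphM.
  rewrite /Zq /rv mnmE; case es: (split i) => [i'|j].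
    rewrite rmorphXn rmorphB rmorph_sum /= PsiC [cc 1]rmorph1 mul1r; congr (_ ^+ _).
    rewrite [X in _ - X](_ : _ = \sum_j cc ((A ^+ k) i' j) * Psi (lshift m j)).
      by rewrite PsiL subKr -[in RHS](splitK i) es.
    by apply: eq_bigr => j _; rewrite rmorphM /= PsiC mmapX mmap1U.
  by rewrite rmorphM rmorphXn /= PsiC mmapX mmap1U /Psi es.
move=> a; have := congr1 (mmap (@mpolyC N {mpoly L[n]}) Psi) q0.
rewrite qE rmorph0 => /(congr1 (fun M : {mpoly {mpoly L[n]}[N]} => M@_(rv a.2)@_(ffun_mnm a.1))).
rewrite !mcoeff0 !raddf_sum (bigD1 a) //= big1 ?addr0.
  rewrite mcoeffZ mcoeffX eqxx mulr1 mcoeffCM mcoeffX eqxx mulr1 => /eqP.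
  rewrite mulf_eq0 => /orP[/eqP //|/prodf_eq0[i _]].
  by case: split => [i'|j]; rewrite ?oner_eq0 // expf_eq0 (negPf (ga_neq0 j)) andbF.
move=> a' aa; rewrite mcoeffZ mcoeffX; case: eqP => [e1|_]; last by rewrite mulr0 mcoeff0.
rewrite mulr1 mcoeffCM mcoeffX; case: eqP => [/ffun_mnm_inj e2|_]; last by rewrite mulr0.
case/eqP: aa; case: a' a e1 e2 => [a1 a2] [b1 b2] /= /mnmP e1 ->; congr (_, _).
apply/ffunP => i; apply: val_inj; have := e1 i; rewrite !mnmE.
case: split => // _ e1i; rewrite /= -(subKn (ltnW (ltn_ord (a2 i)))) e1i.
by rewrite subKn // ltnW.
Qed.

End Box.

Theorem core_independence : P = 0.
Proof.
apply/eqP/negPn/negP => P0.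
have [Ch hCh] := orb_height; have [Ct hCt] := t_height.
have [kap kap0 hkap] := lheight_absv_ge v_abs v_nat h.
(* The monomials in Omega^k alpha and t_k have height about p Cs rho^k. The choice of s makes c0 (s
   + 1) exceed kap Cs by at least 1, independently of p. *)
pose Cs := n%:R * Ch + N%:R * Ct.
have [s hs] : exists s : nat, (kap * Cs + 1) / c0 < s%:R.
  by exists (Num.truncn ((kap * Cs + 1) / c0)).+1; rewrite truncnS_gt.
have [s_gt0 cs] : (0 < s.+1)%N /\ kap * Cs + 1 <= c0 * s.+1%:R.
  split=> //; rewrite [leRHS]mulrC -ler_pdivrMr //; apply: ltW; apply: lt_le_trans hs _.
  by rewrite ler_nat.
have Fdeg k : ps_deg_le (msize P) (Fs k) by apply: relation_series_deg.
have F0 k : pcoef (Fs k) 0%MM != 0 by apply: relation_series_neq0.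
have [p [x [s0 [xg [a1 xa1] [N0 hN0]]]]] :=
  auxiliary_series good0 good_sign goodD goodM s_gt0 Fs_class Fdeg F0.
have p0 : (0 < p)%N by apply: leq_trans (ltn_ord s0).
pose E k := \sum_(j < p | (s0 <= j)%N) box_series (fun a => x j a k) * Fs k ^+ (j - s0).
pose e k := specialize (t k) (E k).
pose FY k := mmap (@ps_cst n L) (Y k) P.
have eE k : e k = \sum_(j < p | (s0 <= j)%N)
    specialize (t k) (box_series (fun a => x j a k)) * FY k ^+ (j - s0).
  rewrite /e /E /FY /specialize rmorph_sum; apply: eq_bigr => j _.
  by rewrite rmorphM rmorphXn /= -!/(specialize _ _) specialize_relation.
have [B [n2 B0 hB]] : exp_norm v delta e.
  rewrite (funext eE); apply: exp_norm_sum => // j _.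
  apply: exp_normM => //; first exact: exp_norm_box.
  apply: exp_normX => //; apply: exp_norm_sum => // mu _; apply: exp_normM => //.
    by apply: exp_norm_const => //; exact: summable_cst.
  by apply: exp_norm_prod => // i _; apply: exp_normX => //; apply: exp_norm_Y.
have FYs k : summable v (fun=> delta) (FY k).
  by apply: (summable_mmap v_abs d0) => i; apply: Y_summable.
(* At Omega^k alpha the specialized F_k takes the value P(f(alpha), g(alpha)) = 0, so only the term
   j = s0 remains. *)
have [n3 h3] : exists n3, forall k, (n3 <= k)%N -> ps_val v (e k) (orb k) = theta (x s0) k.
  have [m1 k1] := orb_delta; have [m2 k2] := Y_val; have [m3 k3] := theta_val (x s0).
  exists (maxn m1 (maxn m2 m3)) => k; rewrite !geq_max => /and3P[/k1{}k1 /k2{}k2 /k3{}k3].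
  have sb j := specialize_box_summable (x j) k.
  rewrite eE (ps_val_sum v_abs v_complete k1); last first.
    by move=> j _; apply: summableM => //; apply: summableX.
  have FY0 : ps_val v (FY k) (orb k) = 0.
    rewrite (ps_val_mmap v_abs v_complete k1); last by move=> i; apply: Y_summable.
    by rewrite -[RHS]P_root; apply: eq_mmap.
  have sX j : summable v (fun=> delta) (FY k ^+ j) by apply: summableX.
  rewrite (bigD1 s0) //= big1 ?addr0 => [|j /andP[sj js]].
    by rewrite subnn expr0 mulr1.
  rewrite (ps_valM v_abs v_complete k1) // (ps_valX v_abs v_complete k1) // FY0 expr0n.
  by rewrite subn_eq0 leqNgt ltn_neqAle sj eq_sym js /= mulr0.
have e_ord k : (N0 <= k)%N -> forall mu, (mdeg mu < p * s.+1)%N -> pcoef (e k) mu = 0.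
  by move=> k0 mu lt; rewrite /e /specialize pcoef_map_ps hN0 // rmorph0.
have [Cx Cx0 hCx] : exists2 Cx : R, 0 <= Cx &
    forall a k, lheight h (x s0 a k) (Cx * k.+1%:R).
  have /choice[C hC] : forall a, exists C : R, forall k, lheight h (x s0 a k) (C * k.+1%:R).
    by move=> a; case: (xg s0 a).
  have C0 a : 0 <= C a by have := lheight_ge0 (hC a 0%N); rewrite mulr1.
  exists (\sum_a C a) => [|a k]; first by rewrite sumr_ge0.
  apply: (lheightW _ (hC a k)); rewrite ler_wpM2r // (bigD1 a) //= lerDl.
  by rewrite sumr_ge0.
pose mh := min_height R F; pose nb : R := #|{: box p}|%:R.
have mh0 : 0 <= mh by apply: min_height_ge0.
pose ld := - ln delta; have ld0 : 0 <= ld by rewrite oppr_ge0 ln_le0.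
(* W collects what grows at most linearly in k: delta^(-p(s+1)) and the norm of e_k in the upper
   bound, the heights of the coefficients and the constant [mh] in the lower one. *)
pose W := ld * (p * s.+1)%:R + B + kap * (nb * Cx) + kap * mh.
have th0 : exists N1, forall k, (N1 <= k)%N -> theta (x s0) k = 0.
  have [n1 h1] := orb_decay; have [n4 h4] := decay_small delta_gt0.
  have [n5 h5] := linear_lt_pow W rho_gt1.
  exists (maxn (maxn n1 n2) (maxn (maxn n3 n4) (maxn n5 N0))) => k.
  rewrite !geq_max => /andP[/andP[k1 k2] /andP[/andP[k3 k4] /andP[k5 k0]]].
  apply/eqP/negPn/negP => nz.
  pose X (i : 'I_n + 'I_N) := match i with inl j => orb k j | inr i => t k i end.
  pose sX (i : 'I_n + 'I_N) := match i with inl j => Ch * rho ^+ k | inr i => Ct * rho ^+ k end.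
  pose ex (a : box p) (i : 'I_n + 'I_N) : nat := match i with inl j => a.1 j | inr i => a.2 i end.
  have hX i : lheight h (X i) (sX i) by case: i => i /=.
  have hex a i : (ex a i <= p.-1)%N.
    by case: i => i; rewrite -ltnS prednK // /ex ltn_ord.
  have := lheight_box_sum hX (fun a => hCx a k) hex.
  have -> : \sum_j x s0 j k * \prod_i X i ^+ ex j i = theta (x s0) k.
    by apply: eq_bigr => a _; rewrite big_sumType.
  rewrite big_sumType /= !sumr_const !card_ord prednK // -/nb -/mh => hth.
  have low := hkap _ _ hth nz.
  have up := ps_val_order_le v_abs v_complete delta_gt0 _ (h1 k k1) (e_ord k k0) (hB k k2).
  have {}up := up _; rewrite expR_ge0 (h4 k k4) h3 // in up.
  have {up low} := le_trans low (up isT).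
  have -> : (expR (- (c0 * rho ^+ k)) / delta) ^+ (p * s.+1) =
      expR ((p * s.+1)%:R * (ld - c0 * rho ^+ k)).
    by rewrite expRM_natl /ld -opprD -{1}[delta]lnK ?posrE // -expRN -expRD opprD addrC.
  rewrite -expRD ler_expR; apply/negP; rewrite -ltNge.
  set r := rho ^+ k; set q : R := k.+1%:R.
  have r0 : 0 < r by rewrite exprn_gt0 // (lt_trans ltr01).
  have q1 : 1 <= q by rewrite ler1n.
  have p1 : 1 <= p%:R :> R by rewrite ler1n.
  have Wq : W * q < r := h5 k k5.
  rewrite -[_ *+ n]mulr_natl -[_ *+ N]mulr_natl.
  have g1 : 0 <= (c0 * s.+1%:R - kap * Cs - 1) * (p%:R * r).
    by rewrite mulr_ge0 ?mulr_ge0 ?ler0n ?(ltW r0) // -addrA -opprD subr_ge0.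
  have g2 : 0 <= (p%:R - 1) * r by rewrite mulr_ge0 ?subr_ge0 // ltW.
  have g3 : 0 <= ld * (p%:R * s.+1%:R) * (q - 1).
    by rewrite !mulr_ge0 ?ler0n ?subr_ge0.
  have g4 : 0 <= kap * mh * (q - 1) by rewrite !mulr_ge0 ?subr_ge0 // ltW.
  move: Wq g1 g3; rewrite /W /Cs natrM.
  move: g2 g4.
  move: (p%:R : R) (s.+1%:R : R) (n%:R : R) (N%:R : R) => p' s' n' N'.
  move=> *; lra.
(* Since theta vanishes for large k, [gam] vanishes along the orbit and hence identically, so the
   coefficients x s0 are zero for every k, against the choice of s0. *)
case: xa1; exists 0%N => k _; apply: (gam_eq0 (p := p)).
have [ss ss0 hss] := gam_exp (xg s0).
apply: (vanishing_theorem v_abs v_complete Omega_det Omega_unity orb_small orb_generic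
  delta_gt0 delta_le1 ss0 hss).
  by move=> k'; apply: gam_summable.
have [N1 h1] := th0; have [N2 h2] := gam_val (x s0).
exists (maxn N1 N2) => k'; rewrite geq_max => /andP[k1 k2].
by have [c ->] := h2 k' k2; rewrite h1 // mulr0.
Qed.

End CoreArgument.

(** * Functional equations at alpha *)

Definition map_frac_rmorphism (R S : idomainType) (h : {rmorphism R -> S})
    (h_inj : injective h) : {rmorphism {fraction R} -> {fraction S}} :=
  HB.pack (map_frac h)
    (GRing.isZmodMorphism.Build _ _ (map_frac h) (map_frac_zmod h_inj))
    (GRing.isMonoidMorphism.Build _ _ (map_frac h) (map_frac_monoid h_inj)).

Section IteratedEquations.
Variables (R : realType) (L : fieldType) (v : L -> R).
Hypothesis v_abs : is_absval v.
Hypothesis v_complete : abs_complete v.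
Variables (n : nat) (Omega : 'M[nat]_n).
Hypothesis Omega_det : \det (mx_rat Omega) != 0.
Variable alpha : 'I_n -> L.
Let orb k := iter k (vec_act Omega) alpha.
Implicit Types (f g q : powser n L).

Notation phi := (@subst_ps n L Omega).
Notation cst := (@ps_cst n L).
Notation E := {fraction (powser n L)}.

Lemma iter_subst_val r (z : 'I_n -> L) (y : 'I_n -> R) q :
    (forall j, v (iter r (vec_act Omega) z j) <= y j) -> summable v y q ->
  summable v (v \o z) (iter r phi q) /\
  ps_val v (iter r phi q) z = ps_val v q (iter r (vec_act Omega) z).
Proof.
elim: r z => [|r ih] z zy sq.
  by split=> //; have [B hB] := sq; exists B; apply: (norm_leW v_abs _ hB) => j;
     rewrite /= absv_ge0 // zy.
rewrite iterSr in zy *; have [s1 e1] := ih (vec_act Omega z) zy sq.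
rewrite iterS -[iter r _ (vec_act _ _)]/(iter r (vec_act Omega) (vec_act Omega z)) -e1.
split; first by apply: (summable_subst v_abs Omega_det _ s1).
exact: (ps_val_subst v_abs v_complete Omega_det _ s1).
Qed.

(** A common notion of value at alpha for series and rational functions, independent of the
    representation by [frac_value_uniq]. *)
Definition frac_value (y : E) (s : L) := exists a b : powser n L,
  [/\ summable v (v \o alpha) a, summable v (v \o alpha) b, ps_val v b alpha != 0,
      y = a%:F / b%:F & s = ps_val v a alpha / ps_val v b alpha].

Let le_alpha j : v (alpha j) <= (v \o alpha) j. Proof. exact: lexx. Qed.
Let alpha0 j : 0 <= (v \o alpha) j. Proof. exact: absv_ge0. Qed.
Let valM := ps_valM v_abs v_complete le_alpha.
Let valD := ps_valD v_abs v_complete le_alpha.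

Let neq0_val b : ps_val v b alpha != 0 -> b%:F != 0 :> E.
Proof.
rewrite tofrac_eq0; apply: contraNneq => ->.
by rewrite -(rmorph0 cst) (ps_val_cst v_abs v_complete le_alpha).
Qed.

Lemma frac_value_uniq y s t : frac_value y s -> frac_value y t -> s = t.
Proof.
move=> [a [b [sa sb b0 -> ->]]] [c [d [sc sd d0 e ->]]]; apply/eqP.
rewrite eqr_div // -!valM //.
by move/eqP: e; rewrite eqr_div ?neq0_val // -!tofracM tofrac_eq => /eqP ->.
Qed.

Lemma frac_value_ps a : summable v (v \o alpha) a -> frac_value a%:F (ps_val v a alpha).
Proof.
move=> sa; exists a, 1; split=> //; rewrite -?(rmorph1 cst).
- exact: (summable_psc v_abs alpha0).
- by rewrite (ps_val_cst v_abs v_complete le_alpha) oner_eq0.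
- by rewrite rmorph1 tofrac1 divr1.
- by rewrite (ps_val_cst v_abs v_complete le_alpha) divr1.
Qed.

Lemma frac_value_cst c : frac_value (cst c)%:F c.
Proof.
rewrite -{2}(ps_val_cst v_abs v_complete le_alpha c); apply: frac_value_ps.
exact: (summable_psc v_abs alpha0).
Qed.

Lemma frac_valueM y z s t : frac_value y s -> frac_value z t -> frac_value (y * z) (s * t).
Proof.
move=> [a [b [sa sb b0 -> ->]]] [c [d [sc sd d0 -> ->]]].
exists (a * c), (b * d); split; [exact: summableM|exact: summableM| | |].
- by rewrite valM // mulf_neq0.
- by rewrite !tofracM mulf_div.
- by rewrite !valM // mulf_div.
Qed.

Lemma frac_valueD y z s t : frac_value y s -> frac_value z t -> frac_value (y + z) (s + t).
Proof.
move=> [a [b [sa sb b0 -> ->]]] [c [d [sc sd d0 -> ->]]].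
have s1 : summable v (v \o alpha) (a * d) by apply: summableM.
have s2 : summable v (v \o alpha) (c * b) by apply: summableM.
exists (a * d + c * b), (b * d); split; [exact: summableD|exact: summableM| | |].
- by rewrite valM // mulf_neq0.
- by rewrite tofracD !tofracM addf_div ?neq0_val.
- by rewrite valD // !valM // addf_div.
Qed.

Lemma frac_value_sum (I : Type) (r : seq I) (y : I -> E) (s : I -> L) :
  (forall i, frac_value (y i) (s i)) ->
  frac_value (\sum_(i <- r) y i) (\sum_(i <- r) s i).
Proof.
move=> hy; elim/big_rec2: _ => [|i z t _ ih]; last exact: frac_valueD.
by have := frac_value_cst 0; rewrite rmorph0 tofrac0.
Qed.

Lemma frac_value_prod (I : Type) (r : seq I) (y : I -> E) (s : I -> L) :
  (forall i, frac_value (y i) (s i)) ->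
  frac_value (\prod_(i <- r) y i) (\prod_(i <- r) s i).
Proof.
move=> hy; elim/big_rec2: _ => [|i z t _ ih]; last exact: frac_valueM.
by have := frac_value_cst 1; rewrite rmorph1 tofrac1.
Qed.

Let phi_inj := subst_ps_inj (R := L) Omega_det.

Definition subst_frac := map_frac_rmorphism (phi_inj : injective (subst_rmorphism L Omega_det)).

Notation Phi := subst_frac.

Lemma subst_frac_ps a : Phi a%:F = (phi a)%:F.
Proof. exact: (@map_frac_tofrac _ _ (subst_rmorphism L Omega_det) phi_inj). Qed.

Lemma iter_subst_frac_ps r a : iter r Phi a%:F = (iter r phi a)%:F.
Proof. by elim: r => // r ih; rewrite !iterS ih subst_frac_ps. Qed.

Lemma iter_subst_fracM r y z : iter r Phi (y * z) = iter r Phi y * iter r Phi z.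
Proof. by elim: r => // r ih; rewrite !iterS ih rmorphM. Qed.

Lemma iter_subst_fracD r y z : iter r Phi (y + z) = iter r Phi y + iter r Phi z.
Proof. by elim: r => // r ih; rewrite !iterS ih rmorphD. Qed.

Lemma iter_subst_frac_sum r (I : Type) (s : seq I) (y : I -> E) :
  iter r Phi (\sum_(i <- s) y i) = \sum_(i <- s) iter r Phi (y i).
Proof. by elim: r => // r ih; rewrite iterS ih rmorph_sum. Qed.

Lemma iter_subst_cst r c : iter r phi (cst c) = cst c.
Proof. by elim: r => // r ih; rewrite iterS ih subst_cst. Qed.

Lemma ratfun_frac_value r (N D : {mpoly L[n]}) : mmap idfun (orb r) D != 0 ->
  frac_value (iter r Phi ((poly_ps N)%:F / (poly_ps D)%:F))
    (mmap idfun (orb r) N / mmap idfun (orb r) D).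
Proof.
move=> D0; have sp (q : {mpoly L[n]}) : summable v (v \o orb r) (poly_ps q).
  by apply: summable_poly => // j; apply: absv_ge0.
have le j : v (orb r j) <= (v \o orb r) j by apply: lexx.
have [sN eN] := iter_subst_val le (sp N); have [sD eD] := iter_subst_val le (sp D).
rewrite (ps_val_poly v_abs v_complete le) in eN.
rewrite (ps_val_poly v_abs v_complete le) in eD.
have PD0 : (poly_ps D)%:F != 0 :> E.
  rewrite tofrac_eq0 -(rmorph0 (@poly_ps n L)) (inj_eq (@poly_ps_inj n L)).
  by apply: contraNneq D0 => ->; rewrite rmorph0.
exists (iter r phi (poly_ps N)), (iter r phi (poly_ps D)); split=> //.
- by rewrite eD.
- have iD0 : (iter r phi (poly_ps D))%:F != 0 :> E by apply: neq0_val; rewrite eD.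
  by apply: (mulIf iD0); rewrite divfK // -!iter_subst_frac_ps -iter_subst_fracM divfK.
- by rewrite eN eD.
Qed.

Section Equations.
Variables (x : 'I_n -> R) (k : nat).
Hypothesis orb_x : forall j, v (orb k j) <= x j.

(** The equation is iterated formally in the field of fractions of series and evaluated only once,
    at alpha: the intermediate points Omega^r alpha may lie outside the domain of convergence of
    f. *)
Lemma additive_iterated_value l (A : 'M[L]_l) (f : 'I_l -> powser n L)
    (b : 'I_l -> E) (y : nat -> 'I_l -> L) :
    (forall i, (f i)%:F = \sum_j (cst (A i j))%:F * (phi (f j))%:F + b i) ->
    (forall r i, frac_value (iter r Phi (b i)) (y r i)) ->
    (forall i, summable v x (f i)) -> (forall i, summable v (v \o alpha) (f i)) ->
  forall i, ps_val v (f i) alpha = \sum_j (A ^+ k) i j * ps_val v (f j) (orb k) +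
    \sum_(0 <= r < k) \sum_j (A ^+ r) i j * y r j.
Proof.
move=> ef hy sx sa i.
have iterE r : (f i)%:F = \sum_j (cst ((A ^+ r) i j))%:F * (iter r phi (f j))%:F +
    \sum_(0 <= s < r) \sum_j (cst ((A ^+ s) i j))%:F * iter s Phi (b j) :> E.
  elim: r => [|r ih].
    rewrite big_nil addr0 (bigD1 i) //= big1 ?addr0 => [|j ji].
      by rewrite expr0 mxE eqxx rmorph1 tofrac1 mul1r.
    by rewrite expr0 mxE eq_sym (negPf ji) rmorph0 tofrac0 mul0r.
  have st j : (iter r phi (f j))%:F =
      \sum_h (cst (A j h))%:F * (iter r.+1 phi (f h))%:F + iter r Phi (b j).
    rewrite -iter_subst_frac_ps ef iter_subst_fracD iter_subst_frac_sum.
    congr (_ + _); apply: eq_bigr => h _.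
    by rewrite iter_subst_fracM !iter_subst_frac_ps iter_subst_cst iterSr.
  rewrite big_nat_recr // addrA addrAC {1}ih; congr (_ + _).
  transitivity (\sum_j (cst ((A ^+ r) i j))%:F * (\sum_h (cst (A j h))%:F *
      (iter r.+1 phi (f h))%:F + iter r Phi (b j))).
    by apply: eq_bigr => j _; rewrite st.
  under eq_bigr => j _ do rewrite mulrDr mulr_sumr.
  rewrite big_split /=; congr (_ + _); rewrite exchange_big /=; apply: eq_bigr => h _.
  rewrite exprSr mxE !rmorph_sum /= mulr_suml; apply: eq_bigr => j _.
  by rewrite mulrA (rmorphM (@ps_cst n L)) tofracM.
apply: (frac_value_uniq (frac_value_ps (sa i))); rewrite (iterE k).
apply: frac_valueD.
  apply: frac_value_sum => j; apply: frac_valueM; first exact: frac_value_cst.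
  have [s1 e1] := iter_subst_val orb_x (sx j).
  by rewrite -[ps_val v (f j) (orb k)]e1; apply: frac_value_ps.
apply: frac_value_sum => r; apply: frac_value_sum => j.
by apply: frac_valueM => //; apply: frac_value_cst.
Qed.

Lemma multiplicative_iterated_value (g : powser n L) (e : E) (y : nat -> L) :
    g%:F = e * (phi g)%:F -> (forall r, frac_value (iter r Phi e) (y r)) ->
    summable v x g -> summable v (v \o alpha) g ->
  ps_val v g alpha = (\prod_(0 <= r < k) y r) * ps_val v g (orb k).
Proof.
move=> eg hy sx sa.
have iterE r : g%:F = (\prod_(0 <= s < r) iter s Phi e) * (iter r phi g)%:F.
  elim: r => [|r ih]; first by rewrite big_nil mul1r.
  rewrite big_nat_recr //= -mulrA -iterS iterSr -iter_subst_frac_ps -iter_subst_fracM.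
  by rewrite -eg iter_subst_frac_ps.
apply: (frac_value_uniq (frac_value_ps sa)); rewrite (iterE k).
apply: frac_valueM; first by apply: frac_value_prod => r; apply: hy.
have [s1 e1] := iter_subst_val orb_x sx.
by rewrite -[ps_val v g (orb k)]e1; apply: frac_value_ps.
Qed.

End Equations.
End IteratedEquations.

(** * Completions of the algebraic numbers and conditions on Omega *)

(** The limit is the supremum of the numbers that are eventually below u. *)
Lemma normr_complete (R : realType) : abs_complete (fun x : R => `|x|).
Proof.
move=> u cau.
pose S := [set x : R | exists N, forall i, (N <= i)%N -> x <= u i]%classic.
have near (e : R) : 0 < e -> exists N, forall i j, (N <= i)%N -> (N <= j)%N -> u j - e < u i < u j + e.
  move=> e0; have [N hN] := cau e e0; exists N => i j iN jN.
  by have := hN i j iN jN; rewrite ltr_norml; lra.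
have supS : has_sup S.
  have [N hN] := near 1 ltr01; split.
    by exists (u N - 1), N => i iN; have /andP[/ltW] := hN i N iN (leqnn _).
  exists (u N + 1) => x [M hM]; have /andP[_ /ltW] := hN _ N (leq_maxl N M) (leqnn _).
  by apply: le_trans; apply: hM; apply: leq_maxr.
exists (sup S) => e e0; have [N hN] := near (e / 2) (divr_gt0 e0 (ltr0n _ 2)).
exists N => i iN; apply: (@le_lt_trans _ _ (e / 2)); last by rewrite ltr_pdivrMr // ltr_pMr // ltr1n.
have lo : u i - e / 2 <= sup S.
  by apply: sup_upper_bound => //; exists N => j jN; have /andP[/ltW] := hN j i jN iN.
have hi : sup S <= u i + e / 2.
  apply: ge_sup; first by case: supS.
  move=> x [M hM]; have /andP[_ /ltW] := hN _ i (leq_maxl N M) iN.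
  by apply: le_trans; apply: hM; apply: leq_maxr.
by rewrite ler_norml; lra.
Qed.

Lemma normc_absval (R : realType) : is_absval (fun z : R[i] => Normc.normc z).
Proof.
split=> [[a b]|z|z y|z y]; last 2 first.
- exact: Normc.normcM.
- exact: le_normcD.
- by rewrite /= sqrtr_ge0.
- apply/eqP/eqP => [/Normc.eq0_normc|->] //; exact: Normc.normc0.
Qed.

Lemma normc_bounds (R : realType) (a b : R) :
  [/\ `|a| <= Normc.normc (Complex a b), `|b| <= Normc.normc (Complex a b) &
      Normc.normc (Complex a b) <= `|a| + `|b|].
Proof.
have sq (x y : R) : 0 <= y -> x ^+ 2 <= y -> `|x| <= Num.sqrt y.
  by move=> y0 le; rewrite -sqrtr_sqr ler_sqrt.
split=> /=.
- by apply: sq; rewrite ?addr_ge0 ?sqr_ge0 // lerDl sqr_ge0.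
- by apply: sq; rewrite ?addr_ge0 ?sqr_ge0 // lerDr sqr_ge0.
- rewrite -[leRHS]ger0_norm ?addr_ge0 // -sqrtr_sqr ler_sqrt ?sqr_ge0 //.
  by rewrite sqrrD !real_normK ?num_real // lerD2r lerDl mulrn_wge0 // mulr_ge0.
Qed.

Lemma normc_complete (R : realType) : abs_complete (fun z : R[i] => Normc.normc z).
Proof.
move=> u cau.
have [x hx] : exists x : R, forall e : R, 0 < e -> exists N, forall i, (N <= i)%N -> `|complex.Re (u i) - x| < e.
  apply: (@normr_complete R) => e /cau[N hN]; exists N => i j iN jN.
  apply: le_lt_trans (hN i j iN jN); case: (u i) (u j) => [a b] [c d].
  by have [] := normc_bounds (a - c) (b - d).
have [y hy] : exists x : R, forall e : R, 0 < e -> exists N, forall i, (N <= i)%N -> `|complex.Im (u i) - x| < e.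
  apply: (@normr_complete R) => e /cau[N hN]; exists N => i j iN jN.
  apply: le_lt_trans (hN i j iN jN); case: (u i) (u j) => [a b] [c d].
  by have [] := normc_bounds (a - c) (b - d).
exists (Complex x y) => e e0; have e2 : 0 < e / 2 by apply: divr_gt0.
have [N hN] := hx _ e2; have [M hM] := hy _ e2; exists (maxn N M) => i.
rewrite geq_max => /andP[/hN ha /hM hb]; rewrite [e]splitr.
apply: le_lt_trans (ltrD ha hb); case: (u i) => a b.
by have [] := normc_bounds (a - x) (b - y).
Qed.

Section Models.
Variables (R : realType) (pl : place) (M : Cp_model R pl).
Notation v := (@Cp_abs R pl M).

Lemma Cp_absval : is_absval v.
Proof. by case: M => [|p pp T] /=; [exact: normc_absval | case: (Cpadic_completion T)]. Qed.

Lemma Cp_complete : abs_complete v.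
Proof. by case: M => [|p pp T] /=; [exact: normc_complete | case: (Cpadic_completion T)]. Qed.

Lemma normc_nat d : Normc.normc (d%:R : R[i]) = d%:R.
Proof. by rewrite (normcMn 1) Normc.normc1. Qed.

Lemma Cpadic_abs_nat p (T : padic_tower R p) (d : nat) :
  Cpadic_abs (d%:R : Cpadic T) = padic_abs R p d%:R.
Proof.
have [_ e1 _ _] := Cpadic_completion T; have [_ e2 _ _] := Qp_completion T.
by rewrite -e2 -Qpbar_extends -e1 !rmorph_nat.
Qed.

Lemma padic_abs_nat p d : (0 < d)%N -> padic_abs R p d%:R = (p%:R ^+ logn p d)^-1.
Proof.
move=> d0; rewrite /padic_abs pnatr_eq0 gtn_eqF //.
have -> : (d%:R : rat) = (d : int)%:Q by [].
by rewrite numq_int denq_int /= logn1 expr0 mul1r.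
Qed.

(** In the p-adic case |d| is the inverse of the power of p dividing d, which is at most d. *)
Lemma Cp_abs_nat d : (0 < d)%N -> (d%:R : R)^-1 <= v d%:R.
Proof.
case: M => [|p pp T] d0 /=.
  by rewrite normc_nat (@le_trans _ _ 1) ?invf_le1 ?ltr0n // ler1n.
have p0 : 0 < p%:R ^+ logn p d :> R by rewrite exprn_gt0 // ltr0n prime_gt0.
rewrite Cpadic_abs_nat padic_abs_nat // lef_pV2 ?posrE ?ltr0n //.
by rewrite -natrX ler_nat dvdn_leq // pfactor_dvdnn.
Qed.

Lemma Cp_abs_nontrivial : exists2 q, (0 < q)%N & v q%:R != 1.
Proof.
case: M => [|p pp T]; first by exists 2 => //; rewrite [Cp_abs _]normc_nat pnatr_eq1.
exists p; rewrite ?prime_gt0 //= Cpadic_abs_nat padic_abs_nat ?prime_gt0 //.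
by rewrite logn_prime // eqxx expr1 invr_eq1 pnatr_eq1; case: p pp {T} => [|[]].
Qed.

Variable iota : {rmorphism algC -> Cp M}.

Let vX := absvX Cp_absval.

(** Take a root of high order of some integer q or of 1/q, so that its absolute value t satisfies 1
    < t < b / a. Consecutive integral powers of t cannot jump over the interval from a to b. *)
Lemma Cp_abs_dense (a b : R) : 0 < a -> a < b -> exists y, a < v y < b.
Proof.
move=> a0 ab; have [q q0 q1] := Cp_abs_nontrivial.
have vq0 : 0 < v q%:R by apply: lt_le_trans (Cp_abs_nat q0); rewrite invr_gt0 ltr0n.
have [c [T1 cT]] : exists c : algC, 1 < v (iota c) /\ c != 0.
  move: q1; rewrite neq_lt => /orP[lt|gt].
    exists q%:R^-1; rewrite fmorphV rmorph_nat invr_eq0 pnatr_eq0 -lt0n q0.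
    by rewrite (absvV Cp_absval) invf_gt1.
  by exists q%:R; rewrite rmorph_nat pnatr_eq0 -lt0n q0.
set T := v (iota c) in T1.
have ba : 1 < b / a by rewrite ltr_pdivlMr // mul1r.
have [N hN] : exists N, T < (b / a) ^+ N.+1.
  have [C C0 hC] := linear_le_pow ba.
  have [k hk] : exists k : nat, C * T < k%:R.
    by exists (Num.bound (C * T)); apply: archi_boundP; rewrite mulr_ge0 // ltW // (lt_trans ltr01).
  exists k; rewrite -(ltr_pM2l C0) (lt_le_trans hk) //.
  apply: le_trans (_ : k.+1%:R <= _); first by rewrite ler_nat.
  apply: le_trans (hC k) _; rewrite ler_pM2l // exprS ler_peMl ?(ltW ba) //.
  by rewrite exprn_ge0 // ltW // (lt_trans ltr01).
set t := v (iota (N.+1.-root c)).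
have tN : t ^+ N.+1 = T by rewrite /t /T -vX -rmorphXn /= rootCK.
have t0 : 0 <= t by apply: absv_ge0 Cp_absval _.
have t1 : 1 < t.
  by rewrite -(@expr_gt1 _ N.+1) ?tN //.
have tba : t < b / a by rewrite -(@ltr_pXn2r _ N.+1) ?tN // nnegrE ?(ltW (lt_trans ltr01 ba)).
have [D D0 hD] := linear_le_pow t1.
have big (x : R) : exists k, x < t ^+ k.
  have [k hk] : exists k : nat, D * `|x| < k%:R.
    by exists (Num.bound (D * `|x|)); apply: archi_boundP; rewrite mulr_ge0 // ltW.
  exists k; apply: le_lt_trans (ler_norm x) _.
  rewrite -(ltr_pM2l D0) (lt_le_trans hk) // (le_trans _ (hD k)) //.
  by rewrite ler_nat.
have tp0 : 0 < t by apply: lt_trans t1.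
have [K hK] := big a^-1.
have ex : exists k, a < t ^+ k / t ^+ K.
  have [k hk] := big (a * t ^+ K); exists k.
  by rewrite ltr_pdivlMr // exprn_gt0.
case: (ex_minnP ex) => k hk kmin.
have k0 : (0 < k)%N.
  rewrite lt0n; apply: contraTneq hk => ->; rewrite expr0 mul1r -leNgt.
  by rewrite -[leRHS]invrK lef_pV2 ?posrE ?exprn_gt0 ?invr_gt0 // ltW.
exists (iota (N.+1.-root c) ^+ k / iota (N.+1.-root c) ^+ K).
rewrite (absvM Cp_absval) (absvV Cp_absval) !vX -/t hk /=.
case: k k0 {hk} kmin => // k _ kmin.
have le : t ^+ k / t ^+ K <= a by rewrite leNgt; apply/negP => /kmin; rewrite ltnn.
rewrite exprS -mulrA; apply: le_lt_trans (_ : t * a < b); first by rewrite ler_pM2l.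
by rewrite -ltr_pdivlMr.
Qed.

End Models.

Lemma map_mx_exp (S T : pzRingType) (f : {rmorphism S -> T}) n (X : 'M[S]_n) k :
  map_mx f (X ^+ k) = map_mx f X ^+ k.
Proof.
elim: k => [|k ih]; first by rewrite !expr0 -[1]/(1%:M) map_mx1.
by rewrite !exprS -ih -[X * _]/(X *m _) map_mxM.
Qed.

(** Multiply d by the factors one at a time: the vector reached before the factor that kills it is
    an eigenvector. *)
Lemma eigenvalue_of_prod (F : fieldType) n (X : 'M[F]_n) (s : seq F) (d : 'rV_n) :
  d != 0 -> d *m \big[mulmx/1%:M]_(z <- s) (X - z%:M) = 0 ->
  exists2 z, z \in s & eigenvalue X z.
Proof.
elim: s d => [|z s ih] d d0; first by rewrite big_nil mulmx1 => /eqP; rewrite (negPf d0).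
rewrite big_cons mulmxA; have [e _|d1 /(ih _ d1)[w ws ew]] := eqVneq (d *m (X - z%:M)) 0.
  exists z; rewrite ?mem_head //; apply/eigenvalueP; exists d => //.
  by apply/eqP; rewrite -subr_eq0 -mul_mx_scalar -mulmxBr e.
by exists w; rewrite // inE ws orbT.
Qed.

Lemma closed_eigenvalue (C : closedFieldType) n (X : 'M[C]_n) (p : {poly C}) (d : 'rV_n) :
  (0 < n)%N -> p != 0 -> d != 0 -> d *m \sum_(i < size p) p`_i *: X ^+ i = 0 ->
  exists2 z, root p z & eigenvalue X z.
Proof.
case: n X d => // n X d _ p0 d0; have <- : horner_mx X p = \sum_(i < size p) p`_i *: X ^+ i.
  by rewrite -{1}[p]coefK poly_def linear_sum; apply: eq_bigr => i _; rewrite linearZ rmorphXn /= horner_mx_X.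
have [s es] := closed_field_poly_normal p; rewrite {1}es linearZ /= rmorph_prod -scalemxAr /=.
move/eqP; rewrite scaler_eq0 lead_coef_eq0 (negPf p0) /= => /eqP.
under eq_bigr => z _ do rewrite rmorphB /= horner_mx_X horner_mx_C.
move=> /(eigenvalue_of_prod d0)[z zs ez]; exists z => //.
by rewrite es rootZ ?lead_coef_eq0 // root_prod_XsubC.
Qed.

Section OmegaConditions.
Variables (R : realType) (n : nat) (Omega : 'M[nat]_n).
Hypothesis n_gt0 : (0 < n)%N.
Hypothesis OmegaI : cond_I R Omega.
Notation rho := (spectral_radius R Omega).

(** A nonzero vector fixed by Omega^s is annihilated by Omega^s - 1, and factoring X^s - 1 over C
    produces an eigenvalue that is a root of unity. *)
Lemma condI_unity s (d : 'rV[rat]_n) : (0 < s)%N -> d *m mx_rat Omega ^+ s = d -> d = 0.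
Proof.
move=> s0 ed; apply/eqP; apply: contraT => d0; case: OmegaI => _ eig.
pose X : 'M[R[i]]_n := map_mx (fun k => k%:R) Omega.
have eX : X = map_mx ratr (mx_rat Omega).
  by apply/matrixP => i j; rewrite !mxE ratr_nat.
pose d' : 'rV[R[i]]_n := map_mx ratr d.
have d'0 : d' != 0 by rewrite map_mx_eq0.
have [|z] := @closed_eigenvalue _ n X ('X^s - 1) d' n_gt0 (monic_neq0 (monicXnsubC 1 s0)) d'0.
  case: s s0 ed => // s _ ed.
  rewrite size_XnsubC // big_ord_recl big_ord_recr /=.
  rewrite big1 => [|i _]; last first.
    by rewrite coefB coefXn coefC /= /bump /= add1n eqSS (ltn_eqF (ltn_ord i)) subrr scale0r.
  rewrite !coefB !coefXn !coefC /= /bump /= add1n eqxx sub0r subr0 add0r scale1r scaleN1r expr0 mulmxDr mulmxN mulmx1.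
  by rewrite eX -map_mx_exp -map_mxM ed addNr.
rewrite rootE !hornerE subr_eq0 => /eqP z1 ez.
by case/eqP: (eig _ ez s s0).
Qed.

Lemma mx_rat_exp k : mx_rat (Omega ^+ k) = mx_rat Omega ^+ k.
Proof.
elim: k => [|k ih]; first by apply/matrixP => i j; rewrite !mxE; case: (i == j).
rewrite !exprS -ih; apply/matrixP => i j; rewrite !mxE natr_sum.
by apply: eq_bigr => h _; rewrite !mxE natrM.
Qed.

(** If the powers agreed, Omega^(b - a) would fix the nonzero vector (1, ..., 1) Omega^a. *)
Lemma Omega_exp_inj a b : (a < b)%N -> Omega ^+ a != Omega ^+ b.
Proof.
move=> ab; apply/eqP => e; have [det _] := OmegaI.
have u : mx_rat Omega ^+ a \in unitmx.
  elim: a {ab e} => [|a ih]; first by rewrite expr0 unitmx1.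
  by rewrite exprS -[_ * _]/(_ *m _) unitmx_mul ih unitmxE unitfE det.
pose d : 'rV[rat]_n := const_mx 1.
have d0 : d != 0.
  by apply/eqP => /matrixP/(_ 0 (Ordinal n_gt0))/eqP; rewrite !mxE oner_eq0.
have := @condI_unity (b - a) (d *m mx_rat Omega ^+ a); rewrite subn_gt0 => /(_ ab).
rewrite -mulmxA -[_ *m mx_rat Omega ^+ (b - a)]exprD subnKC ?(ltnW ab) // -!mx_rat_exp e => /(_ erefl).
rewrite -e mx_rat_exp => /(congr1 (mulmx^~ (invmx (mx_rat Omega ^+ a)))).
by rewrite mulmxK // mul0mx => /eqP; rewrite (negPf d0).
Qed.

Lemma spectral_radius_ge0 : 0 <= rho.
Proof.
rewrite /spectral_radius; set S := (S in sup S).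
have [h|h] := pselect (has_sup S); last by rewrite sup_out.
have [[x Sx] _] := h; apply: (@le_trans _ _ x); last exact: sup_upper_bound.
by case: Sx => a _ <-; exact: absv_ge0 (normc_absval R) _.
Qed.

Hypothesis OmegaII : cond_II R Omega.

(** If rho <= 1, then (II) bounds the entries of the powers of Omega. These being natural numbers,
    two powers would coincide by the pigeonhole principle. *)
Lemma spectral_radius_gt1 : 1 < rho.
Proof.
rewrite ltNge; apply/negP => rho1.
have [B [N hB]] : exists B N, forall k, (N <= k)%N -> forall i j, ((Omega ^+ k) i j <= B)%N.
  have /choice[c hc] : forall ij : 'I_n * 'I_n, exists cN : R * nat, forall k, (cN.2 <= k)%N ->
      ((Omega ^+ k) ij.1 ij.2)%:R <= cN.1 * rho ^+ k.
    by move=> [i j]; have [c [N hN]] := OmegaII i j; exists (c, N).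
  exists (\max_ij Num.bound `|(c ij).1|)%N, (\max_ij (c ij).2)%N => k kN i j.
  have := hc (i, j) k (leq_trans (leq_bigmax (i, j)) kN) => /= le.
  apply: leq_trans (leq_bigmax (i, j)); rewrite -(ler_nat R) (le_trans le) //.
  apply: le_trans (ler_norm _) _; rewrite normrM.
  rewrite [`|_ ^+ k|]ger0_norm ?exprn_ge0 ?spectral_radius_ge0 //.
  apply: le_trans (ltW (archi_boundP (normr_ge0 (c (i, j)).1))).
  by rewrite ler_piMr // exprn_ile1 // spectral_radius_ge0.
pose T := {ffun 'I_n * 'I_n -> 'I_B.+1}.
pose F (k : 'I_#|T|.+1) : T := [ffun ij => inord ((Omega ^+ (N + k)) ij.1 ij.2)].
have /injectivePn[a [b ab eF]] : ~~ injectiveb F.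
  by apply/negP => /injectiveP/leq_card; rewrite card_ord ltnn.
have eO : Omega ^+ (N + a) = Omega ^+ (N + b).
  apply/matrixP => i j; move/ffunP/(_ (i, j)): eF; rewrite !ffunE /= => /(congr1 (@nat_of_ord _)).
  by rewrite !inordK // ltnS hB // leq_addr.
wlog lt : a b ab eO {eF} / (a < b)%N.
  by move=> h; case: (ltngtP a b) => [lt|gt|/val_inj e]; [apply: (h a b)|apply: (h b a); rewrite 1?eq_sym|rewrite e eqxx in ab].
by have := @Omega_exp_inj (N + a) (N + b); rewrite ltn_add2l eO eqxx => /(_ lt).
Qed.

(** As rho^k >= 1, the finitely many exceptional k of (II) are absorbed into the constant. *)
Lemma condII_uniform : exists2 C, 0 <= C & forall k i j, ((Omega ^+ k) i j)%:R <= C * rho ^+ k.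
Proof.
have r1 := ltW spectral_radius_gt1; have r0 := spectral_radius_ge0.
have /choice[C hC] : forall ij : 'I_n * 'I_n, exists C, 0 <= C /\
    forall k, ((Omega ^+ k) ij.1 ij.2)%:R <= C * rho ^+ k.
  move=> [i j] /=; have [c [N hN]] := OmegaII i j.
  exists (`|c| + \sum_(k < N) ((Omega ^+ k) i j)%:R); split.
    by rewrite addr_ge0 // sumr_ge0.
  move=> k; have rk : 0 <= rho ^+ k by apply: exprn_ge0.
  have [kN|kN] := leqP N k.
    apply: le_trans (hN k kN) _; rewrite ler_wpM2r //.
    by rewrite (le_trans (ler_norm _)) // lerDl sumr_ge0.
  apply: (@le_trans _ _ (\sum_(k < N) ((Omega ^+ k) i j)%:R)).
    by rewrite (bigD1 (Ordinal kN)) //= lerDl sumr_ge0.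
  rewrite -[leLHS]mulr1; apply: ler_pM => //; last exact: exprn_ege1.
    by rewrite sumr_ge0.
  by rewrite lerDr.
exists (\sum_ij C ij) => [|k i j]; first by rewrite sumr_ge0 // => ij _; have [] := hC ij.
have [_ h] := hC (i, j); apply: le_trans (h k) _; rewrite ler_wpM2r ?exprn_ge0 //.
by rewrite (bigD1 (i, j)) //= lerDl sumr_ge0 // => ij _; have [] := hC ij.
Qed.

Lemma iter_vec_actE (L : fieldType) (z : 'I_n -> L) k i :
  iter k (vec_act Omega) z i = \prod_j z j ^+ (Omega ^+ k) i j.
Proof.
elim: k i => [|k ih] i.
  rewrite /= (bigD1 i) //= big1 => [|j ji]; first by rewrite expr0 mxE eqxx mulr1.
  by rewrite expr0 mxE eq_sym (negPf ji).
transitivity (\prod_j (\prod_h z h ^+ (Omega ^+ k) j h) ^+ Omega i j).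
  by rewrite iterS; apply: eq_bigr => j _; rewrite ih.
under eq_bigr => j _ do rewrite -prodrXl.
rewrite exchange_big /=; apply: eq_bigr => j _; rewrite exprS mxE.
rewrite -prodrXr /=; apply: eq_bigr => h _.
by rewrite -exprM mulnC.
Qed.

Lemma lheight_orbit (L : fieldType) (F : fieldExtType rat) (h : {rmorphism F -> L})
    (z : 'I_n -> L) : (forall j, exists s : R, lheight h (z j) s) ->
  exists C, forall k j, lheight h (iter k (vec_act Omega) z j) (C * rho ^+ k).
Proof.
move=> /choice[s hs]; have [C C0 hC] := condII_uniform.
have r1 := ltW spectral_radius_gt1; have r0 := spectral_radius_ge0.
exists (\sum_j (C + 1) * s j + min_height R F) => k i; rewrite iter_vec_actE.
have rk1 : 1 <= rho ^+ k by apply: exprn_ege1.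
apply: lheightW (lheight_prod _ (lexx _) (fun j => lheightX _ (hs j))).
rewrite mulrDl; apply: lerD; last by rewrite ler_peMr // min_height_ge0.
rewrite mulr_suml; apply: ler_sum => j _; rewrite mulrAC ler_wpM2r ?(lheight_ge0 (hs j)) //.
by rewrite -natr1 mulrDl mul1r lerD.
Qed.

End OmegaConditions.

(** * Completeness of finite-dimensional subspaces *)

Section FiniteDimensionalCompleteness.
Variables (R : realType) (k E : fieldType) (w : E -> R) (j : {rmorphism k -> E}).
Hypothesis w_abs : is_absval w.
Hypothesis k_complete : abs_complete (w \o j).

Fixpoint in_span (b : seq E) (z : E) : Prop :=
  if b is e :: b' then exists c y, in_span b' y /\ z = j c * e + y else z = 0.

Lemma in_span0 b : in_span b 0.
Proof. by elim: b => //= e b ih; exists 0, 0; rewrite rmorph0 mul0r addr0. Qed.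

Lemma in_spanD b y z : in_span b y -> in_span b z -> in_span b (y + z).
Proof.
elim: b y z => [|e b ih] y z /=; first by move=> -> ->; rewrite addr0.
move=> [c [y' [sy ->]]] [d [z' [sz ->]]]; exists (c + d), (y' + z').
by split; [exact: ih|rewrite rmorphD mulrDl addrACA].
Qed.

Lemma in_spanZ b c y : in_span b y -> in_span b (j c * y).
Proof.
elim: b y => [|e b ih] y /=; first by move=> ->; rewrite mulr0.
move=> [d [z [sz ->]]]; exists (c * d), (j c * z).
by split; [exact: ih|rewrite rmorphM mulrDr mulrA].
Qed.

Lemma in_spanB b y z : in_span b y -> in_span b z -> in_span b (y - z).
Proof.
move=> sy sz; apply: in_spanD => //; rewrite -mulN1r -(rmorph1 j) -rmorphN.
exact: in_spanZ.
Qed.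

Lemma in_span_sum b (I : Type) (s : seq I) (F : I -> E) :
  (forall i, in_span b (F i)) -> in_span b (\sum_(i <- s) F i).
Proof.
move=> h; elim/big_rec: _ => [|i y _]; first exact: in_span0.
exact: in_spanD.
Qed.

Lemma in_span_mem b e : e \in b -> in_span b e.
Proof.
elim: b => //= d b ih; rewrite inE => /orP[/eqP ->|/ih he].
  by exists 1, 0; rewrite rmorph1 mul1r addr0; split=> //; apply: in_span0.
by exists 0, e; rewrite rmorph0 mul0r add0r.
Qed.

Let cauchy (u : nat -> E) := forall e : R, 0 < e -> exists N, forall i h,
  (N <= i)%N -> (N <= h)%N -> w (u i - u h) < e.
Let tendsto (u : nat -> E) x := forall e : R, 0 < e -> exists N, forall i,
  (N <= i)%N -> w (u i - x) < e.

Lemma tendsto_cauchy u x : tendsto u x -> cauchy u.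
Proof.
move=> t e e0; have [N hN] := t (e / 2) (divr_gt0 e0 (ltr0n _ 2)).
exists N => i h /hN hi /hN hh; rewrite [e]splitr.
have -> : u i - u h = (u i - x) + (x - u h) by ring.
by apply: le_lt_trans (absvD w_abs _ _) _; rewrite ltrD // (absv_subC w_abs).
Qed.

Lemma tendsto_uniq u x y : tendsto u x -> tendsto u y -> x = y.
Proof.
move=> tx ty; apply/eqP; rewrite -subr_eq0 -(absv_eq0 w_abs) eq_le absv_ge0 // andbT.
apply: contraT; rewrite -ltNge => e0; set e := w (x - y) in e0.
have [N hN] := tx (e / 2) (divr_gt0 e0 (ltr0n _ 2)).
have [M hM] := ty (e / 2) (divr_gt0 e0 (ltr0n _ 2)).
have h1 := hN _ (leq_maxl N M); have h2 := hM _ (leq_maxr N M).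
suff : e < e by rewrite ltxx.
rewrite {2}[e]splitr; apply: le_lt_trans (ltrD h1 h2).
rewrite /e (_ : x - y = (x - u (maxn N M)) + (u (maxn N M) - y)); last by ring.
by apply: le_trans (absvD w_abs _ _) _; rewrite lerD2r (absv_subC w_abs).
Qed.

Lemma tendsto_of_approx (P : E -> Prop) x :
    (forall e : R, 0 < e -> exists2 y, P y & w (y - x) < e) ->
  exists2 u, (forall i, P (u i)) & tendsto u x.
Proof.
move=> hx; have /choice[u hu] : forall i : nat, exists y, P y /\ w (y - x) < i.+1%:R^-1.
  by move=> i; have [|y Py wy] := hx i.+1%:R^-1; [rewrite invr_gt0 ltr0n|exists y].
exists u => [i|e e0]; first by case: (hu i).
exists (Num.bound e^-1) => i hi; have [_ lt] := hu i; apply: lt_trans lt _.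
rewrite -[e]invrK ltf_pV2 ?posrE ?invr_gt0 ?ltr0n //.
apply: lt_le_trans (archi_boundP _) _; first by rewrite invr_ge0 ltW.
by rewrite ler_nat (leq_trans hi).
Qed.

(** Induction on the spanning list e :: b. If e is in the span of b, drop it. Otherwise that span is
    complete, hence closed, and e has a distance eps > 0 from it; then |c e + y| >= eps |c|, so the
    coefficients of e along a Cauchy sequence are Cauchy. *)
Lemma in_span_complete b u : (forall i, in_span b (u i)) -> cauchy u ->
  exists2 x, in_span b x & tendsto u x.
Proof.
elim: b u => [|e b ih] u su cu.
  by exists 0 => // d d0; exists 0%N => i _; rewrite (su i) subr0 absv0.
have [se|nse] := pselect (in_span b e).
  have [|x sx tx] := ih u _ cu.
    by move=> i; have [c [y [sy ->]]] := su i; apply: in_spanD => //; apply: in_spanZ.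
  by exists x => //; exists 0, x; rewrite rmorph0 mul0r add0r.
have [eps eps0 heps] : exists2 eps, 0 < eps & forall y, in_span b y -> eps <= w (y - e).
  apply: contrapT => no; apply: nse.
  have [|v sv tv] := @tendsto_of_approx (in_span b) e.
    move=> d d0; apply: contrapT => hd; apply: no; exists d => // y sy.
    by rewrite leNgt; apply/negP => lt; apply: hd; exists y.
  have [x sx tx] := ih v sv (tendsto_cauchy tv).
  by rewrite (tendsto_uniq tv tx).
have bound c y : in_span b y -> eps * w (j c) <= w (j c * e + y).
  move=> sy; have [->|c0] := eqVneq c 0.
    by rewrite rmorph0 (absv0 w_abs) mulr0 absv_ge0.
  have jc0 : j c != 0 by rewrite fmorph_eq0.
  have -> : j c * e + y = - (j c * ((j (- c^-1) * y) - e)).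
    by rewrite rmorphN fmorphV; field.
  by rewrite (absvN w_abs) (absvM w_abs) mulrC ler_wpM2l ?absv_ge0 // heps //; apply: in_spanZ.
have /choice[c hc] : forall i, exists c, exists2 y, in_span b y & u i = j c * e + y.
  by move=> i; have [c [y [sy ey]]] := su i; exists c, y.
have wje0 : 0 < w e + 1 by rewrite (le_lt_trans (absv_ge0 w_abs e)) // ltrDl.
have [c0 tc] : exists c0, forall d : R, 0 < d -> exists N, forall i, (N <= i)%N -> w (j (c i - c0)) < d.
  apply: k_complete => d d0; have [N hN] := cu (d * eps) (mulr_gt0 d0 eps0).
  exists N => i h iN hN'; rewrite /= -(ltr_pM2l eps0) [eps * d]mulrC.
  apply: le_lt_trans (hN i h iN hN').
  have [y sy ->] := hc i; have [z sz ->] := hc h.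
  have -> : j (c i) * e + y - (j (c h) * e + z) = j (c i - c h) * e + (y - z).
    by rewrite rmorphB; ring.
  exact/bound/in_spanB.
have tce : tendsto (fun i => j (c i) * e) (j c0 * e).
  move=> d d0; have [N hN] := tc (d / (w e + 1)) (divr_gt0 d0 wje0).
  exists N => i /hN; rewrite ltr_pdivlMr // -mulrBl -rmorphB (absvM w_abs).
  by apply: le_lt_trans; rewrite ler_wpM2l ?absv_ge0 // lerDl.
have cv : cauchy (fun i => u i - j (c i) * e).
  move=> d d0; have d2 : 0 < d / 2 by apply: divr_gt0.
  have [N hN] := cu _ d2; have [M hM] := tendsto_cauchy tce d2.
  exists (maxn N M) => i h; rewrite !geq_max => /andP[iN iM] /andP[hN' hM'].
  rewrite [d]splitr; apply: le_lt_trans (ltrD (hN i h iN hN') (hM i h iM hM')).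
  rewrite -[w (j (c i) * e - _)](absvN w_abs).
  by apply: le_trans (absvD w_abs _ _); rewrite le_eqVlt; apply/orP; left; apply/eqP; congr w; ring.
have sv i : in_span b (u i - j (c i) * e).
  by have [y sy ->] := hc i; rewrite addrC addKr.
have [y sy ty] := ih _ sv cv.
exists (j c0 * e + y); first by exists c0, y.
move=> d d0; have d2 : 0 < d / 2 by apply: divr_gt0.
have [N hN] := ty _ d2; have [M hM] := tce _ d2.
exists (maxn N M) => i; rewrite geq_max => /andP[/hN h1 /hM h2].
rewrite [d]splitr; apply: le_lt_trans (ltrD h1 h2).
by apply: le_trans (absvD w_abs _ _); rewrite le_eqVlt; apply/orP; left; apply/eqP; congr w; ring.
Qed.

End FiniteDimensionalCompleteness.

(** Split off the roots of p one at a time inside the algebraically closed field L. *)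
Lemma root_in_image (L C : fieldType) (j : {rmorphism L -> C}) (p : {poly L}) x :
  GRing.closed_field_axiom L -> p \is monic -> root (map_poly j p) x -> exists y, x = j y.
Proof.
move=> cl; have [d] := ubnP (size p); elim: d p => // d ih p le mp rx.
have lc : p`_(size p).-1 = 1 by move/monicP: mp.
have [n sn] : exists n, size p = n.+2.
  case e: (size p) => [|[|n]]; last by exists n.
    by move/eqP: e; rewrite size_poly_eq0 => /eqP e; move: mp; rewrite e monicE lead_coef0 eq_sym oner_eq0.
  move: rx lc; rewrite e [p]size1_polyC ?e // => rx; rewrite coefC /= => p0.
  by move: rx; rewrite p0 map_polyC rootC /= (rmorph1 j) oner_eq0.
have lc' : p`_n.+1 = 1 by rewrite sn in lc.
have [y hy] := cl n.+1 (fun i => - p`_i) isT.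
have ry : root p y.
  rewrite rootE horner_coef sn big_ord_recr /= hy lc' mul1r.
  by rewrite -big_split big1 //= => i _; rewrite mulNr addrN.
have /factor_theorem[q eq] := ry.
have mq : q \is monic by move: mp; rewrite eq monicMr // monicXsubC.
move: rx; rewrite eq rmorphM rootM rmorphB /= map_polyX map_polyC root_XsubC => /orP[rq|/eqP ->]; last by exists y.
apply: ih rq => //; move: le; rewrite eq size_Mmonic ?monic_neq0 ?monicXsubC //.
by rewrite size_XsubC addn2 ltnS.
Qed.

Lemma condIV_generic (R : realType) pl (M : Cp_model R pl) n (Omega : 'M[nat]_n)
    (z : 'I_n -> Cp M) : cond_IV Omega z ->
  forall f : powser n (Cp M), f != 0 -> converges_near0 (@Cp_abs _ _ M) f ->
    infinitely_many (fun k => ps_val (@Cp_abs _ _ M) f (iter k (vec_act Omega) z) != 0).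
Proof.
move=> h f f0 fc; have {h f0 fc} := h f f0 fc.
case: pl M z f => [|p pp] M z f // /(_ 1%N isT) h N.
by have [k Nk hk] := h N; exists k => //; rewrite mul1n in hk.
Qed.

Lemma condIII_decay (R : realType) pl (M : Cp_model R pl) n (Omega : 'M[nat]_n)
    (z : 'I_n -> Cp M) : (forall j, z j != 0) -> cond_III Omega z ->
  exists2 c, 0 < c & exists N, forall k, (N <= k)%N -> forall j,
    Cp_abs (iter k (vec_act Omega) z j) <= expR (- (c * spectral_radius R Omega ^+ k)).
Proof.
move=> z0 [c c0 [N hN]]; exists c => //; exists N => k kN j.
have v_abs := Cp_absval M.
(* Positivity is what allows the exponential to invert [ln]. *)
have w0 : 0 < Cp_abs (iter k (vec_act Omega) z j).
  rewrite (absv_gt0 v_abs) iter_vec_actE; apply/prodf_neq0 => i _.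
  by rewrite expf_neq0.
rewrite -[leLHS]lnK ?posrE // ler_expR.
by have := hN k kN j; rewrite mulNr.
Qed.

(** By [Cp_abs_dense] there is a point w of the polydisc with |z_j| < |w_j| for all j, and
    convergence at w gives summability at z by Abel's lemma. *)
Lemma summable_in_polydisc (R : realType) pl (M : Cp_model R pl)
    (iota : {rmorphism algC -> Cp M}) n (r : 'I_n -> R) (z : 'I_n -> Cp M) f :
    (forall j, z j != 0) -> polydisc (@Cp_abs _ _ M) r z ->
    converges_on (@Cp_abs _ _ M) (polydisc (@Cp_abs _ _ M) r) f ->
  summable (@Cp_abs _ _ M) (@Cp_abs _ _ M \o z) f.
Proof.
move=> z0 zr fc; have v_abs := Cp_absval M.
have /choice[w hw] : forall j, exists y : Cp M, Cp_abs (z j) < Cp_abs y < r j.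
  by move=> j; apply: (Cp_abs_dense iota) => //; rewrite (absv_gt0 v_abs).
have [j|s hs] := fc w; first by case/andP: (hw j).
by apply: (summable_of_ps_sum v_abs _ hs) => j; case/andP: (hw j).
Qed.

Lemma number_field_of_values (K : fieldExtType rat) (sigma : {rmorphism K -> algC})
    n (z : 'I_n -> algC) :
  exists (F : fieldExtType rat) (h : {rmorphism F -> algC}),
    (forall j, exists a, z j = h a) /\ (forall c, exists a, sigma c = h a).
Proof.
pose s := [seq z j | j <- enum 'I_n] ++ [seq sigma c | c <- vbasis (fullv : {vspace K})].
have [F [h [t et _]]] := num_field_exists s; exists F, h.
have im x : x \in s -> exists a, x = h a.
  by rewrite -et => /mapP[a _ ->]; exists a.
split=> [j|c]; first by apply: im; rewrite mem_cat map_f ?mem_enum.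
have /choice[a ha] : forall i : 'I_(\dim (fullv : {vspace K})), exists a,
    sigma (vbasis fullv)`_i = h a.
  by move=> i; apply: im; rewrite mem_cat (map_f sigma) ?orbT ?mem_nth ?size_tuple.
exists (\sum_i coord (vbasis fullv) i c *: a i).
rewrite {1}(coord_vbasis (memvf c)) !rmorph_sum; apply: eq_bigr => i _.
by rewrite !rmorphZ_num ha.
Qed.

Lemma rmorph_rat_eq (L : fieldType) (f g : {rmorphism rat -> L}) : f =1 g.
Proof. by move=> x; rewrite !fmorph_eq_rat. Qed.

(** The image of the number field F consists of algebraic numbers, so it lies in the closure of Q_p
    and spans there a finite-dimensional Q_p-space. This space is complete, hence contains the
    limits of its elements. *)
Lemma in_Qpbar_limit (R : realType) pl (M : Cp_model R pl) (F : fieldExtType rat)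
    (h : {rmorphism F -> Cp M}) (x : Cp M) :
  (forall e : R, 0 < e -> exists a, Cp_abs (h a - x) < e) -> in_Qpbar x.
Proof.
case: M h x => [//|p pp T] h x /= hx.
pose j1 := Qpbar_Cpadic T; pose j0 := Qp_Qpbar T.
have [_ e1 _ _] := Cpadic_completion T; have [_ e2 _ c2] := Qp_completion T.
have [cl _] := Qpbar_closure T.
have k_complete : abs_complete (@Qpbar_abs _ _ T \o j0).
  by have -> : @Qpbar_abs _ _ T \o j0 = @Qp_abs _ _ T by apply: funext => y; apply: Qpbar_extends.
have hQ a : h (a%:A) = j1 (j0 (rat_Qp T a)).
  exact: (rmorph_rat_eq (h \o in_alg F) (j1 \o (j0 \o rat_Qp T))).
have hZ a y : h (a *: y) = j1 (j0 (rat_Qp T a)) * h y.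
  by rewrite -hQ -rmorphM mulr_algl.
pose B := vbasis (fullv : {vspace F}).
have /choice[b hb] : forall i : 'I_(\dim (fullv : {vspace F})), exists y, h B`_i = j1 y.
  move=> i; set y := B`_i.
  have /polyOver1P[q eq] := minPolyOver 1 y.
  have mq : q \is monic by rewrite -(map_monic (in_alg F)) -eq monic_minPoly.
  have := root_minPoly 1 y; rewrite eq => rq.
  apply: (@root_in_image _ _ j1 (map_poly (j0 \o rat_Qp T) q)) => //.
    by rewrite map_monic.
  rewrite -map_poly_comp (eq_map_poly (g := h \o in_alg F)) => [|a]; last exact/esym/hQ.
  by rewrite map_poly_comp rootE horner_map (eqP rq) rmorph0.
have spanF a : exists2 y, in_span j0 [seq b i | i <- enum 'I_(\dim (fullv : {vspace F}))] y & h a = j1 y.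
  exists (\sum_i j0 (rat_Qp T (coord B i a)) * b i).
    by apply: in_span_sum => i; apply/in_spanZ/in_span_mem/map_f; rewrite mem_enum.
  rewrite {1}(coord_vbasis (memvf a)) !rmorph_sum; apply: eq_bigr => i _.
  by rewrite hZ hb [RHS]rmorphM.
have vC := Cp_absval (PadicModel pp T); have vQ := Qpbar_absval T.
have [|u hu tu] := @tendsto_of_approx _ _ (@Cpadic_abs _ _ T) (fun y => exists a, y = h a) x.
  by move=> e /hx[a ha]; exists (h a) => //; exists a.
have /choice[y hy] : forall i, exists y,
    in_span j0 [seq b i | i <- enum 'I_(\dim (fullv : {vspace F}))] y /\ u i = j1 y.
  by move=> i; have [a ->] := hu i; have [y sy ey] := spanF a; exists y.
have sy i : in_span j0 [seq b i | i <- enum 'I_(\dim (fullv : {vspace F}))] (y i).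
  by case: (hy i).
have [|z _ tz] := in_span_complete vQ k_complete sy.
  move=> e /(tendsto_cauchy vC tu)[N hN]; exists N => i k iN kN.
  by rewrite -e1 rmorphB; case: (hy i) (hy k) => [_ <-] [_ <-]; apply: hN.
exists z; apply: (tendsto_uniq vC tu) => e /tz[N hN]; exists N => i /hN.
by rewrite -e1 rmorphB; case: (hy i) => _ <-.
Qed.

Lemma mmap_map_mpoly n (K L : comNzRingType) (kap : {rmorphism K -> L}) (z : 'I_n -> L)
    (q : {mpoly K[n]}) : mmap idfun z (map_mpoly kap q) = mmap kap z q.
Proof.
rewrite /map_mpoly (rmorph_mmap (mmap idfun z)); apply: eq_mmap => [c|i] /=.
  by rewrite mmapC.
by rewrite mmapX mmap1U.
Qed.

Lemma ratfun_value_frac (R : realType) (L K : fieldType) (v : L -> R) (n : nat)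
    (Omega : 'M[nat]_n) (Omega_det : \det (mx_rat Omega) != 0) (alpha : 'I_n -> L)
    (kap : {rmorphism K -> L}) b r y : is_absval v -> abs_complete v ->
    ratfun_value kap b (iter r (vec_act Omega) alpha) y ->
  frac_value v alpha (iter r (subst_frac L Omega_det)
    (map_frac (@map_ps n K L kap) (ratfun_ps b))) y.
Proof.
move=> v_abs v_complete [N [D [-> D0 ->]]].
have m q : mmap kap (iter r (vec_act Omega) alpha) q =
    mmap idfun (iter r (vec_act Omega) alpha) (map_mpoly kap q) by rewrite mmap_map_mpoly.
have D0' : D != 0 by apply: contraNneq D0 => ->; rewrite rmorph0.
rewrite /ratfun_ps (map_fracE (@poly_ps_inj n K)) // map_fracE; last 2 first.
- exact: map_ps_inj.
- by rewrite -(rmorph0 (@poly_ps n K)) (inj_eq (@poly_ps_inj n K)).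
by rewrite /= !map_ps_poly !m; apply: ratfun_frac_value => //; rewrite -m.
Qed.

Lemma geometric_sum_le (R : realType) (rho : R) k : 1 < rho ->
  \sum_(0 <= r < k) rho ^+ r <= rho ^+ k / (rho - 1).
Proof.
move=> r1; have d0 : 0 < rho - 1 by rewrite subr_gt0.
by rewrite big_mkord ler_pdivlMr // mulrC -subrX1 gerBl.
Qed.

(** * Heights of the iterated functional equations *)

Section IteratedHeights.
Variables (R : realType) (L : fieldType) (F : fieldExtType rat) (h : {rmorphism F -> L}).
Variable rho : R.
Hypothesis rho_gt1 : 1 < rho.
Notation mh := (min_height R F).

Lemma lheight_finsum (I : Type) (r : seq I) (x : I -> L) (s : I -> R) :
  (forall i, lheight h (x i) (s i)) ->
  lheight h (\sum_(i <- r) x i) (\sum_(i <- r) s i + mh).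
Proof.
move=> hx; elim/big_rec2: _ => [|i t y _ ih]; first by rewrite add0r; apply: (lheight_nat h (m := 0)).
by rewrite -addrA; apply: lheightD.
Qed.

Let rho_X k : 1 <= rho ^+ k. Proof. by rewrite exprn_ege1 // ltW. Qed.

(** Heights O(rho^r) at the steps r < k add up to O(rho^k), which is why t_k is no larger in height
    than Omega^k alpha up to a constant. *)
Lemma geometric_height (C : R) k : 0 <= C ->
  \sum_(0 <= r < k) C * rho ^+ r + mh <= (C / (rho - 1) + mh) * rho ^+ k.
Proof.
move=> C0; rewrite mulrDl; apply: lerD; last by rewrite ler_peMr // min_height_ge0.
by rewrite -mulr_sumr -mulrA ler_wpM2l // mulrC geometric_sum_le.
Qed.

Lemma lheight_iterated_prod m (y : nat -> 'I_m -> L) :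
    (exists C, forall r i, lheight h (y r i) (C * rho ^+ r)) ->
  exists C, forall k i, lheight h (\prod_(0 <= r < k) y r i) (C * rho ^+ k).
Proof.
move=> [C hC]; exists (`|C| / (rho - 1) + mh) => k i.
apply: lheightW (geometric_height k (normr_ge0 C)) _.
apply: lheight_prod => // r; apply: (lheightW _ (hC r i)).
by rewrite ler_wpM2r ?ler_norm // (le_trans ler01).
Qed.

Lemma lheight_iterated_sum l (A : 'M[L]_l) (y : nat -> 'I_l -> L) :
    (forall i j, exists s : R, lheight h (A i j) s) ->
    (exists C, forall r i, lheight h (y r i) (C * rho ^+ r)) ->
  exists C, forall k i,
    lheight h (\sum_(0 <= r < k) \sum_j (A ^+ r) i j * y r j) (C * rho ^+ k).
Proof.
move=> /lheight_mxpow[D hD] [C hC]; have [E E0 hE] := linear_le_pow rho_gt1.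
pose B := \sum_(j < l) (`|D| * E + `|C|) + mh.
have B0 : 0 <= B.
  by rewrite addr_ge0 ?min_height_ge0 // sumr_ge0 // => j _; rewrite addr_ge0 // mulr_ge0 // ltW.
exists (B / (rho - 1) + mh) => k i.
apply: lheightW (geometric_height k B0) _; apply: lheight_finsum => r.
have step j : lheight h ((A ^+ r) i j * y r j) ((`|D| * E + `|C|) * rho ^+ r).
  rewrite mulrDl; apply: lheightM.
    apply: (lheightW _ (hD r i j)); apply: (@le_trans _ _ (`|D| * r.+1%:R)).
      by rewrite ler_wpM2r // ler_norm.
    by rewrite -mulrA ler_wpM2l.
  by apply: (lheightW _ (hC r j)); rewrite ler_wpM2r ?ler_norm // (le_trans ler01).
apply: lheightW (lheight_finsum _ step); rewrite /B [leRHS]mulrDl mulr_suml lerD //.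
by rewrite ler_peMr // min_height_ge0.
Qed.

End IteratedHeights.

Lemma lheight_ratfun_orbit (R : realType) (L : fieldType) (v : L -> R) :
    is_absval v -> (forall d, (0 < d)%N -> (d%:R : R)^-1 <= v d%:R) ->
  forall (F : fieldExtType rat) (h : {rmorphism F -> L}) (K : fieldType)
    (kap : {rmorphism K -> L}) n (rho : R) (z : nat -> 'I_n -> L) N
    (b : 'I_N -> {fraction {mpoly K[n]}}) (y : nat -> 'I_N -> L),
  1 < rho -> (forall c, exists s : R, lheight h (kap c) s) ->
  (exists C, forall k j, lheight h (z k j) (C * rho ^+ k)) ->
  (forall k i, ratfun_value kap (b i) (z k) (y k i)) ->
  exists C, forall k i, lheight h (y k i) (C * rho ^+ k).
Proof.
move=> v_abs v_nat F h K kap n rho z N b y r1 hk [C hC] hy.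
have /choice[D hD] : forall i, exists D, 0 <= D /\ forall x s y, min_height R F <= s ->
    (forall j, lheight h (x j) s) -> ratfun_value kap (b i) x y -> lheight h y (D * s).
  by move=> i; have [D D0 hD] := lheight_ratfun v_abs v_nat hk (b i); exists D.
have rX k : 1 <= rho ^+ k by rewrite exprn_ege1 // ltW.
have rX0 k : 0 <= rho ^+ k by apply: le_trans (rX k).
pose B := `|C| + min_height R F.
have B0 : 0 <= B by rewrite addr_ge0 ?min_height_ge0.
exists ((\sum_i D i) * B) => k i; have [D0 hDi] := hD i.
apply: (@lheightW _ _ _ _ _ (D i * (B * rho ^+ k))).
  rewrite mulrA ler_wpM2r // ler_wpM2r //.
  by rewrite (bigD1 i) //= lerDl sumr_ge0 // => j _; case: (hD j).
apply: (hDi (z k)) => //.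
  by rewrite (@le_trans _ _ B) ?ler_peMr // lerDr.
move=> j; apply: (lheightW _ (hC k j)); rewrite ler_wpM2r //.
by rewrite (le_trans (ler_norm C)) // lerDl min_height_ge0.
Qed.

Section MapSeriesFractions.
Variables (n : nat) (K L : fieldType) (kap : {rmorphism K -> L}).

Let mapk : {rmorphism powser n K -> powser n L} := @map_ps n K L kap.
Let mapk_inj : injective mapk := map_ps_inj (kap := kap).

Definition map_ps_frac := map_frac_rmorphism mapk_inj.

Lemma map_ps_frac_ps q : map_ps_frac q%:F = (map_ps kap q)%:F.
Proof. exact: (map_frac_tofrac mapk_inj). Qed.

Lemma map_ps_frac_cst c :
  map_ps_frac (ratfun_ps (c%:MP_[n])%:F) = (ps_cst n (kap c))%:F.
Proof.
by rewrite /ratfun_ps (map_frac_tofrac (@poly_ps_inj n K)) map_ps_frac_ps map_ps_cst.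
Qed.

End MapSeriesFractions.

Lemma join_fam_map (S T : Type) (phi : S -> T) l m (f : 'I_l -> S) (g : 'I_m -> S) :
  (fun i => phi (join_fam f g i)) = join_fam (fun i => phi (f i)) (fun i => phi (g i)).
Proof. by apply: funext => i; rewrite /join_fam; case: split. Qed.

(** * Reduction of the theorem to the core argument *)

Theorem theorem3p5 (R : realType) (p : place) (M : Cp_model R p)
    (iota : {rmorphism algC -> Cp M})
    (K : fieldExtType rat) (sigma : {rmorphism K -> algC})
    (n l m : nat) (n_gt0 : (0 < n)%N) (Omega : 'M[nat]_n)
    (f : 'I_l -> powser n K) (g : 'I_m -> powser n K)
    (A : 'M[K]_l)
    (b : 'I_l -> {fraction {mpoly K[n]}}) (e : 'I_m -> {fraction {mpoly K[n]}})
    (r : 'I_n -> R) (alpha : 'I_n -> algC) :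
  let kappa := fun x : K => iota (sigma x) in
  let alphap := fun j : 'I_n => iota (alpha j) in
  let U := polydisc (@Cp_abs R p M) r in
  let val := fun q : powser n K =>
    ps_val (@Cp_abs R p M) (map_ps kappa q) alphap in
  (forall j, 0 < r j) ->
  (forall h, pcoef (g h) 0%MM != 0) ->
  (forall i, converges_on (@Cp_abs R p M) U (map_ps kappa (f i))) ->
  (forall h, converges_on (@Cp_abs R p M) U (map_ps kappa (g h))) ->
  \col_i (f i)%:F =
    map_mx (fun a : K => ratfun_ps (a%:MP_[n])%:F) A
      *m (\col_i (subst_ps Omega (f i))%:F)
    + \col_i ratfun_ps (b i) ->
  (forall h, (g h)%:F = ratfun_ps (e h) * (subst_ps Omega (g h))%:F) ->
  U alphap ->
  (forall j, alpha j != 0) ->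
  cond_I R Omega ->
  cond_II R Omega ->
  cond_III Omega alphap ->
  cond_IV Omega alphap ->
  (forall i k, exists y,
     ratfun_value kappa (b i) (iter k (vec_act Omega) alphap) y) ->
  (forall h k, exists2 y,
     ratfun_value kappa (e h) (iter k (vec_act Omega) alphap) y & y != 0) ->
  alg_independent (@ratfun_ps n K)
    (join_fam (fun i => (f i)%:F) (fun h => (g h)%:F)) ->
  (forall i, in_Qpbar (val (f i))) /\
  (forall h, in_Qpbar (val (g h))) /\
  alg_independent (fun x : rat => iota (ratr x))
    (join_fam (fun i => val (f i)) (fun h => val (g h))).
Proof.
move=> kappa alphap U val r_gt0 g0 fU gU f_eq g_eq alphaU alpha0 OI OII OIII OIV b_def e_def ind.
pose v := @Cp_abs R p M.
have v_abs : is_absval v := Cp_absval M.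
have v_complete : abs_complete v := @Cp_complete R p M.
have v_nat d : (0 < d)%N -> (d%:R : R)^-1 <= v d%:R := @Cp_abs_nat R p M d.
have [Omega_det _] := OI.
have Omega_unity := condI_unity n_gt0 OI.
have rho1 := spectral_radius_gt1 n_gt0 OI OII.
pose rho := spectral_radius R Omega.
pose kap : {rmorphism K -> Cp M} := iota \o sigma.
pose orb k := iter k (vec_act Omega) alphap.
have alphap0 j : alphap j != 0 by rewrite fmorph_eq0.
(* All heights are taken in one number field, containing the components of alpha and the image of
   K. *)
have [F [QsC [alphaF sigmaF]]] := number_field_of_values sigma alpha.
pose h : {rmorphism F -> Cp M} := iota \o QsC.
have kap_im c : exists a, kap c = h a by have [a ea] := sigmaF c; exists a; rewrite /= ea.
have alpha_im j : exists a, alphap j = h a.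
  by have [a ea] := alphaF j; exists a; rewrite /alphap ea.
have kap_height c : exists s : R, lheight h (kap c) s.
  by have [a ->] := kap_im c; apply: lheight_field.
pose f' i := map_ps kap (f i); pose g' i := map_ps kap (g i).
have sf i : summable v (v \o alphap) (f' i).
  exact: (summable_in_polydisc iota alphap0 alphaU (fU i)).
have sg i : summable v (v \o alphap) (g' i).
  exact: (summable_in_polydisc iota alphap0 alphaU (gU i)).
(* As delta is at most every |alpha_j|, summability at alpha passes to the polydisc of radius delta,
   which the orbit eventually enters. *)
have [delta [delta0 delta1 hdelta]] : exists delta : R, [/\ 0 < delta, delta <= 1 &
    forall j, delta <= v (alphap j)].
  exists (\big[Num.min/1]_j v (alphap j)); split.
  - by elim/big_ind: _ => // [x y x0 y0|j _]; rewrite ?lt_min ?x0 // (absv_gt0 v_abs).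
  - by elim/big_rec: _ => // j x _ x1; rewrite ge_min x1 orbT.
  - by move=> j; rewrite (bigD1 j) //= ge_min lexx.
have sW q : summable v (v \o alphap) q -> summable v (fun=> delta) q.
  by move=> [B hB]; exists B; apply: (norm_leW v_abs _ hB) => j; rewrite (ltW delta0) hdelta.
have orb_height : exists C, forall k j, lheight h (orb k j) (C * rho ^+ k).
  apply: (lheight_orbit n_gt0 OI OII) => j.
  by have [a ->] := alpha_im j; apply: lheight_field.
have [c0 c00 decay] := condIII_decay alphap0 OIII.
have /choice[yb hyb] : forall k, exists y : 'I_l -> Cp M, forall i,
    ratfun_value kap (b i) (orb k) (y i).
  by move=> k; have /choice[y hy] := fun i => b_def i k; exists y.
have /choice[ye hye] : forall k, exists y : 'I_m -> Cp M, forall i,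
    ratfun_value kap (e i) (orb k) (y i) /\ y i != 0.
  move=> k; have /choice[y hy] : forall i, exists y, ratfun_value kap (e i) (orb k) y /\ y != 0.
    by move=> i; have [y] := e_def i k; exists y.
  by exists y.
have yb_height : exists C, forall k i, lheight h (yb k i) (C * rho ^+ k).
  exact: (lheight_ratfun_orbit v_abs v_nat rho1 kap_height orb_height hyb).
have ye_height : exists C, forall k i, lheight h (ye k i) (C * rho ^+ k).
  have hye1 k i : ratfun_value kap (e i) (orb k) (ye k i) by case: (hye k i).
  exact: (lheight_ratfun_orbit v_abs v_nat rho1 kap_height orb_height hye1).
pose A' := map_mx kap A.
have A'_height i j : exists s : R, lheight h (A' i j) s by rewrite mxE.
have detA : \det A != 0 := mahler_matrix_invertible f_eq ind.
have A'_unit : A' \in unitmx by rewrite map_unitmx unitmxE unitfE.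
have A'_exp i j : exp_poly idfun (fun k => (A' ^+ k) i j).
  have [s es] := closed_field_poly_normal (map_poly sigma (char_poly A)).
  have es' : map_poly kap (char_poly A) = \prod_(x <- map iota s) ('X - x%:P).
    rewrite (map_poly_comp iota sigma) es lead_coef_map (monicP (char_poly_monic A)) rmorph1 scale1r.
    rewrite rmorph_prod big_map; apply: eq_bigr => x _.
    by rewrite rmorphB /= map_polyX map_polyC.
  have -> : (fun k => (A' ^+ k) i j) = fun k => kap ((A ^+ k) i j).
    by apply: funext => k; rewrite /A' -map_mx_exp mxE.
  exact: (exp_poly_mxpow i j detA es').
pose Psi := map_ps_frac n kap.
have f'_eq i : (f' i)%:F = \sum_j (ps_cst n (A' i j))%:F * (subst_ps Omega (f' j))%:F +
    Psi (ratfun_ps (b i)).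
  have := congr1 (fun X : 'cV_l => Psi (X i 0)) f_eq; rewrite !mxE rmorphD rmorph_sum /Psi map_ps_frac_ps => ->.
  congr (_ + _); apply: eq_bigr => j _.
  by rewrite !mxE rmorphM map_ps_frac_cst map_ps_frac_ps map_ps_subst.
have g'_eq i : (g' i)%:F = Psi (ratfun_ps (e i)) * (subst_ps Omega (g' i))%:F.
  by rewrite -map_ps_frac_ps g_eq rmorphM map_ps_frac_ps map_ps_subst.
pose u k i := \sum_(0 <= r < k) \sum_j (A' ^+ r) i j * yb r j.
pose w k i := \prod_(0 <= r < k) ye r i.
have [N0 orb_delta] : exists N, forall k, (N <= k)%N -> forall j, v (orb k j) <= delta.
  exact: (orb_small rho1 c00 decay delta0).
have fa_iter k : (N0 <= k)%N -> forall i,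
    val (f i) = \sum_j (A' ^+ k) i j * ps_val v (f' j) (orb k) + u k i.
  move=> /orb_delta kd; apply: (additive_iterated_value v_abs v_complete kd f'_eq) => // [q i|i].
    exact: (ratfun_value_frac Omega_det v_abs v_complete (hyb q i)).
  exact: sW.
have ga_iter k : (N0 <= k)%N -> forall i, val (g i) = w k i * ps_val v (g' i) (orb k).
  move=> /orb_delta kd i; apply: (multiplicative_iterated_value v_abs v_complete kd (g'_eq i)) => // [q|].
    by have [he _] := hye q i; apply: (ratfun_value_frac Omega_det v_abs v_complete he).
  exact: sW.
(* g(alpha) = w_k g(Omega^k alpha), where w_k is a product of nonzero values of e and g has no zero
   near the origin because g(0) != 0. *)
have ga_neq0 i : val (g i) != 0.
  have gi0 : pcoef (g' i) 0%MM != 0 by rewrite fmorph_eq0.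
  have [eta /andP[eta0 _] heta] := ps_val_near0_ge v_abs v_complete delta0 (sW _ (sg i)) gi0.
  have [N1 hN1] := orb_small rho1 c00 decay eta0.
  rewrite (ga_iter (maxn N0 N1)) ?leq_maxl // mulf_neq0 //.
    by rewrite /w big_mkord; apply/prodf_neq0 => k _; case: (hye k i).
  rewrite -(absv_gt0 v_abs); apply: lt_le_trans (heta _ (hN1 _ (leq_maxr _ _))).
  by rewrite divr_gt0 // (absv_gt0 v_abs).
(* The finite partial sums at alpha lie in the image of F and approach the value. *)
have in_bar q : summable v (v \o alphap) (map_ps kap q) -> in_Qpbar (val q).
  move=> sq; apply: (in_Qpbar_limit (h := h)) => d d0.
  have [S0 hS0] := ps_valP v_abs v_complete (fun j => lexx _) sq d0.
  have /choice[z hz] := alpha_im; have /choice[c hc] := kap_im.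
  exists (\sum_(k <- undup S0) c (pcoef q k) * mmap1 z k).
  have -> : h (\sum_(k <- undup S0) c (pcoef q k) * mmap1 z k) =
      \sum_(k <- undup S0) pcoef (map_ps kap q) k * mmap1 alphap k.
    rewrite rmorph_sum; apply: eq_bigr => k _; rewrite rmorphM -hc; congr (_ * _).
    by rewrite /mmap1 rmorph_prod; apply: eq_bigr => j _; rewrite rmorphXn hz.
  by apply: hS0; rewrite ?undup_uniq // => x; rewrite mem_undup.
split; first exact: (fun i => in_bar (f i) (sf i)).
split; first exact: (fun i => in_bar (g i) (sg i)).
move=> P P0; pose ratC : {rmorphism rat -> Cp M} := iota \o ratr.
apply: (map_mpoly_inj (kap := ratC)); rewrite rmorph0.
have g'0 i : pcoef (g' i) 0%MM != 0 by rewrite fmorph_eq0.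
have ind' (q : {mpoly {mpoly (Cp M)[n]}[l + m]}) :
    mmap (@poly_ps n (Cp M)) (join_fam f' g') q = 0 -> q = 0.
  rewrite -(join_fam_map (map_ps kap)); apply: alg_independent_base_change.
  by rewrite (join_fam_map (fun x : powser n K => x%:F)).
have t_height : exists C, forall k i, lheight h (join_fam (u k) (w k) i) (C * rho ^+ k).
  have [C1 h1] := lheight_iterated_sum rho1 A'_height yb_height.
  have [C2 h2] := lheight_iterated_prod rho1 ye_height.
  exists (Num.max C1 C2) => k i; have rk : 0 <= rho ^+ k.
    by rewrite exprn_ge0 // ltW // (lt_trans ltr01).
  by rewrite /join_fam; case: split => j;
    [apply: (lheightW _ (h1 k j))|apply: (lheightW _ (h2 k j))];
    rewrite ler_wpM2r // le_max lexx ?orbT.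
have P_height k : exists s : R, lheight h (map_mpoly ratC P)@_k s.
  have eP : (map_mpoly ratC P)@_k = h (in_alg F P@_k).
    by rewrite mcoeff_map_mpoly; exact: (rmorph_rat_eq ratC (h \o in_alg F)).
  by rewrite eP; apply: lheight_field.
have P_root : mmap idfun (join_fam (fun i => val (f i)) (fun i => val (g i)))
    (map_mpoly ratC P) = 0 by rewrite mmap_map_mpoly.
exact: (core_independence v_abs v_complete v_nat Omega_det Omega_unity
  (condIV_generic OIV) rho1 c00 delta0 delta1 decay orb_height
  (fun i => sW _ (sf i)) (fun i => sW _ (sg i)) (fun i k => kap_height _)
  (fun i k => kap_height _) A'_height A'_unit A'_exp g'0 ind' t_height
  (ex_intro _ N0 fa_iter) (ex_intro _ N0 ga_iter) ga_neq0 P_height P_root).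
Qed.
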